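(* \textsc{Colorful Cut} is {\sf NP}-complete when restricted to instances whose underlying graph is a complete graph.
   Context: An edge-colored graph is a graph $G=(V,E)$ together with a (not necessarily proper) map $c:E\to\{1,2,\ldots,p\}$. For a proper subset $S\subset V$, the edge cut $\partial S$ is the set of edges with one endpoint in $S$ and the other in $V\setminus S$, and $c(\partial S)=\{c(e): e\in\partial S\}$. \textsc{Colorful Cut}: given a graph $G=(V,E)$ with an edge coloring $c:E\to\{1,\ldots,p\}$, decide whether there is a proper subset $S\subset V$ with $|c(\partial S)|=p$. *)

(* Defs.v *)
From mathcomp Require Import all_boot.
Set Implicit Arguments.
Unset Strict Implicit.
Unset Printing Implicit Defensive.

(* Turing machines: one two-way-infinite tape, finite state set,      *)
(* finite tape alphabet with a blank, input bits written via [inp],   *)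
(* halting states labelled accept (Some true) / reject (Some false);  *)
(* the output of a halted machine is read from the head rightwards    *)
(* until the first symbol that [outp] does not decode to a bit.       *)
Inductive dir := MoveL | MoveR | Stay.

Record TM := {
  tQ : finType;
  tG : finType;
  blank : tG;
  inp : bool -> tG;
  outp : tG -> option bool;
  q0 : tQ;
  haltst : tQ -> option bool;
  delta : tQ -> tG -> tQ * tG * dir
}.
Arguments blank : clear implicits.
Arguments inp : clear implicits.
Arguments outp : clear implicits.
Arguments q0 : clear implicits.
Arguments haltst : clear implicits.
Arguments delta : clear implicits.

(* configuration: state, tape left of head (nearest first), symbol under
   the head, tape right of head (nearest first); blanks beyond. *)
Definition config (M : TM) := (tQ M * seq (tG M) * tG M * seq (tG M))%type.

Definition init (M : TM) (x : seq bool) : config M :=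
  match map (inp M) x with
  | [::] => (q0 M, [::], blank M, [::])
  | a :: r => (q0 M, [::], a, r)
  end.

Definition step (M : TM) (cf : config M) : config M :=
  let: (q, l, a, r) := cf in
  if haltst M q is Some _ then cf else
  let: (q', g, d) := delta M q a in
  match d with
  | Stay => (q', l, g, r)
  | MoveL => match l with
             | [::] => (q', [::], blank M, g :: r)
             | b :: l' => (q', l', b, g :: r)
             end
  | MoveR => match r with
             | [::] => (q', g :: l, blank M, [::])
             | b :: r' => (q', g :: l, b, r')
             end
  end.

Definition run (M : TM) (k : nat) (x : seq bool) : config M :=
  iter k (step (M := M)) (init M x).

Definition cstate (M : TM) (cf : config M) : tQ M :=
  let: (q, _, _, _) := cf in q.

Fixpoint take_some (s : seq (option bool)) : seq bool :=
  match s with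
  | Some b :: s' => b :: take_some s'
  | _ => [::]
  end.

Definition output (M : TM) (cf : config M) : seq bool :=
  let: (_, _, a, r) := cf in take_some (map (outp M) (a :: r)).

Definition language := seq bool -> Prop.

Definition pbound (c n : nat) : nat := c * n ^ c + c.

Definition decides_in (M : TM) (L : language) (T : nat -> nat) : Prop :=
  forall x, exists k, k <= T (size x) /\
    exists b, haltst M (cstate (run M k x)) = Some b /\ (b = true <-> L x).

Definition computes_in (M : TM) (f : seq bool -> seq bool) (T : nat -> nat) :=
  forall x, exists k, k <= T (size x) /\
    haltst M (cstate (run M k x)) <> None /\ output (run M k x) = f x.

Definition inP (L : language) : Prop :=
  exists (M : TM) (c : nat), decides_in M L (pbound c).

Definition poly_computable (f : seq bool -> seq bool) : Prop :=
  exists (M : TM) (c : nat), computes_in M f (pbound c).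

(* self-delimiting pairing of binary strings: bits of x doubled, then 01, then y *)
Definition pair_enc (x y : seq bool) : seq bool :=
  flatten [seq [:: b; b] | b <- x] ++ [:: false; true] ++ y.

Definition inNP (L : language) : Prop :=
  exists (V : language) (c : nat), inP V /\
    forall x, L x <-> exists y, size y <= pbound c (size x) /\ V (pair_enc x y).

Definition reduces (L1 L2 : language) : Prop :=
  exists f, poly_computable f /\ forall x, L1 x <-> L2 (f x).

Definition NP_hard (L : language) : Prop :=
  forall L', inNP L' -> reduces L' L.

Definition NP_complete (L : language) : Prop := inNP L /\ NP_hard L.

(* Vertex set 'I_n; edges of K_n listed as pairs (i,j) with i < j in   *)
(* lexicographic order; a coloring is the list of colors of these     *)
(* edges, each in {1,...,p}.                                          *)
Definition edgesK (n : nat) : seq ('I_n * 'I_n) :=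
  [seq (i, j) | i : 'I_n <- enum 'I_n,
                j : 'I_n <- [seq j : 'I_n <- enum 'I_n | (i < j)%N]].

Definition valid_coloring (n p : nat) (cs : seq nat) : bool :=
  (size cs == size (edgesK n)) && all (fun k => (1 <= k <= p)) cs.

Definition crosses (n : nat) (S : {set 'I_n}) (e : 'I_n * 'I_n) : bool :=
  (e.1 \in S) != (e.2 \in S).

Definition cut_colors (n : nat) (cs : seq nat) (S : {set 'I_n}) : seq nat :=
  undup [seq ec.2 | ec <- zip (edgesK n) cs & crosses S ec.1].

Definition colorful_cut (n p : nat) (cs : seq nat) : Prop :=
  exists S : {set 'I_n}, S != setT /\ size (cut_colors cs S) = p.

Fixpoint bits_aux (fuel k : nat) : seq bool :=
  match fuel with
  | 0 => [::]
  | f.+1 => if k == 0 then [::] else odd k :: bits_aux f k./2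
  end.
Definition bits (k : nat) : seq bool := bits_aux k k.

(* self-delimiting encoding of a natural: doubled bits, then 01 *)
Definition enc_nat (k : nat) : seq bool :=
  flatten [seq [:: b; b] | b <- bits k] ++ [:: false; true].

Definition enc_nats (s : seq nat) : seq bool := flatten (map enc_nat s).

Definition enc_instance (n p : nat) (cs : seq nat) : seq bool :=
  enc_nats [:: n, p & cs].

Definition ColorfulCut_complete : language :=
  fun x => exists n p cs,
    x = enc_instance n p cs /\ valid_coloring n p cs /\ colorful_cut n p cs.

(* Main.v *)
(* Machines are programmed in a small language of bounded loops over registers, whose values are
   marks on the cells of a single tape. Increments saturate at a bound held in a register, so the
   running time of a program is a polynomial in that bound, by induction on the program alone.

   A verifier reads n, p, the sides of the vertices and the colours in unary from the certificate,
   re-encodes the instance and compares it with the input.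

   For hardness, the tableau of a verifying machine becomes a set of clauses. These only say that
   the true variables contain the content of the initial row for some certificate, are closed under
   the transition rule, and contain no rejecting state; no uniqueness constraint is needed, since
   the actual run is then forced to be true. A clause becomes a pair of vertices joined to the
   literals by edges of one colour. A uniquely coloured path through these pairs fixes their sides,
   so that the colour is on the cut exactly when the clause is true. All remaining edges get one
   dummy colour, which is then always on the cut. *)
Require Import Defs.
From mathcomp Require Import all_boot.
From mathcomp Require Import zify.
From Stdlib Require Import FunctionalExtensionality.

Set Implicit Arguments.
Unset Strict Implicit.
Unset Printing Implicit Defensive.

(** * Composable machines on a half-infinite tape *)

(** Every instruction starts and ends with the head on a flagged origin cell, so compiled programs
    compose without any knowledge of head positions, and a primitive costs a few sweeps, linear in
    the bound. The bound itself only grows by [Grow]; a fixed number of squarings dominates any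
    polynomial. The verifier contains no decoder: numbers guessed in unary are encoded and compared
    with the input. Its behaviour is described for every certificate, malformed ones included. In
    the tableau, index [i] of row [t] speaks of cell [i + t]. A window of three contents then starts
    at the very index that it determines in the next row, so no index is ever decremented and no
    boundary clause is needed. The price is that the controlled part of a row shrinks by two per
    step, for which the width leaves room. The reduction must print the edge colours in
    lexicographic order. Clause vertices therefore precede variable vertices, and the rows come from
    counters over times and cells together with finite lists, depending only on the machine, that
    are unrolled in the program. *)

Section Machines.
Variable G : finType.

(** The next state [None] is the only exit; the exiting transition still writes and moves, and
    composition redirects it. *)
Record om := Om {
  oQ : finType;
  ostart : oQ;
  odelta : oQ -> G -> option oQ * G * dir }.

Definition tconf := ((nat -> G) * nat)%type.

Definition upd (T : nat -> G) h g : nat -> G := fun i => if i == h then g else T i.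

Definition mv d h := match d with MoveL => h.-1 | MoveR => h.+1 | Stay => h end.

(** Cell 0 is the left end. Executions make no left move there, so absolute positions survive the
    passage to the two-way tape of [TM]. *)
Definition okdir d h := if d is MoveL then 0 < h else true.

Inductive exec (M : om) : oQ M -> tconf -> tconf -> nat -> Prop :=
| exec_exit q T h g d : odelta q (T h) = (None, g, d) -> okdir d h ->
    exec q (T, h) (upd T h g, mv d h) 1
| exec_step q T h g d q' c t : odelta q (T h) = (Some q', g, d) -> okdir d h ->
    exec q' (upd T h g, mv d h) c t -> exec q (T, h) c t.+1.

Definition runs M (c c' : tconf) n := exists2 t, t <= n & exec (ostart M) c c' t.

Lemma runs_le M c c' n n' : n <= n' -> runs M c c' n -> runs M c c' n'.
Proof. by move=> le_n [t le_t H]; exists t => //; apply: leq_trans le_n. Qed.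

Lemma upd_id T h : upd T h (T h) = T.
Proof. by apply: functional_extensionality => i; rewrite /upd; case: eqP => [->|]. Qed.

Definition act (f : G -> G) (d : dir) : om :=
  @Om unit tt (fun _ g => (None, f g, d)).

Lemma runs_act f d T h : okdir d h ->
  runs (act f d) (T, h) (upd T h (f (T h)), mv d h) 1.
Proof. by move=> ok; exists 1 => //; apply: exec_exit. Qed.

Definition seqM (M N : om) : om :=
  @Om (oQ M + oQ N)%type (inl (ostart M)) (fun q g =>
    match q with
    | inl q1 => let: (o, g', d) := odelta q1 g in
                (Some (if o is Some q' then inl q' else inr (ostart N)), g', d)
    | inr q2 => let: (o, g', d) := odelta q2 g in (omap inr o, g', d)
    end).

Lemma runs_seq M N c1 c2 c3 n1 n2 :
  runs M c1 c2 n1 -> runs N c2 c3 n2 -> runs (seqM M N) c1 c3 (n1 + n2).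
Proof.
move=> [t1 le1 H1] [t2 le2 H2]; exists (t1 + t2); first exact: leq_add.
have {}H2 : @exec (seqM M N) (inr (ostart N)) c2 c3 t2.
  elim: H2 => [q T h g d E ok|q T h g d q' c t E ok _ IH].
    by apply: exec_exit ok; rewrite /= E.
  by apply: exec_step ok IH; rewrite /= E.
rewrite /=; elim: H1 H2 => [q T h g d E ok|q T h g d q' c t E ok _ IH] H2.
  by apply: exec_step ok H2; rewrite /= E.
by rewrite addSn; apply: exec_step ok (IH H2); rewrite /= E.
Qed.

Definition ifM (b : G -> bool) (M N : om) : om :=
  @Om (option (oQ M + oQ N)) None (fun q g =>
    match q with
    | None => (Some (Some (if b g then inl (ostart M) else inr (ostart N))), g, Stay)
    | Some (inl q1) => let: (o, g', d) := odelta q1 g in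
                       (omap (Some \o inl) o, g', d)
    | Some (inr q2) => let: (o, g', d) := odelta q2 g in
                       (omap (Some \o inr) o, g', d)
    end).

Lemma runs_if (b : G -> bool) M N T h c n :
  runs (if b (T h) then M else N) (T, h) c n -> runs (ifM b M N) (T, h) c n.+1.
Proof.
move=> [t le_t H]; exists t.+1 => //.
apply: (@exec_step (ifM b M N) _ _ _ (T h) Stay) => //=; rewrite upd_id.
case: (b (T h)) H => H; elim: H => [q T' h' g d E ok|q T' h' g d q' c' t' E ok _ IH].
- by apply: exec_exit ok; rewrite /= E.
- by apply: exec_step ok IH; rewrite /= E.
- by apply: exec_exit ok; rewrite /= E.
- by apply: exec_step ok IH; rewrite /= E.
Qed.

Definition whileM (b : G -> bool) (M : om) : om :=
  @Om (option (oQ M)) None (fun q g =>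
    match q with
    | None => (if b g then Some (Some (ostart M)) else None, g, Stay)
    | Some q1 => let: (o, g', d) := odelta q1 g in (Some o, g', d)
    end).

Lemma runs_while0 (b : G -> bool) M T h :
  ~~ b (T h) -> runs (whileM b M) (T, h) (T, h) 1.
Proof.
move=> nb; exists 1 => //; rewrite -{2}(upd_id T h).
by apply: (@exec_exit (whileM b M) _ _ _ _ Stay); rewrite //= (negbTE nb).
Qed.

Lemma runs_while1 (b : G -> bool) M T h c c' n n' : b (T h) ->
  runs M (T, h) c n -> runs (whileM b M) c c' n' ->
  runs (whileM b M) (T, h) c' (n + n').+1.
Proof.
move=> bT [t le1 H1] [t' le2 H2]; exists (t + t').+1; first lia.
apply: (@exec_step (whileM b M) _ _ _ (T h) Stay (Some (ostart M))) => //=.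
  by rewrite bT.
rewrite upd_id; elim: H1 H2 => [q T' h' g d E ok|q T' h' g d q' c1 t1 E ok _ IH] H2.
  by apply: exec_step ok H2; rewrite /= E.
by rewrite addSn; apply: exec_step ok (IH H2); rewrite /= E.
Qed.

Definition scanR (P : G -> bool) := whileM (fun g => ~~ P g) (act id MoveR).

Lemma runs_scanR (P : G -> bool) T h k : P (T (h + k)) ->
  (forall j, j < k -> ~~ P (T (h + j))) ->
  runs (scanR P) (T, h) (T, h + k) (k.*2).+1.
Proof.
elim: k h => [|k IH] h Pk nP.
  by rewrite addn0 in Pk *; apply: runs_while0; rewrite negbK.
have := nP 0 isT; rewrite addn0 => nP0.
have A := @runs_act id MoveR T h isT; rewrite /= upd_id in A.
have -> : (k.+1.*2).+1 = (1 + k.*2.+1).+1 by lia.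
apply: runs_while1 nP0 A _; rewrite -addSnnS; apply: IH; first by rewrite addSnnS.
by move=> j lt_j; rewrite addSnnS; apply: nP.
Qed.

Definition scanL (P : G -> bool) := whileM (fun g => ~~ P g) (act id MoveL).

Lemma runs_scanL (P : G -> bool) T h : (forall i, P (T i) = (i == 0)) ->
  runs (scanL P) (T, h) (T, 0) (h.*2).+1.
Proof.
move=> PT; elim: h => [|h IH].
  by apply: runs_while0; rewrite negbK PT.
have A := @runs_act id MoveL T h.+1 isT; rewrite /= upd_id in A.
have -> : (h.+1.*2).+1 = (1 + h.*2.+1).+1 by lia.
by apply: runs_while1 A IH; rewrite PT.
Qed.

End Machines.

(** * A register language *)

Inductive cond :=
| CLt (r s : nat) | CEq (r s : nat)
| CIn (r : nat) (b : bool) | COb (r : nat) (b : bool)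
| CB (b : bool) | CNot (c : cond) | CAnd (c d : cond) | COr (c d : cond).

Inductive prog :=
| Skip | Inc (r : nat) | Grow | Cpy (r s : nat) | Out (b : bool)
| Seq (p q : prog) | If (c : cond) (p q : prog) | For (v w : nat) (p : prog).

(* Register 0 is constantly zero; register 1 bounds all registers ([Inc] saturates there) and is
   only changed by [Grow]. *)
Notation rZ := 0 (only parsing).
Notation rE := 1 (only parsing).

Definition state := ((nat -> nat) * seq bool)%type.

Definition setr (s : state) (r k : nat) : state :=
  (fun i => if i == r then k else s.1 i, s.2).

Definition addout (s : state) (o : seq bool) : state := (s.1, s.2 ++ o).

Section Semantics.
Variable x : seq bool.

Fixpoint ceval (c : cond) (s : state) : bool :=
  match c with
  | CLt r r' => s.1 r < s.1 r'
  | CEq r r' => s.1 r == s.1 r'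
  | CIn r b => onth x (s.1 r) == Some b
  | COb r b => onth s.2 (s.1 r) == Some b
  | CB b => b
  | CNot c => ~~ ceval c s
  | CAnd c d => ceval c s && ceval d s
  | COr c d => ceval c s || ceval d s
  end.

(** [For] leaves [v] at the bound because the machine stops looping exactly when the marks of [v]
    and [w] share a cell. *)
Fixpoint eval (p : prog) (s : state) : state :=
  match p with
  | Skip => s
  | Inc r => if s.1 r < s.1 rE then setr s r (s.1 r).+1 else s
  | Grow => setr s rE (s.1 rE).+1
  | Cpy r r' => setr s r (s.1 r')
  | Out b => addout s [:: b]
  | Seq p q => eval q (eval p s)
  | If c p q => if ceval c s then eval p s else eval q s
  | For v w p =>
      setr (foldl (fun s i => eval p (setr s v i)) s (iota 0 (s.1 w))) v (s.1 w)
  end.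

End Semantics.

Fixpoint writes (p : prog) : seq nat :=
  match p with
  | Skip | Out _ => [::]
  | Inc r | Cpy r _ => [:: r]
  | Grow => [:: rE]
  | Seq p q | If _ p q => writes p ++ writes q
  | For v _ p => v :: writes p
  end.

Lemma eval_frame x p s r : r \notin writes p -> (eval x p s).1 r = s.1 r.
Proof.
elim: p s => //= [r'||r' r''|p IHp q IHq|c p IHp q IHq|v w p IH] s.
- by rewrite inE => /negbTE nr; case: ifP => //= _; rewrite nr.
- by rewrite inE => /negbTE ->.
- by rewrite inE => /negbTE ->.
- by rewrite mem_cat => /norP[np nq]; rewrite IHq ?IHp.
- by rewrite mem_cat => /norP[np nq]; case: ifP; rewrite ?IHq ?IHp.
rewrite inE => /norP[/negbTE nv np]; rewrite nv.
by elim: (iota _ _) {1 3}s => //= i l IHl t; rewrite IHl IH //= nv.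
Qed.

Lemma foldl_iotaS (T : Type) (f : T -> nat -> T) s k :
  foldl f s (iota 0 k.+1) = f (foldl f s (iota 0 k)) k.
Proof. by rewrite -addn1 iotaD foldl_cat. Qed.

Lemma eval_For_ind x (P : nat -> state -> Prop) v w p s :
  P 0 s ->
  (forall i t, i < s.1 w -> P i t -> P i.+1 (eval x p (setr t v i))) ->
  (forall t, P (s.1 w) t -> P (s.1 w) (setr t v (s.1 w))) ->
  P (s.1 w) (eval x (For v w p) s).
Proof.
move=> P0 PS PE /=; apply: PE.
move: PS; elim: (s.1 w) => [|k IH] PS //.
rewrite foldl_iotaS; apply: (PS) => //; apply: IH => i t lt_i; apply: PS.
exact: ltnW.
Qed.

Section Compile.
Variable K : nat.

Fixpoint cwf (c : cond) : bool :=
  match c with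
  | CLt r r' | CEq r r' => (r <= K) && (r' <= K)
  | CIn r _ | COb r _ => r <= K
  | CB _ => true
  | CNot c => cwf c
  | CAnd c d | COr c d => cwf c && cwf d
  end.

(** [Cpy] needs two different registers since the machine erases the mark of [r] before it looks for
    that of [r']. A loop body leaves counter and bound alone, so that their marks meet after the
    right number of rounds. *)
Fixpoint wf (p : prog) : bool :=
  match p with
  | Skip | Grow | Out _ => true
  | Inc r => 1 < r <= K
  | Cpy r r' => [&& 1 < r, r <= K, r' <= K & r != r']
  | Seq p q => wf p && wf q
  | If c p q => [&& cwf c, wf p & wf q]
  | For v w p => [&& 1 < v, v <= K, w <= K, v != w,
                  v \notin writes p, w \notin writes p & wf p]
  end.

Definition bounded (s : state) := s.1 rZ = 0 /\ forall r, s.1 r <= s.1 rE.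

Lemma bounded_setr s r k : r != rZ -> r != rE -> k <= s.1 rE -> bounded s ->
  bounded (setr s r k).
Proof.
move=> r0 r1 le_k [s0 sE]; split => [|i] /=.
  by rewrite eq_sym (negbTE r0).
by rewrite [1 == r]eq_sym (negbTE r1); case: ifP.
Qed.

(** Monotonicity lets bounds on the final state control all intermediate states, so that running
    times refer to the final state only. *)
Lemma eval_mono x p s : wf p -> bounded s ->
  [/\ bounded (eval x p s), s.1 rE <= (eval x p s).1 rE
    & size s.2 <= size (eval x p s).2].
Proof.
elim: p s => //= [r||r r'|b|p IHp q IHq|c p IHp q IHq|v w p IH] s.
- move=> /andP[lt1r _] bs; case: ifP => // lt_r.
  have r0 : r != 0 by lia. have r1 : r != 1 by lia.
  by split=> //; [apply: bounded_setr | rewrite /= eq_sym (negbTE r1)].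
- move=> _ [s0 sE]; split => //=; split => //= i.
  by case: ifP => // _; apply: leqW.
- move=> /and4P[lt1r _ _ _] bs.
  have r0 : r != 0 by lia. have r1 : r != 1 by lia.
  split=> //; last by rewrite /= eq_sym (negbTE r1).
  by apply: bounded_setr => //; case: bs.
- by move=> _ bs; split => //; rewrite size_cat leq_addr.
- move=> /andP[wp wq] bs; have [b1 e1 o1] := IHp s wp bs.
  have [b2 e2 o2] := IHq _ wq b1; split => //; exact: leq_trans e2 || exact: leq_trans o2.
- by move=> /and3P[_ wp wq] bs; case: ifP => _; [apply: IHp|apply: IHq].
move=> /and5P[lt1v _ _ _ /and3P[_ _ wp]] bs.
have v0 : v != 0 by lia. have v1 : v != 1 by lia.
have lew : s.1 w <= s.1 1 by case: bs.
pose P (i : nat) (t : state) :=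
  [/\ bounded t, s.1 1 <= t.1 1 & size s.2 <= size t.2].
have setv t k : k <= s.1 1 -> P 0 t -> P 0 (setr t v k).
  move=> le_k [bt et ot]; split=> //; last by rewrite /= [1 == v]eq_sym (negbTE v1).
  by apply: bounded_setr => //; apply: leq_trans et.
apply: (@eval_For_ind x P) => // [i t lt_i Pt|t Pt]; last exact: setv.
have [|b1 e1 o1] := setv t i _ Pt; first by lia.
have [b2 e2 o2] := IH _ wp b1; split => //; exact: leq_trans e2 || exact: leq_trans o2.
Qed.

End Compile.

(** * Simulation of the register language by a one-tape machine *)

Section Simulation.
Variable K : nat.

(* A cell: origin flag, input bit, output bit, set of the registers whose value is its position. *)
Definition cell := (bool * option bool * option bool * {set 'I_K.+1})%type.

Definition org (g : cell) := g.1.1.1.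
Definition inb (g : cell) := g.1.1.2.
Definition oub (g : cell) := g.1.2.
Definition mark (r : nat) (g : cell) := inord r \in g.2.
Definition setm (r : nat) (g : cell) : cell := (g.1, inord r |: g.2).
Definition clrm (r : nat) (g : cell) : cell := (g.1, g.2 :\ inord r).
Definition seto (b : bool) (g : cell) : cell := (g.1.1, Some b, g.2).

Definition home := scanL org.

Definition testM (P Q : cell -> bool) (M N : om cell) :=
  seqM (scanR P) (ifM Q (seqM home M) (seqM home N)).

(** With both continuations as arguments a connective is compiled by rewiring them, at the price of
    copying a branch. For [CLt] the head stops at the first of the two marks, which decides the
    comparison. *)
Fixpoint cmpIf (c : cond) (M N : om cell) : om cell :=
  match c with
  | CLt r r' => testM (fun g => mark r g || mark r' g)
                      (fun g => mark r g && ~~ mark r' g) M N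
  | CEq r r' => testM (mark r) (mark r') M N
  | CIn r b => testM (mark r) (fun g => inb g == Some b) M N
  | COb r b => testM (mark r) (fun g => oub g == Some b) M N
  | CB b => if b then M else N
  | CNot c => cmpIf c N M
  | CAnd c d => cmpIf c (cmpIf d M N) N
  | COr c d => cmpIf c M (cmpIf d M N)
  end.

(** Saturation is a local test: a mark stays where it is when it shares its cell with the mark of
    register 1. *)
Definition incM r : om cell :=
  seqM (scanR (mark r))
    (seqM (ifM (mark 1) (act id Stay)
             (seqM (act (clrm r) MoveR) (act (setm r) Stay))) home).

Definition growM : om cell :=
  seqM (scanR (mark 1)) (seqM (act (clrm 1) MoveR) (seqM (act (setm 1) Stay) home)).

Definition cpyM r r' : om cell :=
  seqM (scanR (mark r)) (seqM (act (clrm r) Stay) (seqM home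
    (seqM (scanR (mark r')) (seqM (act (setm r) Stay) home)))).

Definition outM b : om cell :=
  seqM (scanR (fun g => oub g == None)) (seqM (act (seto b) Stay) home).

Fixpoint cmp (p : prog) : om cell :=
  match p with
  | Skip => act id Stay
  | Inc r => incM r
  | Grow => growM
  | Cpy r r' => cpyM r r'
  | Out b => outM b
  | Seq p q => seqM (cmp p) (cmp q)
  | If c p q => cmpIf c (cmp p) (cmp q)
  | For v w p => seqM (cpyM v 0) (seqM (scanR (mark v)) (seqM
      (whileM (fun g => ~~ mark w g)
         (seqM home (seqM (cmp p) (seqM (incM v) (scanR (mark v))))))
      home))
  end.

Fixpoint csize (c : cond) : nat :=
  match c with
  | CLt _ _ | CEq _ _ | CIn _ _ | COb _ _ => 1
  | CB _ => 0
  | CNot c => csize c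
  | CAnd c d | COr c d => csize c + csize d
  end.

Fixpoint cost (p : prog) (B : nat) : nat :=
  match p with
  | Skip | Inc _ | Grow | Cpy _ _ | Out _ => 10 * B.+1
  | Seq p q => cost p B + cost q B
  | If c p q => csize c * (10 * B.+1) + (cost p B + cost q B)
  | For _ _ p => B * (cost p B + 20 * B.+1) + 20 * B.+1
  end.

Variable x : seq bool.

Definition tape (s : state) : nat -> cell :=
  fun i => (i == 0, onth x i, onth s.2 i, [set r : 'I_K.+1 | s.1 r == i]).

Lemma eq_inord r (i : 'I_K.+1) : r <= K -> (i == inord r) = (i == r :> nat).
Proof. by move=> le_r; rewrite -val_eqE /= inordK. Qed.

Lemma mark_tape r s i : r <= K -> mark r (tape s i) = (s.1 r == i).
Proof. by move=> le_r; rewrite /mark inE inordK. Qed.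

Lemma runs_home s h : runs home (tape s, h) (tape s, 0) (h.*2).+1.
Proof. exact: runs_scanL. Qed.

Lemma runs_find r s : r <= K ->
  runs (scanR (mark r)) (tape s, 0) (tape s, s.1 r) ((s.1 r).*2).+1.
Proof.
move=> le_r; apply: (@runs_scanR _ _ _ 0) => [|j lt_j].
  by rewrite mark_tape.
by rewrite mark_tape // add0n; lia.
Qed.

Lemma tape_move s r k : r <= K ->
  let T := upd (tape s) (s.1 r) (clrm r (tape s (s.1 r))) in
  upd T k (setm r (T k)) = tape (setr s r k).
Proof.
move=> le_r; apply: functional_extensionality => i /=.
rewrite /upd /tape /setm /clrm /=.
case: (eqVneq i k) => [->|nik].
  case: (eqVneq k (s.1 r)) => [->|nk] /=; congr (_, _, _, _); apply/setP => j.
    by rewrite !inE eq_inord //; case: (j == r :> nat); rewrite ?eqxx.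
  rewrite !inE eq_inord //; case: (j == r :> nat); by rewrite ?eqxx.
case: (eqVneq i (s.1 r)) => [Di|ni] /=; first subst i; congr (_, _, _, _); apply/setP => j.
  rewrite !inE eq_inord //; case: (eqVneq (j : nat) r) => [->|] //=.
  by rewrite [RHS]eq_sym (negbTE nik).
rewrite !inE; case: (eqVneq (j : nat) r) => [->|] //=.
by move: ni nik; rewrite ![i == _]eq_sym => /negbTE -> /negbTE ->.
Qed.

Lemma runs_test (P Q : cell -> bool) M N s k B c n : k <= B ->
  P (tape s k) -> (forall j, j < k -> ~~ P (tape s j)) ->
  runs (if Q (tape s k) then M else N) (tape s, 0) c n ->
  runs (testM P Q M N) (tape s, 0) c (10 * B.+1 + n).
Proof.
move=> le_k Pk nP H.
have A := @runs_scanR _ P (tape s) 0 k Pk nP.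
have E : runs (ifM Q (seqM home M) (seqM home N)) (tape s, k) c ((k.*2).+1 + n).+1.
  by apply: runs_if; case: (Q _) H => H; apply: runs_seq (runs_home s k) H.
by apply: runs_le (runs_seq A E); lia.
Qed.

Lemma runs_cmpIf c M N s B c' n : cwf K c -> bounded s -> s.1 1 <= B ->
  runs (if ceval x c s then M else N) (tape s, 0) c' n ->
  runs (cmpIf c M N) (tape s, 0) c' (csize c * (10 * B.+1) + n).
Proof.
move=> wc [_ bs] leB; elim: c M N n wc => [r r'|r r'|r b|r b|b|c IHc|c IHc d IHd|c IHc d IHd] M N n /=.
- move=> /andP[le_r le_r'] H; rewrite mul1n.
  apply: (@runs_test _ _ _ _ s (minn (s.1 r) (s.1 r'))).
  + by have := bs r; lia.
  + by rewrite /= !mark_tape //; case: (leqP (s.1 r)); rewrite eqxx ?orbT.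
  + by move=> j; rewrite /= !mark_tape //; lia.
  rewrite /= !mark_tape //.
  rewrite (_ : (_ && _) = (s.1 r < s.1 r')) //.
  by case: (leqP (s.1 r)); rewrite ?eqxx /=; lia.
- move=> /andP[le_r le_r'] H; rewrite mul1n.
  apply: (@runs_test _ _ _ _ s (s.1 r)).
  + by have := bs r; lia.
  + by rewrite mark_tape.
  + by move=> j; rewrite !mark_tape //; lia.
  by rewrite mark_tape // eq_sym.
- move=> le_r H; rewrite mul1n.
  apply: (@runs_test _ _ _ _ s (s.1 r)) => //.
  + by have := bs r; lia.
  + by rewrite mark_tape.
  + by move=> j; rewrite !mark_tape //; lia.
- move=> le_r H; rewrite mul1n.
  apply: (@runs_test _ _ _ _ s (s.1 r)) => //.
  + by have := bs r; lia.
  + by rewrite mark_tape.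
  + by move=> j; rewrite !mark_tape //; lia.
- by case: b.
- by move=> wc H; apply: IHc => //; rewrite if_neg in H.
- move=> /andP[wc wd] H; rewrite mulnDl -addnA; apply: IHc => //.
  case: (ceval x c s) H => H; first exact: IHd.
  by apply: runs_le H; apply: leq_addl.
move=> /andP[wc wd] H; rewrite mulnDl -addnA; apply: IHc => //.
case: (ceval x c s) H => H; last exact: IHd.
by apply: runs_le H; apply: leq_addl.
Qed.

Lemma runs_move s r k d h : r <= K -> okdir d (s.1 r) -> mv d (s.1 r) = h -> h = k ->
  runs (seqM (act (clrm r) d) (act (setm r) Stay)) (tape s, s.1 r)
    (tape (setr s r k), k) 2.
Proof.
move=> le_r ok <- <-; rewrite -tape_move //.
exact: runs_seq (runs_act _ _ ok) (@runs_act _ _ Stay _ _ isT).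
Qed.

Lemma runs_inc r s B : 1 < r <= K -> bounded s -> s.1 1 <= B ->
  runs (incM r) (tape s, 0) (tape (eval x (Inc r) s), 0) (10 * B.+1).
Proof.
move=> /andP[lt1r le_r] [_ bs] leB.
have A := runs_find s le_r.
have K1 : 1 <= K by lia.
have brE := bs r.
rewrite /=; case: ifP => lt_r.
  have E : runs (ifM (mark 1) (act id Stay)
      (seqM (act (clrm r) MoveR) (act (setm r) Stay))) (tape s, s.1 r)
      (tape (setr s r (s.1 r).+1), (s.1 r).+1) 3.
    apply: runs_if; rewrite mark_tape // (_ : (_ == _) = false); last by lia.
    exact: runs_move.
  by apply: runs_le (runs_seq A (runs_seq E (runs_home _ _))); lia.
have E : runs (ifM (mark 1) (act id Stay)
      (seqM (act (clrm r) MoveR) (act (setm r) Stay))) (tape s, s.1 r)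
      (tape s, s.1 r) 2.
  apply: runs_if; rewrite mark_tape // (_ : (_ == _) = true); last by lia.
  by have := @runs_act _ id Stay (tape s) (s.1 r) isT; rewrite upd_id.
by apply: runs_le (runs_seq A (runs_seq E (runs_home _ _))); lia.
Qed.

Lemma runs_grow s B : 1 <= K -> (s.1 1).+1 <= B ->
  runs growM (tape s, 0) (tape (eval x Grow s), 0) (10 * B.+1).
Proof.
move=> K1 leB; have A := runs_find s K1.
have Hc := @runs_act _ (clrm 1) MoveR (tape s) (s.1 1) isT.
have Hs := fun T => @runs_act _ (setm 1) Stay T (s.1 1).+1 isT.
have := runs_seq A (runs_seq Hc (runs_seq (Hs _) _)).
move/(_ home (tape (eval x Grow s), 0) ((s.1 1).+1.*2).+1) => H.
apply: runs_le (H _); first by lia.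
have := @tape_move s 1 (s.1 1).+1 K1; rewrite /= => ->; exact: runs_home.
Qed.

Lemma runs_cpy r r' s B : 1 < r <= K -> r' <= K -> r != r' -> bounded s -> s.1 1 <= B ->
  runs (cpyM r r') (tape s, 0) (tape (eval x (Cpy r r') s), 0) (10 * B.+1).
Proof.
move=> /andP[lt1r le_r] le_r' nr [_ bs] leB.
have br := bs r; have br' := bs r'.
set T1 := upd (tape s) (s.1 r) (clrm r (tape s (s.1 r))).
have mT1 i : mark r' (T1 i) = (s.1 r' == i).
  rewrite /T1 /upd; case: eqP => [->|_]; last by rewrite mark_tape.
  rewrite /mark /clrm /= !inE inordK // eq_inord // inordK //.
  by rewrite eq_sym (negbTE nr).
have A1 := runs_find s le_r.
have A2 := @runs_act _ (clrm r) Stay (tape s) (s.1 r) isT.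
have A3 : runs home (T1, s.1 r) (T1, 0) ((s.1 r).*2).+1.
  by apply: runs_scanL => i; rewrite /T1 /upd; case: eqP => [->|].
have A4 : runs (scanR (mark r')) (T1, 0) (T1, s.1 r') ((s.1 r').*2).+1.
  apply: (@runs_scanR _ _ _ 0) => [|j lt_j]; rewrite mT1 //.
  by rewrite add0n; lia.
have A5 := @runs_act _ (setm r) Stay T1 (s.1 r') isT.
have A6 := runs_home (setr s r (s.1 r')) (s.1 r').
rewrite /= -/T1 in A2 A5; rewrite -(tape_move _ _ le_r) /= -/T1 in A6.
have := runs_seq A1 (runs_seq A2 (runs_seq A3 (runs_seq A4 (runs_seq A5 A6)))).
rewrite /= -(tape_move _ _ le_r) /=; apply: runs_le; lia.
Qed.

Lemma runs_out b s B : (size s.2).+1 <= B ->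
  runs (outM b) (tape s, 0) (tape (eval x (Out b) s), 0) (10 * B.+1).
Proof.
move=> leB.
have A1 : runs (scanR (fun g => oub g == None)) (tape s, 0) (tape s, size s.2) ((size s.2).*2).+1.
  apply: (@runs_scanR _ _ _ 0) => [|j lt_j]; rewrite /oub /=.
    by rewrite onth_default.
  by rewrite add0n; move: lt_j; rewrite -onthTE; case: onth.
have A2 := @runs_act _ (seto b) Stay (tape s) (size s.2) isT.
have A3 := runs_home (addout s [:: b]) (size s.2).
have E : upd (tape s) (size s.2) (seto b (tape s (size s.2))) = tape (addout s [:: b]).
  apply: functional_extensionality => i; rewrite /upd /tape /seto /=.
  case: eqP => [->|ni]; congr (_, _, _, _).
    by rewrite onth_cat ltnn subnn.
  have [lt_i|le_i] := ltnP i (size s.2); first by rewrite onth_cat lt_i.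
  by rewrite !onth_default // size_cat /=; lia.
rewrite E in A2.
by apply: runs_le (runs_seq A1 (runs_seq A2 A3)); lia.
Qed.

Theorem runs_cmp p s B : 1 <= K -> wf K p -> bounded s ->
  (eval x p s).1 1 <= B -> size (eval x p s).2 <= B ->
  runs (cmp p) (tape s, 0) (tape (eval x p s), 0) (cost p B).
Proof.
move=> K1; elim: p s => [|r||r r'|b|p IHp q IHq|c p IHp q IHq|v w p IH] s.
- move=> _ _ _ _; rewrite /=.
  apply: (@runs_le _ _ _ _ 1); first by lia.
  by have := @runs_act _ id Stay (tape s) 0 isT; rewrite upd_id.
- move=> w bs leB _; apply: runs_inc => //.
  by have [_ e _] := eval_mono x w bs; apply: leq_trans e leB.
- by move=> _ _ leB _; apply: runs_grow.
- move=> w bs leB _; have [_ e _] := eval_mono x w bs.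
  move: w => /= /and4P[lt1r le_r le_r' nr]; apply: runs_cpy => //; first by rewrite lt1r.
  exact: leq_trans e leB.
- by move=> _ _ _ /=; rewrite size_cat /= addn1; apply: runs_out.
- move=> /= /andP[wp wq] bs leE leO.
  have [b1 e1 o1] := eval_mono x wp bs; have [b2 e2 o2] := eval_mono x wq b1.
  by apply: runs_seq (IHp _ wp bs _ _) (IHq _ wq b1 leE leO); lia.
- move=> w bs leE leO; have [_ e _] := eval_mono x w bs.
  move: w => /= /and3P[wc wp wq].
  apply: runs_cmpIf => //; first exact: leq_trans e leE.
  move: leE leO => /=; case: ifP => _ leE leO.
    by apply: runs_le (IHp _ wp bs leE leO); apply: leq_addr.
  by apply: runs_le (IHq _ wq bs leE leO); apply: leq_addl.
move=> wfor bs leE leO.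
have [_ eE _] := eval_mono x wfor bs.
move: (wfor) => /= /and5P[lt1v le_v le_w nvw /and3P[nv nw wp]].
have v0 : v != 0 by lia. have v1 : v != 1 by lia.
have sz := bs.1; have sw := bs.2 w.
have lev : 1 < v <= K by rewrite lt1v.
pose f t i := eval x p (setr t v i).
(* The state after [i] rounds, before the counter is set again. *)
pose st i := foldl f s (iota 0 i).
have stS i : st i.+1 = f (st i) i by rewrite /st foldl_iotaS.
have stw i : (st i).1 w = s.1 w.
  elim: i => // i IHi; rewrite stS /f eval_frame //=.
  by rewrite eq_sym (negbTE nvw).
have bset t i : bounded t -> i <= t.1 1 -> bounded (setr t v i) by move=> *; apply: bounded_setr.
have setE t i : (setr t v i).1 1 = t.1 1 by rewrite /= [1 == v]eq_sym (negbTE v1).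
have stb i : i <= s.1 w -> bounded (st i) /\ s.1 1 <= (st i).1 1.
  elim: i => [//|i IHi] lt_i; have [b1 e1] := IHi (ltnW lt_i).
  have [|b2 e2 _] := @eval_mono K x p (setr (st i) v i) wp; first by apply: bset => //; lia.
  by rewrite stS; split => //; apply: leq_trans e1 _; rewrite -(setE _ i).
have stmono i k : i + k = s.1 w ->
    (st i).1 1 <= (st (s.1 w)).1 1 /\ size (st i).2 <= size (st (s.1 w)).2.
  elim: k i => [|k IHk] i Dw; first by rewrite -Dw addn0.
  have lt_i : i < s.1 w by lia.
  have [b1 e1] := stb i (ltnW lt_i).
  have [|b2 e2 o2] := @eval_mono K x p (setr (st i) v i) wp; first by apply: bset => //; lia.
  have [|e3 o3] := IHk i.+1; first by lia.
  rewrite setE in e2; rewrite stS in e3 o3.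
  by split; [exact: leq_trans e2 e3 | exact: leq_trans o2 o3].
have leEw : (st (s.1 w)).1 1 <= B by move: leE; rewrite /= [1 == v]eq_sym (negbTE v1).
have leOw : size (st (s.1 w)).2 <= B by [].
(* Induction on the number [k] of remaining rounds. The head waits on the mark of the counter, at
   cell [i], where the loop test looks for the mark of [w]. *)
have main k i : i + k = s.1 w ->
  runs (whileM (fun g => ~~ mark w g)
         (seqM home (seqM (cmp p) (seqM (incM v) (scanR (mark v))))))
    (tape (setr (st i) v i), i) (tape (setr (st (s.1 w)) v (s.1 w)), s.1 w)
    (k * (cost p B + 20 * B.+1)).+1.
  elim: k i => [|k IHk] i Dw.
    rewrite -Dw addn0; apply: runs_while0; rewrite negbK mark_tape //=.
    by rewrite [w == v]eq_sym (negbTE nvw) stw -Dw addn0.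
  have lt_i : i < s.1 w by lia.
  have [b1 e1] := stb i (ltnW lt_i).
  have bi : bounded (setr (st i) v i) by apply: bset => //; lia.
  have [e2 o2] := stmono _ _ Dw.
  have [|e3 o3] := stmono i.+1 k; first by lia.
  rewrite stS in e3 o3.
  have [b4 e4 o4] := @eval_mono K x p _ wp bi.
  have A1 := runs_home (setr (st i) v i) i.
  have A2 := IH _ wp bi (leq_trans e3 leEw) (leq_trans o3 leOw).
  have A3 := @runs_inc v _ B lev b4 (leq_trans e3 leEw).
  have vi : (eval x p (setr (st i) v i)).1 v = i by rewrite eval_frame //= eqxx.
  (* The counter cannot saturate, as [i < s.1 w] and [s.1 w] is within the bound. *)
  have E : eval x (Inc v) (eval x p (setr (st i) v i)) = setr (st i.+1) v i.+1.
    by rewrite /= vi ifT ?stS //; rewrite setE in e4; lia.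
  rewrite E in A3.
  have A4 := @runs_find v (setr (st i.+1) v i.+1) le_v.
  rewrite [in X in runs _ _ X]/= [in X in runs _ _ _ X]/= eqxx in A4.
  have Dw1 : i.+1 + k = s.1 w by lia.
  have H := runs_while1 _ (runs_seq A1 (runs_seq A2 (runs_seq A3 A4))) (IHk _ Dw1).
  apply: runs_le (H _); first by lia.
  rewrite mark_tape //= [w == v]eq_sym (negbTE nvw) stw; lia.
have A1 := @runs_cpy v 0 s B lev isT _ bs (leq_trans eE leE).
have A2 := @runs_find v (setr s v 0) le_v.
rewrite [in X in runs _ _ X]/= [in X in runs _ _ _ X]/= eqxx in A2.
have A3 := main (s.1 w) 0 erefl.
have A4 := runs_home (setr (st (s.1 w)) v (s.1 w)) (s.1 w).
rewrite /= sz in A1.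
have := runs_seq (A1 v0) (runs_seq A2 (runs_seq A3 A4)); apply: runs_le.
have leq_m : s.1 w * (cost p B + 20 * B.+1) <= B * (cost p B + 20 * B.+1).
  by rewrite leq_mul2r; apply/orP; right; lia.
lia.
Qed.

End Simulation.

(** * From programs to Turing machines *)

Section Assembly.
Variable K : nat.
Notation cell := (cell K).

Definition mark_origin (g : cell) : cell :=
  (true, inb g, None, ~: [set inord 1; inord 2]).
Definition mark_end (g : cell) : cell := (g.1, [set inord 1; inord 2] :|: g.2).

Definition prologue : om cell :=
  seqM (act mark_origin Stay)
    (seqM (scanR (fun g : cell => inb g == None))
      (seqM (act mark_end Stay) (@home K))).

(** The prologue finds the input length as the first cell without input bit. Register 1 starts there
    as the bound; register 2 starts there to keep the length available while the bound grows. *)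
Definition state0 (x : seq bool) : state :=
  (fun r => if (r == 1) || (r == 2) then size x else 0, [::]).

Lemma bounded_state0 x : bounded (state0 x).
Proof. by split => //= r; case: ifP. Qed.

Definition blank_cell : cell := (false, None, None, set0).
Definition inp_cell (b : bool) : cell := (false, Some b, None, set0).

Lemma runs_prologue x : 2 <= K ->
  runs prologue (nth blank_cell (map inp_cell x), 0) (tape K x (state0 x), 0)
    ((size x).*2 + (size x).*2 + 4).
Proof.
move=> K2; set T0 := nth _ _.
have restT0 i : T0 i = (false, onth x i, None, set0).
  by rewrite /T0; elim: x {T0} i => [|b x IH] [|i] //=.
have inT0 i : inb (T0 i) = onth x i by rewrite restT0.
set T1 := upd T0 0 (mark_origin (T0 0)).
have inT1 i : inb (T1 i) = onth x i.
  by rewrite /T1 /upd; case: eqP => [->|_] /=; rewrite /inb /= ?inT0 // -inT0.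
have A1 := @runs_act _ mark_origin Stay T0 0 isT.
have A2 : runs (scanR (fun g : cell => inb g == None)) (T1, 0) (T1, size x) ((size x).*2).+1.
  apply: (@runs_scanR _ _ _ 0) => [|j lt_j]; rewrite inT1.
    by rewrite onth_default.
  by rewrite add0n; move: lt_j; rewrite -onthTE; case: onth.
have A3 := @runs_act _ mark_end Stay T1 (size x) isT.
have A4 := @runs_home K x (state0 x) (size x).
have E : upd T1 (size x) (mark_end (T1 (size x))) = tape K x (state0 x).
  apply: functional_extensionality => i; rewrite /upd /T1 /upd /mark_origin /mark_end inT0 !restT0 /tape /=.
  have inS (j : 'I_K.+1) : (j \in [set inord 1; inord 2]) = (j == 1 :> nat) || (j == 2 :> nat).
    by rewrite !inE !eq_inord //; lia.
  rewrite onth0n; case: (eqVneq i (size x)) => [->|ni]; last first.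
    case: (eqVneq i 0) ni => [->|nx] ni /=; congr (_, _); apply/setP => j.
      by rewrite in_setC inS !inE; case: ifP => //= _; lia.
    by rewrite !inE; case: ifP; lia.
  case: (eqVneq (size x) 0) => [->|nx] /=; congr (_, _); apply/setP => j.
    by rewrite in_setU in_setC inS inE; case: ifP.
  by rewrite in_setU inS !inE orbF; case: ifP; lia.
rewrite E in A3.
by apply: runs_le (runs_seq A1 (runs_seq A2 (runs_seq A3 A4))); lia.
Qed.

(** The exit leads to one more transition, which turns the cell under the head into the verdict.
    After a compiled program this is the origin, from which the output is read as well. *)
Definition om_TM (M : om cell) (b : cell -> bool) : TM := {|
  tQ := (oQ M + (unit + bool))%type;
  tG := cell;
  Defs.blank := blank_cell;
  inp := inp_cell;
  outp := @oub K;
  q0 := inl (ostart M);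
  haltst := fun q => if q is inr (inr b) then Some b else None;
  delta := fun q g =>
    match q with
    | inl q => let: (o, g', d) := odelta q g in
               (if o is Some q' then inl q' else inr (inl tt), g', d)
    | inr _ => (inr (inr (b g)), g, Stay)
    end |}.

(** The right list may end anywhere beyond the last nonblank cell, hence the comparison through
    [nth] with a blank default. The left list is the whole prefix, because the tape begins at cell
    0. *)
Definition repr (l : seq cell) (a : cell) (r : seq cell) (c : tconf cell) :=
  [/\ l = rev (mkseq c.1 c.2), a = c.1 c.2
    & forall i, nth blank_cell r i = c.1 (c.2.+1 + i)].

Lemma mkseq_upd (T : nat -> cell) h k g : k <= h -> mkseq (upd T h g) k = mkseq T k.
Proof.
move=> le_k; apply/eq_in_map => i; rewrite mem_iota /upd => lt_i.
by case: eqP => // ?; lia.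
Qed.

Lemma mkseqS (T : nat -> cell) h : mkseq T h.+1 = rcons (mkseq T h) (T h).
Proof. by rewrite /mkseq -addn1 iotaD map_cat cats1. Qed.

Lemma step_repr M b q l a r T h o g d :
  repr l a r (T, h) -> odelta q (T h) = (o, g, d) -> okdir d h ->
  exists l' a' r', repr l' a' r' (upd T h g, mv d h) /\
    step (M := om_TM M b) (inl q, l, a, r) =
    (if o is Some q' then inl q' else inr (inl tt), l', a', r').
Proof.
move=> [/= -> -> Dr] E ok; rewrite /step /= E.
case: d ok E => ok E /=.
- case: h ok Dr E => // h _ Dr E; rewrite mkseqS rev_rcons.
  exists (rev (mkseq T h)), (T h), (g :: r); split => //; split => //=.
  + by rewrite mkseq_upd.
  + by rewrite /upd; case: eqP => //; lia.
  + case=> [|i] /=; first by rewrite /upd addn0 eqxx.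
    by rewrite Dr /upd; case: eqP => [|_]; [lia|congr T; lia].
- have Dl : g :: rev (mkseq T h) = rev (mkseq (upd T h g) h.+1).
    by rewrite mkseqS rev_rcons mkseq_upd // /upd eqxx.
  have updT i : upd T h g (h.+1 + i) = T (h.+1 + i).
    by rewrite /upd; case: eqP => //; lia.
  case: r Dr => [|c r] Dr.
    exists (g :: rev (mkseq T h)), blank_cell, [::]; split => //; split => //=.
      by rewrite -(addn0 h.+1) updT -Dr.
    by move=> i; rewrite nth_nil addSnnS updT -Dr nth_nil.
  exists (g :: rev (mkseq T h)), c, r; split => //; split => //=.
    by rewrite -(addn0 h.+1) updT -Dr.
  by move=> i; rewrite addSnnS updT -Dr.
- exists (rev (mkseq T h)), g, r; split => //; split => //=.
  + by rewrite mkseq_upd.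
  + by rewrite /upd eqxx.
  + by move=> i; rewrite Dr /upd; case: eqP => //; lia.
Qed.

Lemma exec_step_iter M b q l a r c c' t :
  exec q c c' t -> repr l a r c ->
  exists l' a' r', repr l' a' r' c' /\
    iter t (step (M := om_TM M b)) (inl q, l, a, r) = (inr (inl tt), l', a', r').
Proof.
move=> H; elim: H l a r => [q' T h g d E ok|q' T h g d q1 c1 t1 E ok _ IH] l a r R.
  by have [l' [a' [r' [R' S]]]] := step_repr b R E ok; exists l', a', r'.
have [l' [a' [r' [R' S]]]] := step_repr b R E ok.
have [l2 [a2 [r2 [R2 S2]]]] := IH _ _ _ R'; exists l2, a2, r2; split => //.
by rewrite iterSr S S2.
Qed.

Lemma take_some_onth (s : seq (option bool)) o :
  (forall i, nth None s i = onth o i) -> take_some s = o.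
Proof.
elim: s o => [|[b|] s IH] [|b' o] //= H; try by have := H 0.
have [-> E] : b = b' /\ (forall i, nth None s i = onth o i).
  by split => [|i]; [have [] := H 0 | have := H i.+1].
by rewrite (IH o).
Qed.

(* Register 3 is the failure flag of a decision program. *)
Theorem prog_TM p : 3 <= K -> wf K p -> exists M : TM, forall x B,
  let s := eval x p (state0 x) in s.1 1 <= B -> size s.2 <= B ->
  exists k, [/\ k <= cost p B + 10 * B.+1,
    haltst M (cstate (run M k x)) = Some (s.1 3 == 0) & output (run M k x) = s.2].
Proof.
move=> K3 wp; exists (om_TM (seqM prologue (cmp K p)) (mark 3)) => x B s leE leO.
have b0 := bounded_state0 x.
have [b1 e1 o1] := eval_mono x wp b0.
have lex : size x <= B by apply: leq_trans leE; exact: e1.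
have K2 : 2 <= K by lia.
have A1 := runs_prologue x K2.
have K1 : 1 <= K by lia.
have [t le_t H] := runs_seq A1 (runs_cmp K1 wp b0 leE leO).
set b := mark 3; set M := om_TM _ b.
have [l [a [r [R0 I0]]]] : exists l a r,
    repr l a r (nth blank_cell (map inp_cell x), 0) /\ init M x = (q0 M, l, a, r).
  rewrite /init /=; case: x {b0 b1 e1 o1 lex s A1 H leE leO le_t} => [|c x] /=.
    by exists [::], blank_cell, [::]; split => //; split => // i; rewrite !nth_nil.
  by exists [::], (inp_cell c), (map inp_cell x).
have [l' [a' [r' [[Dl Da Dr] S]]]] := exec_step_iter b H R0.
exists t.+1; rewrite /run iterS I0 /= S /=; split.
- by apply: leq_ltn_trans le_t _; lia.
- by rewrite Da /= /b mark_tape.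
rewrite -[LHS]/(take_some (map (@oub K) (a' :: r'))).
apply: take_some_onth => i; rewrite Da; case: i => [|i] /=; first by [].
have [lt_i|le_i] := ltnP i (size r').
  by rewrite (nth_map blank_cell) // Dr.
rewrite nth_default ?size_map //; have := Dr i; rewrite nth_default //.
by move/(congr1 (@oub K)); rewrite /oub /=.
Qed.

End Assembly.

(** * Polynomial time bounds *)

(** The base is at least 2 even at [n = 0], so constants and sums are absorbed by a larger exponent
    and no coefficients are needed. *)
Definition poly_bounded (f : nat -> nat) := exists d, forall n, f n <= (n + 2) ^ d.

Lemma poly_boundedW f g : (forall n, f n <= g n) -> poly_bounded g -> poly_bounded f.
Proof. by move=> le_fg [d H]; exists d => n; apply: leq_trans (H n). Qed.

Lemma poly_bounded_const c : poly_bounded (fun=> c).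
Proof.
exists c => n; apply: leq_trans (ltnW (ltn_expl c (isT : 1 < 2))) _.
by case: c => // c; rewrite leq_exp2r //; lia.
Qed.

Lemma poly_bounded_id : poly_bounded id.
Proof. by exists 1 => n; rewrite expn1 leq_addr. Qed.

Lemma poly_boundedM f g :
  poly_bounded f -> poly_bounded g -> poly_bounded (fun n => f n * g n).
Proof. by move=> [d H] [e H']; exists (d + e) => n; rewrite expnD leq_mul. Qed.

Lemma poly_boundedD f g :
  poly_bounded f -> poly_bounded g -> poly_bounded (fun n => f n + g n).
Proof.
move=> [d H] [e H']; exists (d + e).+1 => n; rewrite expnS.
have le_d : (n + 2) ^ d <= (n + 2) ^ (d + e) by rewrite leq_pexp2l //; lia.
have le_e : (n + 2) ^ e <= (n + 2) ^ (d + e) by rewrite leq_pexp2l //; lia.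
have := H n; have := H' n; nia.
Qed.

Lemma poly_boundedX f c : poly_bounded f -> poly_bounded (fun n => f n ^ c).
Proof.
move=> pf; elim: c => [|c IH]; first exact: poly_bounded_const 1.
by apply: poly_boundedW (poly_boundedM pf IH) => n; rewrite expnS.
Qed.

Lemma poly_bounded_comp f g :
  poly_bounded f -> poly_bounded g -> poly_bounded (fun n => f (g n)).
Proof.
move=> [d H] pg.
have := poly_boundedX d (poly_boundedD pg (poly_bounded_const 2)).
exact: poly_boundedW.
Qed.

Lemma poly_bounded_pbound c f : poly_bounded f -> poly_bounded (fun n => pbound c (f n)).
Proof.
move=> pf; apply: poly_boundedD (poly_bounded_const c).
exact: poly_boundedM (poly_bounded_const c) (poly_boundedX c pf).
Qed.

Lemma poly_boundedP f : poly_bounded f -> exists c, forall n, f n <= pbound c n.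
Proof.
(* For positive arguments [n.+1 + 2 <= 3 * n.+1] yields the factor [3 ^ d], and [d < 3 ^ d] takes
   care of the exponent; the additive constant covers argument 0. *)
move=> [d H]; exists (3 ^ d) => n; apply: leq_trans (H n) _; rewrite /pbound.
case: n => [|n].
  apply: leq_trans (leq_addl _ _); case: (d) => // e; by rewrite leq_exp2r.
apply: leq_trans (leq_addr _ _).
have le1 : (n.+1 + 2) ^ d <= 3 ^ d * n.+1 ^ d.
  by rewrite -expnMn; case: (d) => // e; rewrite leq_exp2r //; lia.
apply: leq_trans le1 _; rewrite leq_mul2l leq_pexp2l ?orbT //.
by apply: ltnW; apply: ltn_expl.
Qed.

Lemma poly_bounded_cost p : poly_bounded (cost p).
Proof.
have unit a : poly_bounded (fun B => a * B.+1).
  apply: poly_boundedM (poly_bounded_const a) _.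
  by apply: poly_boundedW (poly_boundedD poly_bounded_id (poly_bounded_const 1)) => n; lia.
elim: p => [|r||r r'|b|p IHp q IHq|c p IHp q IHq|v w p IH] //=.
- exact: poly_boundedD.
- apply: poly_boundedD; last exact: poly_boundedD.
  exact: poly_boundedM (poly_bounded_const _) (unit 10).
exact: poly_boundedD (poly_boundedM poly_bounded_id (poly_boundedD IH (unit 20))) (unit 20).
Qed.

(** [Out] sweeps over the whole output, so the time bound needs a bound on the output length besides
    the one on the registers. *)
Fixpoint outs (p : prog) (B : nat) : nat :=
  match p with
  | Skip | Inc _ | Grow | Cpy _ _ => 0
  | Out _ => 1
  | Seq p q | If _ p q => outs p B + outs q B
  | For _ _ p => B * outs p B
  end.

Lemma poly_bounded_outs p : poly_bounded (outs p).
Proof.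
elim: p => [|r||r r'|b|p IHp q IHq|c p IHp q IHq|v w p IH] /=;
  try exact: poly_bounded_const; try exact: poly_boundedD.
exact: poly_boundedM poly_bounded_id IH.
Qed.

Lemma size_eval_out K x p s B : wf K p -> bounded s -> (eval x p s).1 1 <= B ->
  size (eval x p s).2 <= size s.2 + outs p B.
Proof.
elim: p s => [|r||r r'|b|p IHp q IHq|c p IHp q IHq|v w p IH] s.
- by rewrite addn0.
- by move=> /= *; case: ifP; rewrite addn0.
- by rewrite addn0.
- by rewrite addn0.
- by move=> *; rewrite size_cat.
- move=> /= /andP[wp wq] bs leB.
  have [b1 _ _] := eval_mono x wp bs; have [_ e _] := eval_mono x wq b1.
  have := IHq _ wq b1 leB; have := IHp _ wp bs (leq_trans e leB); lia.
- move=> /= /and3P[_ wp wq] bs; case: ifP => _ leB.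
    have := IHp _ wp bs leB; lia.
  have := IHq _ wq bs leB; lia.
move=> wfor bs leB; move: (wfor) => /= /and5P[lt1v _ _ _ /and3P[nv nw wp]].
have v0 : v != 0 by lia. have v1 : v != 1 by lia.
pose f t i := eval x p (setr t v i).
pose st i := foldl f s (iota 0 i).
have stS i : st i.+1 = f (st i) i by rewrite /st foldl_iotaS.
have [_ eE _] := eval_mono x wfor bs.
have lew := bs.2 w.
have bset t i : bounded t -> i <= t.1 1 -> bounded (setr t v i) by move=> *; apply: bounded_setr.
have setE t i : (setr t v i).1 1 = t.1 1 by rewrite /= [1 == v]eq_sym (negbTE v1).
have stb i : i <= s.1 w -> [/\ bounded (st i), s.1 1 <= (st i).1 1
    & (st i).1 1 <= B -> size (st i).2 <= size s.2 + i * outs p B].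
  elim: i => [|i IHi] lt_i; first by split=> // _; rewrite addn0.
  have [b1 e1 o1] := IHi (ltnW lt_i).
  have [|b2 e2 _] := @eval_mono K x p (setr (st i) v i) wp; first by apply: bset => //; lia.
  rewrite stS; split => //.
    by apply: leq_trans e1 _; rewrite -(setE _ i).
  move=> leBi; have := IH (setr (st i) v i) wp _ leBi.
  rewrite setE in e2; have := o1 (leq_trans e2 leBi).
  have bb : bounded (setr (st i) v i) by apply: bset => //; lia.
  by move=> h1 /(_ bb) /= h2; apply: leq_trans h2 _; lia.
have [_ _ H] := stb _ (leqnn _).
have leB' : (st (s.1 w)).1 1 <= B by move: leB; rewrite /= [1 == v]eq_sym (negbTE v1).
apply: leq_trans (H leB') _; rewrite leq_add2l leq_mul2r.
by apply/orP; right; apply: leq_trans lew (leq_trans eE leB).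
Qed.

(** The final value of register 1 is the only quantity to control for a given program: it bounds the
    loops, hence the output, hence the time. *)
Theorem poly_prog_TM K p (g : nat -> nat) : 3 <= K -> wf K p -> poly_bounded g ->
  (forall x, (eval x p (state0 x)).1 1 <= g (size x)) ->
  exists (M : TM) (c : nat), forall x, exists k,
    let s := eval x p (state0 x) in
    [/\ k <= pbound c (size x), haltst M (cstate (run M k x)) = Some (s.1 3 == 0)
      & output (run M k x) = s.2].
Proof.
move=> K3 wp pg gE; have [M HM] := prog_TM K3 wp; exists M.
pose B n := g n + outs p (g n).
have pB : poly_bounded B.
  exact: poly_boundedD pg (poly_bounded_comp (poly_bounded_outs p) pg).
have : poly_bounded (fun n => cost p (B n) + 10 * (B n).+1).
  apply: poly_boundedD (poly_bounded_comp (poly_bounded_cost p) pB) _.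
  have pB1 := poly_boundedD pB (poly_bounded_const 1).
  apply: poly_boundedW (poly_boundedM (poly_bounded_const 10) pB1) => n; lia.
move=> /poly_boundedP[c Hc]; exists c => x.
have [||k [lek hk ok]] := HM x (B (size x)).
- exact: leq_trans (gE x) (leq_addr _ _).
- apply: leq_trans (size_eval_out wp (bounded_state0 x) (gE x)) _.
  exact: leq_addl.
by exists k; split => //; apply: leq_trans (Hc _).
Qed.

(** * Cuts of coloured complete graphs *)

(** The order of [edgesK] on plain numbers, which is the order in which an instance lists colours
    and in which nested loops visit edges. *)
Definition pairs (n : nat) : seq (nat * nat) :=
  [seq (u, v) | u <- iota 0 n, v <- [seq v <- iota 0 n | u < v]].

Definition epair n (e : 'I_n * 'I_n) : nat * nat := (val e.1, val e.2).

Lemma map_edgesK n : [seq epair e | e <- edgesK n] = pairs n.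
Proof.
rewrite /edgesK /pairs -val_enum_ord /allpairs_dep map_flatten -map_comp -[in RHS]map_comp; congr flatten.
by apply/eq_in_map => i _ /=; rewrite -map_comp filter_map -map_comp.
Qed.

Lemma mem_pairs n u v : ((u, v) \in pairs n) = (u < v < n).
Proof.
apply/allpairsPdep/idP => [[u' [v' [_ + [-> ->]]]]|/andP[lt_uv lt_v]].
  by rewrite mem_filter mem_iota => /andP[-> ->].
exists u, v; split => //; rewrite ?mem_filter mem_iota; lia.
Qed.

Lemma mem_edgesK n (i j : 'I_n) : ((i, j) \in edgesK n) = (i < j).
Proof.
have -> : ((i, j) \in edgesK n) = (epair (i, j) \in map (@epair n) (edgesK n)).
  by rewrite mem_map // => -[a b] [c d] [] /val_inj -> /val_inj ->.
by rewrite map_edgesK mem_pairs ltn_ord andbT.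
Qed.

Lemma size_edgesK n : size (edgesK n) = size (pairs n).
Proof. by rewrite -map_edgesK size_map. Qed.

(** The colours on a cut are a duplicate-free part of [1..p], so there are [p] of them only if all
    occur. *)
Lemma size_cut_colors n p cs (S : {set 'I_n}) : valid_coloring n p cs ->
  size (cut_colors cs S) = p <->
  (forall k, 1 <= k <= p -> k \in cut_colors cs S).
Proof.
move=> /andP[/eqP sz /allP vc].
have sub : {subset cut_colors cs S <= iota 1 p}.
  move=> k; rewrite mem_undup => /mapP[ec]; rewrite mem_filter => /andP[_].
  move=> /(map_f snd) /= kin ->; rewrite mem_iota.
  by move: kin; rewrite -/(unzip2 _) unzip2_zip ?sz // => /vc; lia.
have U : uniq (cut_colors cs S) := undup_uniq _.
split => [sp k le_k|H].
  have [|_ ->] := uniq_min_size U sub; first by rewrite sp size_iota.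
  by rewrite mem_iota; lia.
apply/eqP; rewrite eqn_leq; have := uniq_leq_size U sub; rewrite size_iota => -> /=.
rewrite -{1}(size_iota 1 p); apply: uniq_leq_size; first exact: iota_uniq.
by move=> k; rewrite mem_iota => hk; apply: H; lia.
Qed.

Lemma mem_cut_colors n cs (S : {set 'I_n}) k : size cs = size (edgesK n) ->
  reflect (exists2 ec, ec \in zip (edgesK n) cs & crosses S ec.1 /\ ec.2 = k)
          (k \in cut_colors cs S).
Proof.
move=> sz; rewrite mem_undup; apply: (iffP mapP) => [[ec]|[ec in_ec [cr <-]]].
  by rewrite mem_filter => /andP[cr in_ec] ->; exists ec.
by exists ec => //; rewrite mem_filter cr.
Qed.

Definition coloring (col : nat -> nat -> nat) n := [seq col e.1 e.2 | e <- pairs n].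

Lemma size_coloring col n : size (coloring col n) = size (edgesK n).
Proof. by rewrite size_map size_edgesK. Qed.

Lemma mem_cut_coloring n (col : nat -> nat -> nat) (S : {set 'I_n}) k :
  reflect (exists i j : 'I_n, [/\ i < j, (i \in S) != (j \in S) & col i j = k])
          (k \in cut_colors (coloring col n) S).
Proof.
have E : zip (edgesK n) (coloring col n) = [seq (e, col (epair e).1 (epair e).2) | e <- edgesK n].
  rewrite /coloring -map_edgesK -map_comp; elim: (edgesK n) => //= e s ->.
  by [].
apply: (iffP (mem_cut_colors _ _ (size_coloring _ _))); rewrite E.
  move=> [ec /mapP[[i j] ij ->] /= [cr ck]]; exists i, j; split => //.
  by rewrite -mem_edgesK.
move=> [i [j [lt_ij cr ck]]]; exists ((i, j), col i j) => //.
by apply/mapP; exists (i, j); rewrite ?mem_edgesK.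
Qed.

Section ClauseGraph.
Variables (m nv : nat) (lit : nat -> bool -> nat -> bool).

(* Vertices [2j] and [2j+1] are the false and true ends of clause [j], vertex [m.*2 + x] is
   variable [x]. The uniquely coloured path through the clause vertices forces them to alternate
   sides; an edge of colour [m.*2 + j + 1] is then cut when its literal in clause [j] is true. *)
Definition clause_col (u v : nat) : nat :=
  if (v == u.+1) && (v < m.*2) then u.+2
  else if [&& u < m.*2, m.*2 <= v & lit u./2 (odd u) (v - m.*2)] then (m.*2 + u./2).+1
  else 1.

Lemma clause_col_valid : 0 < m ->
  valid_coloring (m.*2 + nv) (3 * m) (coloring clause_col (m.*2 + nv)).
Proof.
move=> m0; rewrite /valid_coloring size_coloring eqxx /=; apply/allP => k /mapP[[u v]].
by rewrite mem_pairs /clause_col /= => uv ->; case: ifP => // c1; [lia|case: ifP => c2; lia].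
Qed.

(** Colours 2 to [m.*2] belong to the path edges, the next [m] to the clauses, and 1 is the dummy,
    whence [3 * m]. With [1 < m] some edge between clause vertices of opposite sides lies off the
    path and puts the dummy on the cut. *)
Lemma clause_colP : 1 < m ->
  colorful_cut (m.*2 + nv) (3 * m) (coloring clause_col (m.*2 + nv)) <->
  exists a : nat -> bool, forall j, j < m ->
    exists sgn x, [/\ x < nv, lit j sgn x & a x = ~~ sgn].
Proof.
move=> m1; set n := m.*2 + nv; have vc : valid_coloring n (3 * m) (coloring clause_col n).
  by apply: clause_col_valid; lia.
split=> [[S [_]]|[a sat]].
  rewrite (size_cut_colors _ vc) => full.
  pose s u := if insub u is Some i then (i : 'I_n) \in S else false.
  have sE (i : 'I_n) : (i \in S) = s i by rewrite /s valK.
  have {full}cut k : 1 <= k <= 3 * m ->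
      exists i j, [/\ i < j, j < n, s i != s j & clause_col i j = k].
    move=> /full /mem_cut_coloring[i [j [lt_ij cr ck]]].
    by exists i, j; rewrite -!sE; split.
  have alt u : u.+1 < m.*2 -> s u.+1 = ~~ s u.
    move=> lt_u; have [|i [j [_ _ ne]]] := cut u.+2; first by lia.
    rewrite /clause_col; case: ifP => [/andP[/eqP Dj _]|_]; last first.
      by case: ifP => // /and3P[]; lia.
    by move=> [Du]; move: ne; rewrite Dj Du; case: (s u); case: (s u.+1).
  have sodd u : u < m.*2 -> s u = s 0 (+) odd u.
    elim: u => [|u IH] lt_u; first by rewrite addbF.
    by rewrite alt // IH ?(ltnW lt_u) //= addbN.
  (* A set and its complement have the same cut, so truth is read relative to the side of vertex
     0. *)
  exists (fun x => s (m.*2 + x) != s 0) => j lt_j.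
  have [|i [v [_ lt_v ne]]] := cut (m.*2 + j).+1; first by lia.
  rewrite /clause_col; case: ifP => [/andP[/eqP -> ?]|_]; first by lia.
  case: ifP => // [/and3P[lt_i le_v hl]|_]; last by lia.
  move=> [Dj]; have Di : i./2 = j by lia.
  exists (odd i), (v - m.*2); rewrite -Di subnKC //; split => //; first by lia.
  by rewrite sodd // in ne; case: (odd i) ne; case: (s 0); case: (s v).
pose side u := if u < m.*2 then odd u else a (u - m.*2).
pose S : {set 'I_n} := [set i | side (val i)].
have cut u v k : u < v -> v < n -> side u != side v -> clause_col u v = k ->
    k \in cut_colors (coloring clause_col n) S.
  move=> lt_uv lt_v ne ck; apply/mem_cut_coloring.
  have lt_u := ltn_trans lt_uv lt_v.
  by exists (Ordinal lt_u), (Ordinal lt_v); rewrite !inE.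
exists S; split.
  have n0 : 0 < n by lia.
  apply/eqP => /setP /(_ (Ordinal n0)); rewrite !inE /side /=.
  by rewrite ifT //; lia.
rewrite (size_cut_colors _ vc) => k /andP[k1 le_k].
have [lt_k|le_mk] := leqP k m.*2; last first.
  have [|sgn [x [lt_x hl ax]]] := sat (k - m.*2).-1; first by lia.
  set j := (k - m.*2).-1 in hl *.
  have Dh : (j.*2 + sgn)./2 = j by lia.
  have Do : odd (j.*2 + sgn) = sgn by lia.
  apply: (cut (j.*2 + sgn) (m.*2 + x)); rewrite ?/n; try lia.
    rewrite /side ifT; last by lia.
    by rewrite ifF; [rewrite addKn ax Do; case: (sgn) | lia].
  rewrite /clause_col ifF; last by lia.
  rewrite addKn Dh Do hl ifT; lia.
case: (ltngtP k 1) => [|k2|->]; first by lia.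
  apply: (cut (k - 2) (k - 2).+1); rewrite ?/n; try lia.
    rewrite /side ifT; last by lia.
    by rewrite ifT; [rewrite /=; case: odd | lia].
  by rewrite /clause_col ifT; lia.
(* Vertices 0 and 3 have different parity and are not consecutive, so their edge is cut and has the
   dummy colour. *)
apply: (cut 0 3); rewrite ?/n; try lia; first by rewrite /side !ifT //; lia.
by rewrite /clause_col /= ifF //; lia.
Qed.

End ClauseGraph.

(** * Tableaux *)

Notation KStart := None (only parsing).
Notation KMono := (Some None) (only parsing).
Notation KEnd := (Some (Some None)) (only parsing).
Notation KRej s := (Some (Some (Some (inl s)))) (only parsing).
Notation KWin a b c := (Some (Some (Some (inr (a, b, c))))) (only parsing).

Section Tableau.
Variable M : TM.

Definition content := (tG M * option (tQ M))%type.
(** Nested options inherit a [finType] structure, whose enumeration lists the clauses attached to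
    one row and index. *)
Definition kind := option (option (option (content + content * content * content))).

(** A [config] describes the tape relative to the head. The tableau needs absolute cells, so the
    head position is carried along. *)
Definition hconf := (config M * nat)%type.

Definition hstep (ch : hconf) : hconf :=
  let: (q, l, a, r) := ch.1 in
  (step ch.1,
   if haltst M q is Some _ then ch.2 else
   match (delta M q a).2 with MoveL => ch.2.-1 | MoveR => ch.2.+1 | Stay => ch.2 end).

Definition symbol_at l a r h pos : tG M :=
  if pos < h then nth (blank M) l (h - pos.+1) else nth (blank M) (a :: r) (pos - h).

Definition cell_at (ch : hconf) (pos : nat) : content :=
  let: (q, l, a, r) := ch.1 in
  (symbol_at l a r ch.2 pos, if pos == ch.2 then Some q else None).

(** [behead] and [head] with a blank default merge the two cases of [step], inside the recorded tape
    and at its end. *)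
Lemma symbol_at_MoveL l a r h g pos :
  symbol_at (behead l) (head (blank M) l) (g :: r) h pos =
  if pos == h.+1 then g else symbol_at l a r h.+1 pos.
Proof.
rewrite /symbol_at; case: eqP => [->|ne].
  by rewrite ltnNge leqnSn subSnn.
have [lt_p|le_p] := ltnP pos h.
  by rewrite ltnW ?ltnS // nth_behead -subSn.
have [e|ne'] := eqVneq pos h; first by rewrite e ltnSn !subnn nth0.
have -> : (pos < h.+1) = false by lia.
have -> : pos - h = (pos - h.+2).+2 by lia.
by have -> : pos - h.+1 = (pos - h.+2).+1 by lia.
Qed.

Lemma symbol_at_MoveR l a r h g pos :
  symbol_at (g :: l) (head (blank M) r) (behead r) h.+1 pos =
  if pos == h then g else symbol_at l a r h pos.
Proof.
rewrite /symbol_at; case: eqP => [->|ne].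
  by rewrite ltnSn subnn.
have [lt_p|le_p] := ltnP pos h.
  by rewrite ltnS ltnW // subSn.
have -> : (pos < h.+1) = false by lia.
have -> : pos - h = (pos - h.+1).+1 by lia.
by case: (pos - h.+1) => [|i] /=; rewrite ?nth0 ?nth_behead.
Qed.

Lemma symbol_at_Stay l a r h g pos :
  symbol_at l g r h pos = if pos == h then g else symbol_at l a r h pos.
Proof.
rewrite /symbol_at; case: eqP => [->|ne]; first by rewrite ltnn subnn.
case: ltnP => // le_p; by have -> : pos - h = (pos - h.+1).+1 by lia.
Qed.

Definition samedir d d' :=
  match d, d' with MoveL, MoveL | MoveR, MoveR | Stay, Stay => true | _, _ => false end.

Definition arrives d (s : content) : option (tQ M) :=
  if s.2 is Some q then
    if haltst M q is Some _ then None else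
    if samedir d (delta M q s.1).2 then Some (delta M q s.1).1.1 else None
  else None.

Definition next_content (a b c : content) : content :=
  if b.2 is Some q then
    if haltst M q is Some _ then b else ((delta M q b.1).1.2, arrives Stay b)
  else (b.1, if arrives MoveR a is Some q then Some q else arrives MoveL c).

(** The head moves by at most one, so three neighbouring contents determine the next one. The
    hypothesis excludes a left move that the truncated predecessor would swallow. *)
Lemma cell_at_step ch pos : 0 < ch.2 ->
  cell_at (hstep ch) pos.+1 =
  next_content (cell_at ch pos) (cell_at ch pos.+1) (cell_at ch pos.+2).
Proof.
case: ch => -[[[q l] a] r] h /= h0.
rewrite /next_content /hstep /cell_at /step /arrives /=.
case Dh: (haltst M q) => [b|].
  case: (eqVneq pos.+1 h) => [<-|ne] /=; first by rewrite Dh.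
  by congr (_, _); case: eqP => [_|_]; rewrite ?Dh //=; case: eqP; rewrite ?Dh.
have Sa : symbol_at l a r h h = a by rewrite /symbol_at ltnn subnn.
case Dd: (delta M q a) => [[q' g] d] /=.
(* All directions take one form: the old symbols with [g] written at [h], and the new state at the
   new head position. *)
have -> : (let: (q1, l1, a1, r1) :=
     match d with
     | MoveL => match l with
                | [::] => (q', [::], blank M, g :: r)
                | b :: l' => (q', l', b, g :: r)
                end
     | MoveR => match r with
                | [::] => (q', g :: l, blank M, [::])
                | b :: r' => (q', g :: l, b, r')
                end
     | Stay => (q', l, g, r)
     end in
  let h' := match d with MoveL => h.-1 | MoveR => h.+1 | Stay => h end in
  (symbol_at l1 a1 r1 h' pos.+1, if pos.+1 == h' then Some q1 else None)) =
  (if pos.+1 == h then g else symbol_at l a r h pos.+1,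
   if pos.+1 == match d with MoveL => h.-1 | MoveR => h.+1 | Stay => h end
   then Some q' else None).
  case: d {Dd} => /=; last by rewrite -symbol_at_Stay.
    have [h' Dh'] : exists h', h = h'.+1 by exists h.-1; lia.
    by rewrite Dh' -(symbol_at_MoveL l a r); case: (l).
  by rewrite -(symbol_at_MoveR l a r); case: (r).
case: (eqVneq pos.+1 h) => [e_p|ne] /=.
  rewrite Dh e_p Sa Dd /=; congr (_, _).
  by case: (d) => /=; [rewrite ifF //; lia | rewrite ifF //; lia | rewrite eqxx].
congr (_, _); have [e0|ne0] := eqVneq pos h.
  rewrite Dh e0 Sa Dd /= (_ : (h.+2 == h) = false); last by lia.
  by case: (d) => /=; [rewrite ifF //; lia | rewrite eqxx | rewrite ifF //; lia].
have [e2|ne2] := eqVneq pos.+2 h.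
  rewrite /= Dh e2 Sa Dd /= -e2.
  by case: (d) => /=; [rewrite eqxx | rewrite ifF //; lia | rewrite ifF //; lia].
by case: (d); rewrite ifF //; lia.
Qed.

(** The tableau has [T] rows of width [W]; the head starts at cell [o] on the pair of [x] and a
    certificate of at most [Y] bits. *)
Variables (x : seq bool) (T W o Y : nat).

Definition hrun (w : seq bool) t : hconf := iter t hstep (init M w, o).

Lemma hrun_run w t : (hrun w t).1 = run M t w.
Proof.
by elim: t => //= t; rewrite /run /= => <-; rewrite /hstep; case: (hrun w t) => -[[[]]].
Qed.

Lemma hrun_pos w t : o - t <= (hrun w t).2 <= o + t.
Proof.
elim: t => [|t IH]; first by rewrite subn0 addn0 leqnn.
rewrite /hrun iterS -/(hrun w t) /hstep; case: (hrun w t) IH => -[[[q l] a] r] h /= IH.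
by case: (haltst M q) => [_|]; [|case: (_.2)]; lia.
Qed.

Lemma cell_at_init w pos : cell_at (init M w, o) pos =
  (if pos < o then blank M else nth (blank M) (map (inp M) w) (pos - o),
   if pos == o then Some (q0 M) else None).
Proof.
by rewrite /cell_at /init /symbol_at; case: w => [|b w] /=; case: ltnP => // _;
  rewrite ?nth_nil //; case: (pos - o) => //= k; rewrite nth_nil.
Qed.

(* What the initial row of the tableau contains at position [i]: 0 for a blank, 1 and 2 for the
   bits of the input, 3 for a cell of the certificate. *)
Definition init_codes : seq nat :=
  [seq (nat_of_bool b).+1 | b <- pair_enc x [::]] ++ nseq Y 3.
Definition init_code i := if i < o then 0 else nth 0 init_codes (i - o).

Definition code_symbol c (g : tG M) : bool :=
  match c with
  | 0 => g == blank M
  | 1 => g == inp M false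
  | 2 => g == inp M true
  | _ => (g == inp M false) || (g == inp M true)
  end.

(** A certificate cell may hold either bit or lie beyond the end of the certificate, which is the
    case [None]; all other cells leave no choice. *)
Definition start_content (at_o : bool) (c : nat) (s : option content) : bool :=
  if s is Some (g, st) then
    (st == if at_o then Some (q0 M) else None) && code_symbol c g
  else c == 3.

Definition rejecting (s : content) : bool :=
  if s.2 is Some q then haltst M q == Some false else false.

(* Literal [sgn] (negated when [true]) of variable [(t', i', s')] in clause [(t, i, k)]. Variable
   [(t, i, Some s)] says that at time [t] the cell [i + t] has content [s]; [(t, i, None)] says
   that the certificate ends before cell [i]. Clauses that make no sense are replaced by the
   tautology on [(t, i, None)]. *)
Definition tableau_lit (t i : nat) (k : kind) (sgn : bool) (t' i' : nat)
    (s' : option content) : bool :=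
  let taut := [&& t' == t, i' == i & s' == None] in
  match k with
  | KWin a b c =>
      if (t.+1 < T) && (i.+2 < W) then
        if sgn then (t' == t) && [|| (i' == i) && (s' == Some a),
            (i' == i.+1) && (s' == Some b) | (i' == i.+2) && (s' == Some c)]
        else [&& t' == t.+1, i' == i & s' == Some (next_content a b c)]
      else taut
  | KRej s =>
      if rejecting s && (t.+1 == T) then
        [&& sgn, t' == t, i' == i & s' == Some s]
      else taut
  | KStart =>
      if t == 0 then
        [&& ~~ sgn, t' == t, i' == i & start_content (i == o) (init_code i) s']
      else taut
  | KMono =>
      if [&& t == 0, init_code i == 3 & i.+1 < W] then
        [&& t' == t, i' == (if sgn then i else i.+1) & s' == None]
      else taut
  | KEnd =>
      if (t == 0) && (init_code i == 3) then
        [&& t' == t, i' == i & s' == if sgn then None else Some (blank M, None)]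
      else taut
  end.

Definition satisfies (X : nat -> nat -> option content -> bool) :=
  forall t i k, t < T -> i < W -> exists sgn t' i' s',
    [/\ t' < T, i' < W, tableau_lit t i k sgn t' i' s' & X t' i' s' = ~~ sgn].

(** In row [t] only indices with [i + 2 * t < W] are controlled, because a window reaches two
    indices further. The head stays within [T] of [o], so these margins keep it away from cell 0 and
    inside the controlled part; the last one makes input and certificate fit. *)
Hypothesis T0 : 0 < T.
Hypothesis oT : 2 * T <= o.
Hypothesis oW : o + 2 * T < W.
Hypothesis YW : o + size (pair_enc x [::]) + Y <= W.

Lemma pair_enc_cat y : pair_enc x y = pair_enc x [::] ++ y.
Proof. by rewrite /pair_enc -!catA. Qed.

Lemma init_codeE y i : size y <= Y ->
  init_code i != 3 -> 
  code_symbol (init_code i) (cell_at (init M (pair_enc x y), o) i).1.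
Proof.
move=> le_y; rewrite cell_at_init /init_code /init_codes (pair_enc_cat y) /=.
case: ltnP => [_ _|le_i]; first by rewrite /= eqxx.
set u := pair_enc x [::]; rewrite map_cat !nth_cat !size_map.
case: ltnP => [lt_i _|le_u].
  by rewrite !(nth_map true) //; case: (nth _ _ _) => /=.
have [lt_Y|le_Y _] := ltnP (i - o - size u) Y; first by rewrite nth_nseq lt_Y.
rewrite nth_nseq ltnNge le_Y /=.
by rewrite nth_default ?size_map //; lia.
Qed.

Let u := pair_enc x [::].

Lemma size_u : 0 < size u. Proof. by rewrite size_cat addn2. Qed.

Lemma init_code3 i : (init_code i == 3) = (o + size u <= i < o + size u + Y).
Proof.
rewrite /init_code; case: ltnP => [lt_i|le_i]; first by apply/esym/negbTE; lia.
rewrite /init_codes nth_cat size_map -/u; case: ltnP => [lt_u|le_u].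
  by rewrite (nth_map true) //; case: nth => /=; apply/esym/negbTE; lia.
by rewrite nth_nseq; case: ltnP => h; apply/esym; [|apply/negbTE]; lia.
Qed.

Lemma init_code_le3 i : init_code i <= 3.
Proof.
rewrite /init_code; case: ifP => // _; set j := i - o.
have [lt_j|] := ltnP j (size init_codes); last by move=> ?; rewrite nth_default.
have := mem_nth 0 lt_j; rewrite mem_cat mem_nseq => /orP[/mapP[b _ ->]|/andP[_ /eqP ->]] //.
by case: b.
Qed.

Lemma cell_at_cert y i : o + size u <= i ->
  cell_at (init M (pair_enc x y), o) i =
  (nth (blank M) (map (inp M) y) (i - (o + size u)), None).
Proof.
move=> le_i; have u0 := size_u; rewrite cell_at_init pair_enc_cat map_cat nth_cat size_map -/u.
rewrite ltnNge (leq_trans (leq_addr _ _) le_i) /= ltnNge.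
rewrite (_ : size u <= i - o) /=; last by lia.
rewrite (_ : (i == o) = false); last by lia.
by rewrite subnDA.
Qed.

Lemma tautology_sat X t i k : t < T -> i < W ->
  (forall sgn, tableau_lit t i k sgn t i None) ->
  exists sgn t' i' s',
    [/\ t' < T, i' < W, tableau_lit t i k sgn t' i' s' & X t' i' s' = ~~ sgn].
Proof.
move=> lt_t lt_i H; exists (~~ X t i None), t, i, None; split => //.
by rewrite negbK.
Qed.

Lemma satisfies_run y : size y <= Y ->
  haltst M (cstate (run M T.-1 (pair_enc x y))) = Some true -> exists X, satisfies X.
Proof.
move=> le_y acc; set w := pair_enc x y in acc.
pose X t i (s : option content) := if s is Some c then c == cell_at (hrun w t) (i + t)
                         else o + size u + size y <= i.
exists X => t i k lt_t lt_i; have u0 := size_u.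
case: k => [[[[s|[[a b] c]]|]|]|].
- case G: (rejecting s && (t.+1 == T)); last first.
    by apply: tautology_sat => // sgn; rewrite /tableau_lit G !eqxx.
  exists true, t, i, (Some s); rewrite /tableau_lit G !eqxx; split => //=.
  apply/negbTE/eqP => Ds; case/andP: G => + /eqP DT.
  have := hrun_run w t; rewrite Ds /cell_at /rejecting; case: (hrun w t) => -[[[q l] a] r] h /=.
  by case: eqP => //= _ E; move: acc; rewrite -DT /= -E /= => ->.
- case G: ((t.+1 < T) && (i.+2 < W)); last first.
    by apply: tautology_sat => // sgn; rewrite /tableau_lit G !eqxx.
  have [lt_T lt_W] := andP G.
  (* A window clause is an implication. Either a premise fails, or its three contents are those of
     the run and the conclusion is the next content of the run. *)
  case Xa: (X t i (Some a)); last first.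
    by exists true, t, i, (Some a); rewrite /tableau_lit G !eqxx.
  case Xb: (X t i.+1 (Some b)); last first.
    by exists true, t, i.+1, (Some b); rewrite /tableau_lit G !eqxx orbT; split => //; lia.
  case Xc: (X t i.+2 (Some c)); last first.
    by exists true, t, i.+2, (Some c); rewrite /tableau_lit G !eqxx !orbT; split => //; lia.
  exists false, t.+1, i, (Some (next_content a b c)); rewrite /tableau_lit G !eqxx.
  split => //; rewrite /X /= in Xa Xb Xc *.
  rewrite (eqP Xa) (eqP Xb) (eqP Xc) addnS.
  rewrite -[(i + t).+1]/(i + t).+1 -(@cell_at_step (hrun w t)) ?eqxx //.
  by have := hrun_pos w t; lia.
- case G: ((t == 0) && (init_code i == 3)); last first.
    by apply: tautology_sat => // sgn; rewrite /tableau_lit G !eqxx.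
  case XN: (X t i None); last first.
    by exists true, t, i, None; rewrite /tableau_lit G !eqxx.
  exists false, t, i, (Some (blank M, None)); rewrite /tableau_lit G !eqxx; split => //=.
  rewrite /= in XN; have /andP[/eqP -> _] := G.
  rewrite addn0 cell_at_cert; last by lia.
  by rewrite nth_default ?eqxx // size_map; lia.
- case G: [&& t == 0, init_code i == 3 & i.+1 < W]; last first.
    by apply: tautology_sat => // sgn; rewrite /tableau_lit G !eqxx.
  have [_ _ lt_W] := and3P G.
  case XN: (X t i None); last first.
    by exists true, t, i, None; rewrite /tableau_lit G !eqxx.
  exists false, t, i.+1, None; rewrite /tableau_lit G !eqxx; split => //=.
  by rewrite /= in XN *; lia.
case G: (t == 0); last first.
  by apply: tautology_sat => // sgn; rewrite /tableau_lit G !eqxx.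
case XN: ((init_code i == 3) && X t i None).
  have [c3 XN'] := andP XN.
  by exists false, t, i, None; rewrite /tableau_lit G !eqxx /=; split.
exists false, t, i, (Some (cell_at (init M w, o) i)).
rewrite /tableau_lit G !eqxx /=; split => //; last by rewrite (eqP G) addn0 eqxx.
have [c3|nc3] := eqVneq (init_code i) 3; last first.
  by rewrite /start_content; have := init_codeE le_y nc3; rewrite !cell_at_init /= => ->; rewrite eqxx.
move: XN; rewrite c3 eqxx /=; have := init_code3 i; rewrite c3 eqxx => /esym /andP[le_i _] XN.
rewrite cell_at_cert //= (nth_map true); last by lia.
rewrite (_ : (i == o) = false) ?eqxx /=; last by lia.
by case: nth; rewrite eqxx ?orbT.
Qed.

(** Several contents of a cell may be true at once. One certificate is read off and its run is shown
    to consist of true variables; further true variables do no harm. Since only rejection is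
    forbidden, halting is needed to conclude acceptance. *)
Lemma run_satisfies X : satisfies X ->
  (forall y, size y <= Y -> haltst M (cstate (run M T.-1 (pair_enc x y))) <> None) ->
  exists2 y, size y <= Y & haltst M (cstate (run M T.-1 (pair_enc x y))) = Some true.
Proof.
move=> sat halts; have u0 := size_u; pose b := o + size u.
pose f j := X 0 (b + j) None.
pose L := find f (iota 0 Y).
have le_L : L <= Y by rewrite /L -{2}(size_iota 0 Y) find_size.
(* Where both bits are true either choice would do; [true] is preferred. *)
pose y := mkseq (fun j => X 0 (b + j) (Some (inp M true, None))) L.
have sy : size y = L by rewrite size_mkseq.
exists y; first by rewrite sy.
set w := pair_enc x y.
have inW j : j < Y -> b + j < W by rewrite /b /u; lia.
have beforeL j : j < L -> f j = false.
  move=> lt_j; have := before_find 0 lt_j; rewrite nth_iota ?add0n //; lia.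
have c3 j : j < Y -> init_code (b + j) == 3 by rewrite init_code3 /b => ?; lia.
(* [KMono] carries the end mark to the right, so that [KEnd] makes the blank true in every
   certificate cell from [L] on. *)
have afterL j : L <= j < Y -> f j.
  elim: j => [|j IH] /andP[le_j lt_j].
    have hasf : has f (iota 0 Y) by rewrite has_find -/L size_iota; lia.
    by have := nth_find 0 hasf; rewrite -/L nth_iota; [rewrite (_ : 0 + L = 0) //; lia | lia].
  have [e|ne] := eqVneq L j.+1.
    have hasf : has f (iota 0 Y) by rewrite has_find -/L size_iota; lia.
    by have := nth_find 0 hasf; rewrite -/L nth_iota ?e //; lia.
  have fj : f j by apply: IH; lia.
  have [sgn [t' [i' [s' [_ _]]]]] := sat 0 (b + j) KMono T0 (inW _ (ltnW lt_j)).
  rewrite /tableau_lit c3 /=; last by lia.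
  rewrite (_ : _ < W) => [|]; last by have := inW _ lt_j; rewrite addnS.
  move=> /and3P[/eqP -> /eqP -> /eqP ->].
  by case: sgn; rewrite -?addnS //= -/(f j) fj.
(* Before [L] the end mark is false, so [KStart] makes one of the two bits true; outside the
   certificate it admits a single content. *)
have row0 i : i < W -> X 0 i (Some (cell_at (hrun w 0) i)).
  move=> lt_i; have [sgn [t' [i' [s' [_ _]]]]] := sat 0 i KStart T0 lt_i.
  rewrite /tableau_lit /= => /and4P[/negbTE -> /eqP -> /eqP ->].
  have [cc|nc] := eqVneq (init_code i) 3.
    have := init_code3 i; rewrite cc eqxx => /esym /andP[le_i lt_iY].
    pose j := i - b; have Di : i = b + j by rewrite /j /b; lia.
    have lt_j : j < Y by lia.
    rewrite cell_at_cert // -/b -/j.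
    have [lt_jL|le_Lj] := ltnP j L; last first.
      move=> _ _; rewrite nth_default; last by rewrite size_map sy.
      have [sgn' [t1 [i1 [s1 [_ _]]]]] := sat 0 i KEnd T0 lt_i.
      rewrite /tableau_lit cc /= => /and3P[/eqP -> /eqP -> /eqP ->].
      have := afterL j; rewrite le_Lj lt_j /f -Di => /(_ isT) Xf.
      by case: sgn' => //=; rewrite Xf.
    have := beforeL _ lt_jL; rewrite /f -Di => nX.
    rewrite (nth_map true) ?sy // nth_mkseq // -Di.
    case Xt: (X 0 i (Some (inp M true, None))) => //.
    rewrite (_ : (i == o) = false); last by rewrite /b in Di; lia.
    case: s' => [[g st]|_]; last by rewrite nX.
    by move=> /= /andP[/eqP ->] /orP[/eqP ->|/eqP ->] //; rewrite Xt.
  have le_y : size y <= Y by rewrite sy.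
  have := init_codeE le_y nc; rewrite -/w.
  case: s' => [[g st]|] /=; last by rewrite (negbTE nc).
  rewrite /hrun /= !cell_at_init /= => E /andP[/eqP Dst E'] XX.
  set c := if i < o then _ else _ in E *.
  suff <- : (g, st) = (c, if i == o then Some (q0 M) else None) by rewrite XX.
  rewrite Dst; congr (_, _); move: E E' nc (init_code_le3 i).
  by case: (init_code i) => [|[|[|[|n]]]] //= /eqP -> /eqP ->.
(* The window clause is taken for the actual contents; its premises are true by induction, which
   leaves only its conclusion. *)
have row t i : t < T -> i + 2 * t < W -> X t i (Some (cell_at (hrun w t) (i + t))).
  elim: t i => [|t IH] i lt_t lt_i; first by rewrite addn0; apply: row0; lia.
  have lt_T : t < T by lia.
  have lt_iW : i < W by lia.
  have [sgn [t' [i' [s' [_ _]]]]] := sat t i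
    (KWin (cell_at (hrun w t) (i + t)) (cell_at (hrun w t) (i.+1 + t))
          (cell_at (hrun w t) (i.+2 + t))) lt_T lt_iW.
  rewrite /tableau_lit lt_t (_ : i.+2 < W) /=; last by lia.
  case: sgn => [/andP[/eqP -> /or3P[]] /andP[/eqP -> /eqP ->]|] /=.
  - by rewrite IH //; lia.
  - by rewrite IH //; lia.
  - by rewrite IH //; lia.
  move=> /and3P[/eqP -> /eqP -> /eqP ->]; rewrite addnS.
  rewrite -[(i.+2 + t)]/(i + t).+2 -[(i.+1 + t)]/(i + t).+1 -cell_at_step //.
  by have := hrun_pos w t; lia.
(* Only rejection remains to be refuted: the content under the head would then violate a [KRej]
   clause in the last row. *)
case Dh: (haltst M _) (halts y) => [[] |] => [//|H|/(_ _) []]; rewrite ?sy //.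
have lt_T : T.-1 < T by lia.
have := hrun_pos w T.-1; have := hrun_run w T.-1; have := row T.-1.
case: (hrun w T.-1) => -[[[q l] a] r] h rowT /= Dq le_h.
have lt_i : (h - T.-1) + 2 * T.-1 < W by lia.
have := rowT _ lt_T lt_i; rewrite subnK; last by lia.
set c := cell_at _ _ => Xc.
have rc : rejecting c.
  by rewrite /rejecting /c /cell_at /= eqxx; move: Dh; rewrite -Dq /= => ->.
have lt_iW : h - T.-1 < W by lia.
have [sgn [t' [i' [s' [_ _]]]]] := sat T.-1 (h - T.-1) (KRej c) lt_T lt_iW.
rewrite /tableau_lit rc prednK // eqxx /= => /and4P[-> /eqP -> /eqP -> /eqP ->].
by rewrite Xc.
Qed.

Theorem tableauP (V : seq bool -> Prop) :
  (forall y, size y <= Y -> exists2 b,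
     haltst M (cstate (run M T.-1 (pair_enc x y))) = Some b &
     b = true <-> V (pair_enc x y)) ->
  (exists X, satisfies X) <-> exists2 y, size y <= Y & V (pair_enc x y).
Proof.
move=> dec; split => [[X sat]|[y le_y Vy]].
  have [|y le_y acc] := run_satisfies sat.
    by move=> y /dec[b ->].
  exists y => //; have [b] := dec _ le_y; rewrite acc => -[<-] [H _]; exact: H.
have [b Hb bV] := dec _ le_y; apply: satisfies_run le_y _.
by rewrite Hb bV.2.
Qed.

End Tableau.

(** * Program fragments *)

Notation "p ;; q" := (Seq p q) (at level 61, right associativity).

Lemma eval_Seq x p q s : eval x (p ;; q) s = eval x q (eval x p s).
Proof. by []. Qed.

Lemma eval_Inc x r s : s.1 r < s.1 1 -> eval x (Inc r) s = setr s r (s.1 r).+1.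
Proof. by move=> /= ->. Qed.

Lemma eval_If x c p q s :
  eval x (If c p q) s = if ceval x c s then eval x p s else eval x q s.
Proof. by []. Qed.

(* Registers 4-8 are the scratch registers of [Emit]. *)
Definition Halve : prog :=
  Cpy 5 0 ;; Cpy 6 0 ;;
  For 7 4 (If (CEq 6 0) (Inc 6) (Cpy 6 0 ;; Inc 5)).

Lemma eval_Halve x s : bounded s ->
  let s' := eval x Halve s in
  [/\ s'.1 5 = (s.1 4)./2, s'.1 6 = odd (s.1 4) & s'.2 = s.2].
Proof.
move=> [s0 sE]; rewrite /Halve; set F := For _ _ _.
have q_s : s.1 4 = (setr (setr s 5 0) 6 0).1 4 by [].
rewrite [eval _ _ _]/= s0 {1 2}q_s.
pose P i (t : state) :=
  [/\ t.1 5 = i./2, t.1 6 = odd i, t.1 1 = s.1 1, t.1 0 = 0 & t.2 = s.2].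
have: P (s.1 4) (eval x F (setr (setr s 5 0) 6 0)).
  rewrite q_s; apply: (@eval_For_ind x P) => //= i t lt_i [h5 h6 h1 h0 ho].
  have i1 : 0 < s.1 1 by have := sE 4; lia.
  have i2 : i./2 < s.1 1 by have := sE 4; lia.
  case Oi: (odd i); rewrite h6 h0 Oi /=.
    by rewrite h5 h1 i2; split => //=; rewrite ?uphalf_half ?Oi ?add1n ?h5 ?h1.
  by rewrite h1 i1; split => //=; rewrite ?uphalf_half ?Oi ?add0n ?h5.
by case.
Qed.

Lemma bits_auxE f k : k <= f -> bits_aux f k = bits k.
Proof.
rewrite /bits; move: {2}k (leqnn k) => n; elim: n f k => [|n IH] f k.
  by rewrite leqn0 => /eqP -> _; case: f.
case: k => [|k]; first by move=> _ _; case: f.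
case: f => // f le_k le_f /=; congr (_ :: _).
by rewrite IH 1?[RHS]IH //; lia.
Qed.

Lemma bitsE k : bits k = if k == 0 then [::] else odd k :: bits k./2.
Proof.
case: k => // k; rewrite {1}/bits [bits_aux _ _]/=; congr (_ :: _).
by rewrite bits_auxE //=; lia.
Qed.

Definition EmitBit : prog :=
  If (CLt 0 4)
    (Halve ;;
     If (CEq 6 0) (Out false ;; Out false) (Out true ;; Out true) ;;
     Cpy 4 5) Skip.

Definition double_bits k := flatten [seq [:: b; b] | b <- bits k].

(** Written and pending bits are tracked together: their concatenation is invariant while the
    pending number shrinks. *)
Lemma eval_EmitBit x s : bounded s ->
  let s' := eval x EmitBit s in
  [/\ bounded s', s'.1 1 = s.1 1, s'.1 4 <= (s.1 4).-1
    & s'.2 ++ double_bits (s'.1 4) = s.2 ++ double_bits (s.1 4)].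
Proof.
move=> bs; have [s0 _] := bs.
have wb : wf 8 EmitBit by [].
have [bb _ _] := eval_mono x wb bs.
have e1 : (eval x EmitBit s).1 1 = s.1 1 by apply: eval_frame.
have [h5 h6 ho] := eval_Halve x bs; have h0 : (eval x Halve s).1 0 = 0 by rewrite eval_frame.
apply: And4 bb e1 _ _; rewrite eval_If [ceval _ _ _]/= s0; case: ltnP => lt4;
  try (by rewrite /=; lia); try by []; rewrite (eval_Seq x Halve);
  move: (eval x Halve s) h5 h6 ho h0 => t h5 h6 ho h0.
  by rewrite /=; case: ifP => _ /=; rewrite h5; lia.
rewrite [double_bits (s.1 4)]/double_bits bitsE gtn_eqF //= h0 h6.
by case: (odd _); rewrite /= h5 ho -!catA.
Qed.

(** As many rounds as the value of the register are enough, since the pending number drops by at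
    least one per round until it is 0; surplus rounds do nothing. *)
Definition Emit (k : nat) : prog :=
  Cpy 4 k ;;
  For 8 k EmitBit ;;
  Out false ;; Out true.

Lemma eval_Emit x k s : k \notin [:: 4; 5; 6; 7; 8] -> bounded s ->
  (eval x (Emit k) s).2 = s.2 ++ enc_nat (s.1 k).
Proof.
rewrite !inE !negb_or => /and5P[k4 k5 k6 k7 k8] bs; have [s0 sE] := bs.
pose P i (t : state) := [/\ bounded t, t.1 1 = s.1 1, t.1 4 <= s.1 k - i
  & t.2 ++ double_bits (t.1 4) = s.2 ++ double_bits (s.1 k)].
set s4 := setr s 4 (s.1 k).
have Dk : s4.1 k = s.1 k by rewrite /= (negbTE k4).
have: P (s4.1 k) (eval x (For 8 k EmitBit) s4).
  apply: (@eval_For_ind x P); rewrite ?Dk.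
  - by split => //=; [apply: bounded_setr | rewrite subn0].
  - move=> i t lt_i [bt E1 le4 ot].
    have bt' : bounded (setr t 8 i).
      by apply: bounded_setr => //; rewrite E1; have := sE k; lia.
    have [b1 e1 l1 o1] := eval_EmitBit x bt'.
    split => //; [by rewrite e1 | by apply: leq_trans l1 _; move: le4 => /=; lia | by rewrite o1].
  move=> t [bt e1 le4 ot]; split => //.
  by apply: bounded_setr => //; rewrite e1.
rewrite Dk /Emit [eval _ (_ ;; _) _]/= -/s4.
set t := setr (foldl _ _ _) _ _; rewrite -[eval _ _ _]/t => -[_ _].
rewrite subnn leqn0 => /eqP -> /=; rewrite cats0 => ->.
by rewrite /enc_nat -!catA.
Qed.
Arguments Emit : simpl never.

Lemma writes_Emit k : writes (Emit k) = [:: 4; 8; 5; 6; 7; 6; 6; 5; 4].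
Proof. by []. Qed.

Lemma wf_For K v w p : wf K (For v w p) =
  [&& 1 < v, v <= K, w <= K, v != w, v \notin writes p, w \notin writes p & wf K p].
Proof. by []. Qed.

(** * Induction rules for loops *)

Definition frame (l : seq nat) (s t : state) := forall r, r \notin l -> t.1 r = s.1 r.

(** The invariant must not depend on the counter; in return, each round may use the value of the
    counter and the initial values of all registers that the loop does not write. *)
Lemma For_ind K x (P : nat -> state -> Prop) v w p s :
  wf K (For v w p) -> bounded s -> P 0 s ->
  (forall i t k, P i t -> P i (setr t v k)) ->
  (forall i t, i < s.1 w -> P i t -> bounded t -> t.1 v = i ->
     frame (v :: writes p) s t -> P i.+1 (eval x p t)) ->
  P (s.1 w) (eval x (For v w p) s).
Proof.
move=> wfor bs P0 PE PS; move: (wfor) => /= /and5P[lt1v _ _ _ /and3P[_ _ wp]].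
have v0 : v != 0 by lia. have v1 : v != 1 by lia.
pose Q i (t : state) := [/\ P i t, bounded t, s.1 1 <= t.1 1 & frame (v :: writes p) s t].
have setv i t k : Q i t -> k <= s.1 w -> Q i (setr t v k).
  move=> [Pt bt et ft] le_k; have := bs.2 w => le_w; split; first exact: PE.
  - by apply: bounded_setr => //; lia.
  - by rewrite /= [1 == v]eq_sym (negbTE v1).
  move=> r nr; rewrite /= ft //; case: eqP => // e.
  by move: nr; rewrite e inE eqxx.
suff: Q (s.1 w) (eval x (For v w p) s) by case.
apply: (@eval_For_ind x Q) => // [i t lt_i Qt|t Qt]; last exact: setv.
have [Pt bt et ft] := setv _ _ i Qt (ltnW lt_i).
have [b1 e1 _] := eval_mono x wp bt.
split => //; first by apply: PS => //=; rewrite eqxx.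
  exact: leq_trans et e1.
by move=> r; move: (ft r); rewrite inE negb_or => H /andP[nv nw]; rewrite eval_frame // H // nv.
Qed.

Definition AddReg l r a b : prog := Cpy r a ;; For l b (Inc r).

Lemma eval_AddReg x l r a b s : uniq [:: r; l; 0; 1] -> b \notin [:: l; r] -> bounded s ->
  (eval x (AddReg l r a b) s).1 r = minn (s.1 1) (s.1 a + s.1 b).
Proof.
move=> U nb bs; rewrite /= !inE !negb_or in U nb.
have [/and3P[nrl nr0 nr1] /andP[nl0 nl1] _] := and3P U; have [nbl nbr] := andP nb.
rewrite /AddReg eval_Seq; set s1 := eval x (Cpy r a) s.
have b1 : bounded s1 by apply: bounded_setr => //; exact: bs.2.
have sb : s1.1 b = s.1 b by rewrite /= (negbTE nbr).
pose P i (t : state) := t.1 r = minn (s.1 1) (s.1 a + i).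
have : P (s1.1 b) (eval x (For l b (Inc r)) s1).
  apply: (@For_ind (maxn b (maxn l r))) => //.
  - rewrite /= !inE ![_ == r]eq_sym nrl [r == b]eq_sym nbr [l == b]eq_sym nbl; lia.
  - by rewrite /P /= eqxx addn0; have := bs.2 a; lia.
  - by move=> i t k; rewrite /P /= (negbTE nrl).
  rewrite /P => i t lt_i Pt bt tv ft.
  have e1 : t.1 1 = s.1 1.
    rewrite ft ?inE /= ![1 == _]eq_sym; first by rewrite (negbTE nr1).
    by rewrite (negbTE nr1) (negbTE nl1).
  by rewrite [eval _ _ _]/= e1; case: ltnP => lt_r /=; rewrite ?eqxx; lia.
by rewrite /P sb.
Qed.

Fixpoint silent (p : prog) : bool :=
  match p with
  | Out _ => false
  | Seq p q | If _ p q => silent p && silent q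
  | For _ _ p => silent p
  | _ => true
  end.

Lemma eval_silent x p s : silent p -> (eval x p s).2 = s.2.
Proof.
elim: p s => //= [r|p IHp q IHq|c p IHp q IHq|v w p IH] s H.
- by case: ifP.
- by case/andP: H => /IHp Hp /IHq ->.
- by case/andP: H => Hp Hq; case: ifP => _; [apply: IHp | apply: IHq].
by elim: (iota _ _) {1 3}s => //= i l IHl t; rewrite IHl IH.
Qed.

Arguments AddReg : simpl never.

Definition PairLoop u v n body : prog :=
  For u n (For v n (If (CLt u v) body Skip)).

(** Indexing the invariant by the list of visited pairs lets the output be compared with the edge
    list directly. *)
Lemma PairLoop_ind K x (Inv : seq (nat * nat) -> state -> Prop) u v n body s :
  wf K (PairLoop u v n body) -> bounded s -> u \notin writes body ->
  Inv [::] s ->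
  (forall D t k, Inv D t -> Inv D (setr t u k)) ->
  (forall D t k, Inv D t -> Inv D (setr t v k)) ->
  (forall D a b t, a < b < s.1 n -> Inv D t -> bounded t -> t.1 u = a -> t.1 v = b ->
     size D < size (pairs (s.1 n)) ->
     frame [:: u, v & writes body] s t -> Inv (rcons D (a, b)) (eval x body t)) ->
  Inv (pairs (s.1 n)) (eval x (PairLoop u v n body) s).
Proof.
move=> wfl bs nub I0 Iu Iv IS.
pose row k a := [seq (a, b) | b <- iota 0 k & a < b].
pose D a := flatten [seq row (s.1 n) a | a <- iota 0 a].
have DS a : D a.+1 = D a ++ row (s.1 n) a.
  by rewrite /D -(addn1 a) iotaD map_cat flatten_cat /= cats0.
have rowS k a : row k.+1 a = if a < k then rcons (row k a) (a, k) else row k a.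
  rewrite /row -(addn1 k) iotaD filter_cat map_cat /= add0n.
  by case: ifP => _; rewrite ?cats1 ?cats0.
have DE : D (s.1 n) = pairs (s.1 n) by [].
have prefD a b : a < s.1 n -> b <= s.1 n -> size (D a ++ row b a) <= size (pairs (s.1 n)).
  have split_iota c : c <= s.1 n -> iota 0 (s.1 n) = iota 0 c ++ iota c (s.1 n - c).
    by move=> le_c; rewrite -{1}(subnKC le_c) iotaD add0n.
  move=> lt_a le_b; rewrite -DE /D (split_iota _ lt_a) map_cat flatten_cat size_cat -/(D _) -/(D _).
  rewrite DS !size_cat -addnA leq_add2l; apply: leq_trans (leq_addr _ _).
  by rewrite /row !size_map (split_iota _ le_b) filter_cat size_cat leq_addr.
rewrite -DE; apply: (@For_ind K x (fun a t => Inv (D a) t)) => // [a t k|a t lt_a It bt tu ft].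
  exact: Iu.
have wfi : wf K (For v n (If (CLt u v) body Skip)).
  by move: wfl; rewrite /PairLoop [wf _ _]/= => /and5P[_ _ _ _ /and3P[]].
move: wfl; rewrite /PairLoop [wf _ _]/= => /and5P[_ _ _ nun /and3P[]].
rewrite inE cats0 => /norP[nuv _] nwn _.
have tn : t.1 n = s.1 n by rewrite ft //= cats0 inE [n == u]eq_sym negb_or nun.
rewrite DS -[in row _ _]tn.
apply: (@For_ind K x (fun b t => Inv (D a ++ row b a) t)) => // [|b t' k|b t' lt_b It' bt' tv ft'].
- by rewrite cats0.
- exact: Iv.
have tu' : t'.1 u = a.
  by rewrite ft' ?tu // inE /= cats0 negb_or nuv.
rewrite eval_If /= tu' tv rowS; case: ifP => // lt_ab.
rewrite -rcons_cat; apply: IS => //; first by rewrite lt_ab -tn.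
  rewrite -tn in lt_a *; have := prefD a b.+1; rewrite -tn rowS lt_ab -rcons_cat size_rcons; exact.
move=> r nr; rewrite ft' ?ft //= ?cats0 //.
by move: nr; rewrite inE negb_or => /andP[].
Qed.

Fixpoint Seqs (l : seq prog) : prog := if l is p :: l then p ;; Seqs l else Skip.

Lemma Seqs_ind x (P : nat -> state -> Prop) l s :
  P 0 s -> (forall q t, q < size l -> P q t -> P q.+1 (eval x (nth Skip l q) t)) ->
  P (size l) (eval x (Seqs l) s).
Proof.
elim: l P s => [|p l IH] P s P0 PS //=.
by apply: (IH (fun q => P q.+1)) => [|q t lt_q]; [apply: (PS 0) | apply: (PS q.+1)].
Qed.

(** * Membership in NP *)

(* Registers of the verifier: 10, 11 input positions; 13, 14 the numbers n and p; 15 reading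
   position; 16 current colour; 17, 18 addresses of the side bits and of the colours in the
   certificate; 19 pass; 20, 21 current edge; 22, 23 addresses of the sides of its ends; 24 set
   when the colour of the pass has been found on the cut; 12, 26 loop counters. *)
Definition ReadUnary r : prog :=
  Cpy r 0 ;; For 26 2 (If (CIn 15 true) (Inc r ;; Inc 15) Skip) ;; Inc 15.

Arguments ReadUnary : simpl never.

(** The bits of the input are doubled in the pairing, so two adjacent positions advance while their
    bits agree; the separator 01 is the first unequal pair and stops them for good. *)
Definition FindCertificate : prog :=
  Cpy 10 0 ;; Cpy 11 9 ;;
  For 12 2 (If (COr (CAnd (CIn 10 false) (CIn 11 false)) (CAnd (CIn 10 true) (CIn 11 true)))
              (Inc 10 ;; Inc 10 ;; Inc 11 ;; Inc 11) Skip) ;;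
  Cpy 15 10 ;; Inc 15 ;; Inc 15.

Definition ReadHeader : prog :=
  ReadUnary 13 ;; ReadUnary 14 ;; Cpy 17 15 ;; AddReg 26 18 17 13.

Definition CheckEdge : prog :=
  ReadUnary 16 ;;
  If (CEq 19 0) (Emit 16) Skip ;;
  If (COr (CEq 16 0) (CLt 14 16)) (Inc 3) Skip ;;
  AddReg 26 22 17 20 ;; AddReg 26 23 17 21 ;;
  If (CAnd (CEq 16 19) (COr (CAnd (CIn 22 true) (CNot (CIn 23 true)))
                            (CAnd (CNot (CIn 22 true)) (CIn 23 true))))
     (Cpy 24 9) Skip.

(** Pass 0 emits the colours and has none to find, so its flag is set at once; pass [k] looks for
    colour [k]. Reading the certificate anew in each pass avoids storing the colours. *)
Definition CheckColor : prog :=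
  Cpy 15 18 ;; If (CEq 19 0) (Cpy 24 9) (Cpy 24 0) ;;
  PairLoop 20 21 13 CheckEdge ;;
  If (CEq 24 0) (Inc 3) Skip.

(** Register 11 is twice the counter 12 because of the doubled input bits. Rounds beyond the input
    check that the output has ended. *)
Definition CompareOutput : prog :=
  Cpy 11 0 ;;
  For 12 1
    (If (CLt 11 10)
       (If (COr (CAnd (COb 12 false) (CIn 11 false)) (CAnd (COb 12 true) (CIn 11 true)))
          Skip (Inc 3))
       (If (COr (COb 12 false) (COb 12 true)) (Inc 3) Skip) ;;
     Inc 11 ;; Inc 11).

(** The two [Grow] leave room for positions just past the word. For [n = 0] the only vertex set is
    the full one, hence the failure. *)
Definition Verifier : prog :=
  Grow ;; Grow ;; Inc 9 ;; FindCertificate ;; ReadHeader ;;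
  If (CEq 13 0) (Inc 3) Skip ;;
  Emit 13 ;; Emit 14 ;; Cpy 27 14 ;; Inc 27 ;;
  For 19 27 CheckColor ;;
  CompareOutput.

Lemma wf_Verifier : wf 27 Verifier. Proof. by []. Qed.

Lemma onth_drop (T : Type) (s : seq T) q i : onth (drop q s) i = onth s (q + i).
Proof.
by elim: s q => [|a s IH] [|q]; rewrite ?addSn /= ?onth0n.
Qed.

(** * Correctness of the verifier program *)

Section VerifierCorrect.
Variables (x y : seq bool).
Let w := pair_enc x y.

Lemma size_pair_enc : size w = (size x).*2 + 2 + size y.
Proof.
rewrite /w /pair_enc size_cat -addnA; congr (_ + _).
by elim: x => //= b s ->; rewrite doubleS.
Qed.

Lemma onth_pair_enc i : i < size x ->
  (onth w i.*2 = onth x i) /\ (onth w i.*2.+1 = onth x i).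
Proof.
rewrite /w; elim: x i => //= c s IH [|i] // lt_i.
exact: IH.
Qed.

Lemma onth_pair_enc_sep : onth w (size x).*2 = Some false /\ onth w (size x).*2.+1 = Some true.
Proof. by rewrite /w; elim: x => //= c s IH. Qed.

Definition ones q := find negb (drop q w).
(** The minimum mirrors the saturation of [Inc]: a malformed certificate can push the reading
    position past the end of the word. *)
Definition next_pos q := minn (size w).+2 (q + ones q).+1.

Lemma ones_le q : ones q <= size w - q.
Proof. by rewrite -size_drop find_size. Qed.

Lemma onth_ones q i : i <= ones q -> (onth w (q + i) == Some true) = (i < ones q).
Proof.
rewrite /ones -onth_drop; elim: (drop q w) i => [|[] s IH] [|i] //=; exact: IH.
Qed.

Definition standard (s : state) := [/\ bounded s, s.1 1 = (size w).+2 & s.1 2 = size w].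

Lemma standard_eval p s : wf 27 p -> 1 \notin writes p -> 2 \notin writes p ->
  standard s -> standard (eval w p s).
Proof.
move=> wp n1 n2 [bs s1 s2]; have [b1 _ _] := eval_mono w wp bs.
by split; rewrite ?eval_frame.
Qed.

(** At the first bit that is not [true] the position stops moving, so the remaining rounds are idle;
    the final [Inc] skips the terminator. *)
Lemma eval_ReadUnary r s : 1 < r <= 27 -> r \notin [:: 2; 15; 26] -> standard s ->
  let s' := eval w (ReadUnary r) s in
  [/\ s'.1 r = ones (s.1 15), s'.1 15 = next_pos (s.1 15) & s'.2 = s.2].
Proof.
move=> /andP[lt1r ler] + [bs s1 s2]; rewrite !inE !negb_or => /and3P[r2 r15 r26].
have r0 : r != 0 by lia. have r1 : r != 1 by lia.
set q := s.1 15; rewrite /ReadUnary !eval_Seq; set t0 := eval w (Cpy r 0) s.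
have q0 : t0.1 15 = q by rewrite /= [15 == r]eq_sym (negbTE r15).
have b0 : bounded t0 by apply: bounded_setr => //; rewrite bs.1.
have t02 : t0.1 2 = size w by rewrite /= [2 == r]eq_sym (negbTE r2) s2.
pose P i (t : state) := [/\ t.1 r = minn i (ones q), t.1 15 = q + minn i (ones q) & t.2 = s.2].
have lq : q <= (size w).+2 by rewrite -s1; exact: bs.2.
have lo := ones_le q.
have wl : wf 27 (For 26 2 (If (CIn 15 true) (Inc r;; Inc 15) Skip)).
  by rewrite /= !inE ![_ == r]eq_sym !orbF (negbTE r26) (negbTE r2) lt1r ler.
have := @For_ind _ w P _ _ _ _ wl b0; set t1 := eval _ _ t0; rewrite t02 => H.
have [|||h1 h2 h3] := H.
- by split; rewrite ?q0 /= ?eqxx ?min0n ?addn0 ?bs.1.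
- by move=> i t k [h1 h2 h3]; split; rewrite //= [r == 26](negbTE r26).
- move=> i t lt_i [h1 h2 h3] bt _ ft.
  have e1 : t.1 1 = (size w).+2.
    by rewrite ft /= ?inE /= ?[1 == r]eq_sym ?(negbTE r1) //= (negbTE r1) s1.
  rewrite eval_If [ceval _ _ _]/= h2 onth_ones; last by lia.
  case: ltnP => lt_o; last by split => //=; lia.
  have E1 : eval w (Inc r) t = setr t r (t.1 r).+1.
    by rewrite /= e1 h1 ifT //; lia.
  rewrite eval_Seq E1 /= [15 == r]eq_sym (negbTE r15) [1 == r]eq_sym (negbTE r1) h2 e1.
  by rewrite ifT; [split => //=; rewrite ?(negbTE r15) ?eqxx ?h1; lia | lia].
have e1 : t1.1 1 = (size w).+2.
  by rewrite eval_frame /= ?inE /= [1 == r]eq_sym (negbTE r1) //= s1.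
clear H; clearbody t1; rewrite /= h2 e1; case: ltnP => lt_E; rewrite /= ?(negbTE r15) h1 ?h2; split => //; rewrite /next_pos; lia.
Qed.

Lemma eval_FindCertificate s : standard s -> s.1 9 = 1 ->
  let s' := eval w FindCertificate s in
  [/\ s'.1 10 = (size x).*2, s'.1 15 = (size x).*2 + 2 & s'.2 = s.2].
Proof.
move=> [bs s1 s2] s9; have sw := size_pair_enc.
rewrite /FindCertificate; set body := If _ _ _; rewrite !eval_Seq.
set t0 := eval w (Cpy 11 9) _.
have b0 : bounded t0 by have [] := @eval_mono 27 w (Cpy 10 0 ;; Cpy 11 9) s isT bs.
have t02 : t0.1 2 = size w by [].
have t01 : t0.1 1 = (size w).+2 by [].
pose P i (t : state) := let k := minn i (size x) in
  [/\ t.1 10 = k.*2, t.1 11 = k.*2.+1 & t.2 = s.2].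
have wl : wf 27 (For 12 2 body) by [].
have := @For_ind _ w P _ _ _ _ wl b0; rewrite t02; set t1 := eval w (For 12 2 body) t0 => H.
have [|||h1 h2 h3] := H.
- by split; rewrite /= ?min0n // ?bs.1 ?s9.
- by move=> i t k [h1 h2 h3].
- move=> i t lt_i [h1 h2 h3] bt _ ft.
  have e1 : t.1 1 = (size w).+2 by rewrite ft.
  rewrite /body eval_If [ceval _ _ _]/= h1 h2.
  have [lt_x|le_x] := ltnP i (size x).
    have Dk : minn i (size x) = i by lia.
    have [-> ->] := onth_pair_enc lt_x; rewrite ifT; last first.
      by move: lt_x; rewrite -onthTE; case: onth => // -[].
    rewrite Dk in h1 h2.
    rewrite !eval_Seq (@eval_Inc w 10 t); last by rewrite h1 e1; lia.
    rewrite (@eval_Inc w 10 (setr t 10 _)); last by rewrite /= h1 e1; lia.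
    rewrite (@eval_Inc w 11 (setr (setr t 10 _) 10 _)); last by rewrite /= h2 e1; lia.
    rewrite (@eval_Inc w 11 (setr _ 11 _)); last by rewrite /= h2 e1; lia.
    by split; rewrite /= ?h1 ?h2 //; lia.
  have Dk : minn i (size x) = size x by lia.
  have [-> ->] := onth_pair_enc_sep.
  by rewrite /=; split; rewrite ?h1 ?h2 //; lia.
have e1 : t1.1 1 = (size w).+2 by rewrite eval_frame.
have Dk : minn (size w) (size x) = size x by lia.
rewrite Dk in h1 h2; clear H; clearbody t1.
rewrite (@eval_Inc w 15 (eval w (Cpy 15 10) t1)); last by rewrite /= h1 e1; lia.
rewrite (@eval_Inc w 15 (setr _ 15 _)); last by rewrite /= h1 e1; lia.
by split; rewrite /= ?h1 ?h2 //; lia.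
Qed.

Section Loops.
Variables (n p sb cb : nat).

Definition constants (s : state) :=
  [/\ standard s, s.1 9 = 1, s.1 13 = n, s.1 14 = p & s.1 17 = sb /\ s.1 18 = cb].

Lemma constants_eval q s : wf 27 q ->
  ~~ has (fun r => r \in writes q) [:: 1; 2; 9; 13; 14; 17; 18] ->
  constants s -> constants (eval w q s).
Proof.
move=> wq /hasPn nw [ss s9 s13 s14 [s17 s18]].
by split; [apply: standard_eval => //; apply: nw | | | | ]; rewrite ?eval_frame //; apply: nw.
Qed.

Definition side u := onth w (minn (size w).+2 (sb + u)) == Some true.

Lemma eval_CheckEdge s k a b : constants s -> s.1 19 = k -> s.1 20 = a -> s.1 21 = b ->
  let c := ones (s.1 15) in
  let s' := eval w CheckEdge s in
  [/\ s'.1 15 = next_pos (s.1 15),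
      s'.2 = s.2 ++ (if k == 0 then enc_nat c else [::]),
      (s'.1 3 == 0) = (s.1 3 == 0) && (0 < c <= p)
    & (s'.1 24 == 0) = (s.1 24 == 0) && ~~ ((c == k) && (side a != side b))].
Proof.
move=> cs sk sa sb'; set c := ones _; rewrite /CheckEdge.
set p2 := If _ _ _; set p3 := If _ _ _; set p6 := If _ _ _; rewrite 5!eval_Seq.
have [ss _ _ _ _] := cs.
have [c1 q1 o1] := eval_ReadUnary (isT : 1 < 16 <= 27) isT ss.
have C1 := @constants_eval (ReadUnary 16) s isT isT cs.
have F1 r := @eval_frame w (ReadUnary 16) s r.
move: (eval w (ReadUnary 16) s) c1 q1 o1 C1 F1 => s1 c1 q1 o1 C1 F1.
have [[b1 _ _] _ _ _ _] := C1.
have C2 := @constants_eval p2 s1 isT isT C1.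
have F2 r := @eval_frame w p2 s1 r.
have o2 : (eval w p2 s1).2 = s.2 ++ (if k == 0 then enc_nat c else [::]).
  rewrite /p2 eval_If [ceval _ _ _]/= F1 // sk b1.1; case: (k == 0).
    by rewrite eval_Emit // o1 c1.
  by rewrite /= o1 cats0.
move: (eval w p2 s1) o2 C2 F2 => s2 o2 C2 F2.
have C3 := @constants_eval p3 s2 isT isT C2.
have F3 r := @eval_frame w p3 s2 r.
have [[b2 e2 _] _ _ s214 _] := C2.
have f3 : (eval w p3 s2).1 3 == 0 = (s.1 3 == 0) && (0 < c <= p).
  have h16 : s2.1 16 = c by rewrite F2.
  have h3 : s2.1 3 = s.1 3 by rewrite F2 // F1.
  rewrite /p3 /= b2.1 s214 h16 e2; case: ifP => hc /=; last by rewrite h3; lia.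
  by case: ifP; rewrite /= h3; lia.
have o3 : (eval w p3 s2).2 = s2.2 by apply: eval_silent.
move: (eval w p3 s2) f3 o3 C3 F3 => s3 f3 o3 C3 F3.
have [[b3 e3 _] _ _ _ [s317 _]] := C3.
have C4 := @constants_eval (AddReg 26 22 17 20) s3 isT isT C3.
have A4 := @eval_AddReg w 26 22 17 20 s3 isT isT b3.
have F4 r := @eval_frame w (AddReg 26 22 17 20) s3 r.
have o4 := @eval_silent w (AddReg 26 22 17 20) s3 isT.
move: (eval w (AddReg 26 22 17 20) s3) A4 o4 C4 F4 => s4 A4 o4 C4 F4.
have [[b4 e4 _] _ _ _ [s417 _]] := C4.
have C5 := @constants_eval (AddReg 26 23 17 21) s4 isT isT C4.
have A5 := @eval_AddReg w 26 23 17 21 s4 isT isT b4.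
have F5 r := @eval_frame w (AddReg 26 23 17 21) s4 r.
have o5 := @eval_silent w (AddReg 26 23 17 21) s4 isT.
move: (eval w (AddReg 26 23 17 21) s4) A5 o5 C5 F5 => s5 A5 o5 C5 F5.
have F6 r := @eval_frame w p6 s5 r.
have S4 : (onth w (s5.1 22) == Some true) = side a.
  by rewrite F5 // A4 e3 s317 F3 // F2 // F1 // sa.
have S5 : (onth w (s5.1 23) == Some true) = side b.
  by rewrite A5 e4 s417 F4 // F3 // F2 // F1 // sb'.
have [_ s59 _ _ _] := C5.
have c5 : s5.1 16 = c by rewrite F5 // F4 // F3 // F2.
have k5 : s5.1 19 = k by rewrite F5 // F4 // F3 // F2 // F1.
have o6 : (eval w p6 s5).2 = s5.2 by apply: eval_silent.
apply: And4; rewrite -/p6.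
- by rewrite F6 // F5 // F4 // F3 // F2.
- by rewrite o6 o5 o4 o3.
- by rewrite F6 // F5 // F4.
rewrite /p6 eval_If [ceval _ _ _]/= S4 S5 c5 k5.
have -> : side a && ~~ side b || ~~ side a && side b = (side a != side b).
  by case: (side a); case: (side b).
have g5 : s5.1 24 = s.1 24 by rewrite F5 // F4 // F3 // F2 // F1.
by case: ifP => h; rewrite /= ?s59 ?g5 ?andbF ?andbT.
Qed.

Definition color_pos e := iter e next_pos cb.
Definition trace (D : seq (nat * nat)) :=
  zip D (mkseq (fun e => ones (color_pos e)) (size D)).

Lemma trace_rcons D d :
  trace (rcons D d) = rcons (trace D) (d, ones (color_pos (size D))).
Proof.
by rewrite /trace size_rcons -addn1 /mkseq iotaD map_cat /= cats1 zip_rcons ?size_map ?size_iota.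
Qed.

Definition good_color (ec : nat * nat * nat) := 0 < ec.2 <= p.
Definition cut_color k (ec : nat * nat * nat) := (ec.2 == k) && (side ec.1.1 != side ec.1.2).
Definition emitted (L : seq (nat * nat * nat)) := flatten [seq enc_nat ec.2 | ec <- L].

Lemma eval_CheckColor s k : constants s -> s.1 19 = k ->
  let L := trace (pairs n) in
  let s' := eval w CheckColor s in
  s'.2 = s.2 ++ (if k == 0 then emitted L else [::]) /\
  (s'.1 3 == 0) = [&& s.1 3 == 0, all good_color L & (k == 0) || has (cut_color k) L].
Proof.
move=> cs sk L; rewrite /CheckColor; set p1 := If _ _ _; set p4 := If _ _ _; rewrite 3!eval_Seq.
have C1 := @constants_eval (Cpy 15 18) s isT isT cs.
have [[b1 _ _] _ _ _ _] := C1.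
have C2 := @constants_eval p1 _ isT isT C1.
have F2 r := @eval_frame w p1 (eval w (Cpy 15 18) s) r.
have f24 : ((eval w p1 (eval w (Cpy 15 18) s)).1 24 == 0) = (k != 0).
  have [[b _ _] s9 _ _ _] := cs.
  by rewrite /p1 /= sk b.1 s9; case: (k == 0).
have o2 : (eval w p1 (eval w (Cpy 15 18) s)).2 = s.2 by apply: eval_silent.
have f3 : (eval w p1 (eval w (Cpy 15 18) s)).1 3 = s.1 3 by rewrite F2.
have f15 : (eval w p1 (eval w (Cpy 15 18) s)).1 15 = cb.
  by rewrite F2 //=; have [_ _ _ _ []] := cs.
have f19 : (eval w p1 (eval w (Cpy 15 18) s)).1 19 = k by rewrite F2.
move: (eval w p1 _) C2 o2 f3 f15 f19 f24 => s2 C2 o2 f3 f15 f19 f24 {F2 C1 b1}.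
have [[b2 _ _] _ s213 _ _] := C2.
pose Inv D (t : state) :=
  [/\ t.1 15 = color_pos (size D),
      t.2 = s.2 ++ (if k == 0 then emitted (trace D) else [::]),
      (t.1 3 == 0) = (s.1 3 == 0) && all good_color (trace D)
    & (t.1 24 == 0) = (k != 0) && ~~ has (cut_color k) (trace D)].
have : Inv (pairs n) (eval w (PairLoop 20 21 13 CheckEdge) s2).
  rewrite -s213; apply: (@PairLoop_ind 27) => //.
  - by split; rewrite ?o2 ?f3 ?f15 ?f24 ?andbT //=; case: (k == 0); rewrite cats0.
  move=> D a b t lt_ab [i15 io i3 i24] bt ta tb _ ft.
  have Ct : constants t.
    have [[_ e1 e2] e9 e13 e14 [e17 e18]] := C2.
    by split; rewrite ?ft //; split; rewrite ?ft.
  have tk : t.1 19 = k by rewrite ft.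
  have [h15 ho h3 h24] := eval_CheckEdge Ct tk ta tb.
  split.
  - by rewrite h15 i15 size_rcons.
  - rewrite ho io i15 -catA trace_rcons /emitted map_rcons flatten_rcons.
    by case: (k == 0).
  - by rewrite h3 i3 i15 trace_rcons all_rcons -andbA; congr (_ && _); rewrite andbC.
  by rewrite h24 i24 i15 trace_rcons has_rcons negb_or -andbA; congr (_ && _); rewrite andbC.
have C3 := @constants_eval (PairLoop 20 21 13 CheckEdge) s2 isT isT C2.
move: (eval w _ s2) C3 => s3 [[b3 e1 _] _ _ _ _] [_ h2 h3 h24].
have o4 : (eval w p4 s3).2 = s3.2 by apply: eval_silent.
split; first by rewrite -/p4 o4 h2.
rewrite /p4 eval_If [ceval _ _ _]/= b3.1 h24 andbA -/L -h3.
case: (k == 0) => //=; first by rewrite andbT.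
case: (has _ _); rewrite /= ?andbT // andbF e1.
by case: ltnP => h //=; lia.
Qed.

Lemma eval_CheckColors s : constants s -> s.1 27 = p.+1 ->
  let L := trace (pairs n) in
  let s' := eval w (For 19 27 CheckColor) s in
  s'.2 = s.2 ++ emitted L /\
  (s'.1 3 == 0) = [&& s.1 3 == 0, all good_color L
                    & all (fun k => has (cut_color k) L) (iota 1 p)].
Proof.
move=> cs s27 L; have [[bs _ _] _ _ _ _] := cs.
pose Inv i (t : state) :=
  t.2 = s.2 ++ (if i == 0 then [::] else emitted L) /\
  (t.1 3 == 0) = [&& s.1 3 == 0, (i == 0) || all good_color L
                    & all (fun k => has (cut_color k) L) (iota 1 i.-1)].
have: Inv (s.1 27) (eval w (For 19 27 CheckColor) s).
  apply: (@For_ind 27) => //; first by split; rewrite ?cats0 //= andbT.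
  move=> i t _ [io i3] bt ti ft.
  have Ct : constants t.
    have [[_ e1 e2] e9 e13 e14 [e17 e18]] := cs.
    by split; rewrite ?ft //; split; rewrite ?ft.
  have [ho h3] := eval_CheckColor Ct ti.
  rewrite /Inv ho h3 io i3; case: i {ti io i3 ho h3} => [|i] /=.
    by rewrite cats0 !andbT.
  rewrite cats0; split => //.
  have -> : has (cut_color 1) L && all (fun k => has (cut_color k) L) (iota 2 i) =
            all (fun k => has (cut_color k) L) (iota 1 i) && has (cut_color i.+1) L.
    transitivity (all (fun k => has (cut_color k) L) (iota 1 (i + 1))).
      by rewrite addn1.
    by rewrite iotaD all_cat /= add1n andbT.
  by case: (s.1 3 == 0) => //=; case: (all good_color L).
by rewrite s27.
Qed.

End Loops.

Lemma eval_CompareOutput s : standard s -> s.1 10 = (size x).*2 ->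
  ((eval w CompareOutput s).1 3 == 0) = (s.1 3 == 0) && (s.2 == x).
Proof.
move=> [bs s1 s2] s10; rewrite /CompareOutput; set body := If _ _ _ ;; _; rewrite eval_Seq.
set t0 := eval w (Cpy 11 0) s; have sw := size_pair_enc.
have b0 : bounded t0 by have [] := @eval_mono 27 w (Cpy 11 0) s isT bs.
pose Inv i (t : state) :=
  [/\ t.1 11 = minn (size w).+2 i.*2, t.2 = s.2
    & (t.1 3 == 0) = (s.1 3 == 0) && all (fun j => onth s.2 j == onth x j) (iota 0 i)].
have: Inv (t0.1 1) (eval w (For 12 1 body) t0).
  apply: (@For_ind 27) => //.
    by split; rewrite /= ?bs.1 ?andbT //; lia.
  move=> i t lt_i [i11 io i3] bt ti ft.
  have e1 : t.1 1 = (size w).+2 by rewrite ft.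
  have e10 : t.1 10 = (size x).*2 by rewrite ft.
  have allS (f : pred nat) : all f (iota 0 i.+1) = all f (iota 0 i) && f i.
    by rewrite -(addn1 i) iotaD all_cat /= andbT.
  rewrite /Inv allS andbA -i3 /body eval_Seq.
  set q := If _ _ _.
  have F r := @eval_frame w q t r.
  have o1 : (eval w q t).2 = t.2 by apply: eval_silent.
  have h3 : ((eval w q t).1 3 == 0) = (t.1 3 == 0) && (onth s.2 i == onth x i).
    rewrite /q eval_If [ceval _ _ _]/= e10 i11 gtn_min.
    have fail (tt : state) : tt = eval w (Inc 3) t -> (tt.1 3 == 0) = (t.1 3 == 0) && false.
      by move=> ->; rewrite andbF /= e1; case: ltnP => //= h; lia.
    have [lt_x|le_x] := ltnP i (size x).
      have -> : ((size w).+2 < (size x).*2) || (i.*2 < (size x).*2) by lia.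
      have Dm : minn (size w).+2 i.*2 = i.*2 by lia.
      have [onx _] := onth_pair_enc lt_x.
      rewrite eval_If [ceval _ _ _]/= ti i11 Dm onx io.
      move: lt_x; rewrite -onthTE; case: (onth x i) => // b _.
      case: (onth s.2 i) => [c|]; last exact: fail.
      by case: c; case: b; rewrite /= ?andbT //; apply: fail.
    have -> : ((size w).+2 < (size x).*2) || (i.*2 < (size x).*2) = false by lia.
    rewrite eval_If [ceval _ _ _]/= ti io [onth x i]onth_default //.
    by case: (onth s.2 i) => [[]|]; rewrite /= ?andbT //; apply: fail.
  have [e1' e11'] : (eval w q t).1 1 = (size w).+2 /\ (eval w q t).1 11 = t.1 11.
    by split; rewrite F.
  move: (eval w q t) o1 h3 e1' e11' => t2 o1 h3 e1' e11' {F}.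
  have E2 (tt : state) m : tt.1 11 = minn (size w).+2 m -> tt.1 1 = (size w).+2 ->
      (eval w (Inc 11) tt).1 11 = minn (size w).+2 m.+1 /\ (eval w (Inc 11) tt).1 3 = tt.1 3.
    by move=> e11 e1t; rewrite /= e1t e11; case: ltnP => h /=; split => //; lia.
  rewrite eval_Seq; have [a1 a3] := E2 _ _ (etrans e11' i11) e1'.
  have e1'' : (eval w (Inc 11) t2).1 1 = (size w).+2 by rewrite eval_frame.
  have [c1 c3] := E2 _ _ a1 e1''.
  by split; [rewrite c1; congr minn; lia | rewrite !eval_silent // o1 | rewrite c3 a3 h3].
rewrite [t0.1 1]s1 => -[_ _ ->]; congr (_ && _).
apply/allP/eqP => [H|-> //]; apply: eq_from_onth => i.
have [lt_i|le_i] := ltnP i (size w).+2.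
  by apply/eqP; apply: H; rewrite mem_iota.
(* Agreement just past the input shows that the output is not longer than the input, which settles
   the indices that the loop does not reach. *)
have e := H (size x); rewrite mem_iota in e.
have /eqP : onth s.2 (size x) == onth x (size x) by apply: e; lia.
rewrite [RHS]onth_default // => en.
have le_s : size s.2 <= size x by rewrite -onthNE en.
have -> : onth s.2 i = None by apply: onth_default; lia.
by apply/esym/onth_default; have le_x : size x <= i by lia.
Qed.

Lemma eval_ReadHeader s q : standard s -> s.1 15 = q ->
  let s' := eval w ReadHeader s in let sb := next_pos (next_pos q) in
  [/\ s'.1 13 = ones q, s'.1 14 = ones (next_pos q), s'.1 17 = sb,
      s'.1 18 = minn (size w).+2 (sb + ones q) & s'.2 = s.2].
Proof.
move=> ss sq; rewrite /ReadHeader; set p3 := Cpy 17 15; rewrite 3!eval_Seq.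
have [c1 q1 o1] := eval_ReadUnary (isT : 1 < 13 <= 27) isT ss.
have S1 := @standard_eval (ReadUnary 13) s isT isT isT ss.
move: (eval w (ReadUnary 13) s) c1 q1 o1 S1 => s1 c1 q1 o1 S1.
have [c2 q2 o2] := eval_ReadUnary (isT : 1 < 14 <= 27) isT S1.
have S2 := @standard_eval (ReadUnary 14) s1 isT isT isT S1.
have F2 r := @eval_frame w (ReadUnary 14) s1 r.
move: (eval w (ReadUnary 14) s1) c2 q2 o2 S2 F2 => s2 c2 q2 o2 S2 F2.
have S3 := @standard_eval p3 s2 isT isT isT S2; have [b3 e3 _] := S3.
have A4 := @eval_AddReg w 26 18 17 13 (eval w p3 s2) isT isT b3.
have F4 r := @eval_frame w (AddReg 26 18 17 13) (eval w p3 s2) r.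
have o4 := @eval_silent w (AddReg 26 18 17 13) (eval w p3 s2) isT.
move: (eval w (AddReg 26 18 17 13) (eval w p3 s2)) A4 F4 o4 => s4 A4 F4 o4.
have h13 : s2.1 13 = ones q by rewrite F2 // c1 sq.
split.
- by rewrite F4.
- by rewrite F4 // /p3 /= c2 q1 sq.
- by rewrite F4 // /p3 /= q2 q1 sq.
- by rewrite A4 e3 /p3 /= q2 q1 sq h13.
by rewrite o4 /p3 /= o2 o1.
Qed.

Definition cert_pos := (size x).*2 + 2.
Definition cert_n := ones cert_pos.
Definition cert_p := ones (next_pos cert_pos).
Definition cert_sides := next_pos (next_pos cert_pos).
Definition cert_colors := minn (size w).+2 (cert_sides + cert_n).
Definition cert_trace := trace cert_colors (pairs cert_n).

(** This describes acceptance for an arbitrary [y], so soundness requires no analysis of malformed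
    certificates. *)
Lemma eval_Verifier :
  ((eval w Verifier (state0 w)).1 3 == 0) =
  [&& cert_n != 0, all (good_color cert_p) cert_trace,
      all (fun k => has (cut_color cert_sides k) cert_trace) (iota 1 cert_p)
    & enc_nat cert_n ++ enc_nat cert_p ++ emitted cert_trace == x].
Proof.
rewrite /Verifier; set p6 := If _ _ _; set p9 := Cpy _ _; set p11 := For _ _ _.
rewrite 11!eval_Seq; set s1 := eval w (Inc 9) _.
have S1 : standard s1.
  split => //=.
  by have [] := @eval_mono 27 w (Grow ;; Grow ;; Inc 9) _ isT (bounded_state0 w).
have h19 : s1.1 9 = 1 by [].
have h13 : s1.1 3 = 0 by [].
have o1 : s1.2 = [::] by [].
move: s1 S1 h19 h13 o1 => s1 S1 h19 h13 o1.
have [a2 q2 o2] := eval_FindCertificate S1 h19.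
have S2 := @standard_eval FindCertificate s1 isT isT isT S1.
have F2 r := @eval_frame w FindCertificate s1 r.
move: (eval w FindCertificate s1) a2 q2 o2 S2 F2 => s2 a2 q2 o2 S2 F2.
have [n3 p3 sb3 cb3 o3] := eval_ReadHeader S2 q2.
have S3 := @standard_eval ReadHeader s2 isT isT isT S2.
have F3 r := @eval_frame w ReadHeader s2 r.
rewrite -/cert_pos -/cert_n -/cert_p -/cert_sides -/cert_colors in n3 p3 sb3 cb3.
move: (eval w ReadHeader s2) n3 p3 sb3 cb3 o3 S3 F3 => s3 n3 p3 sb3 cb3 o3 S3 F3.
have [b3 e3 _] := S3.
have C3 : constants cert_n cert_p cert_sides cert_colors s3.
  by split => //; rewrite F3 // F2.
have C6 := @constants_eval _ _ _ _ p6 s3 isT isT C3.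
have F6 r := @eval_frame w p6 s3 r.
have f6 : ((eval w p6 s3).1 3 == 0) = (cert_n != 0).
  rewrite /p6 /= n3 b3.1 e3; have h : s3.1 3 = 0 by rewrite F3 ?F2.
  by rewrite h; case: (cert_n == 0); rewrite //= h.
have o6 : (eval w p6 s3).2 = [::] by rewrite eval_silent // o3 o2.
have a6 : (eval w p6 s3).1 10 = (size x).*2 by rewrite F6 // F3 // a2.
move: (eval w p6 s3) C6 f6 o6 a6 => s6 C6 f6 o6 a6 {F6}.
have [[b6 _ _] _ n6 _ _] := C6.
have C7 := @constants_eval _ _ _ _ (Emit 13) s6 isT isT C6.
have o7 := @eval_Emit w 13 s6 isT b6; rewrite o6 n6 cat0s in o7.
have F7 r := @eval_frame w (Emit 13) s6 r.
move: (eval w (Emit 13) s6) C7 o7 F7 => s7 C7 o7 F7.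
have [[b7 _ _] _ _ p7 _] := C7.
have C8 := @constants_eval _ _ _ _ (Emit 14) s7 isT isT C7.
have o8 := @eval_Emit w 14 s7 isT b7; rewrite o7 p7 in o8.
have F8 r := @eval_frame w (Emit 14) s7 r.
move: (eval w (Emit 14) s7) C8 o8 F8 => s8 C8 o8 F8.
have [[_ e8 _] _ _ p8 _] := C8.
have C10 := @constants_eval _ _ _ _ (p9 ;; Inc 27) s8 isT isT C8.
have F10 r := @eval_frame w (p9 ;; Inc 27) s8 r.
have o10 := @eval_silent w (p9 ;; Inc 27) s8 isT.
have lp : cert_p <= size w by apply: leq_trans (ones_le _) (leq_subr _ _).
have h27 : (eval w (p9 ;; Inc 27) s8).1 27 = cert_p.+1.
  by rewrite /p9 /= p8 e8 ifT //; lia.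
rewrite -[eval w (Inc 27) (eval w p9 s8)]/(eval w (p9 ;; Inc 27) s8).
move: (eval w (p9 ;; Inc 27) s8) C10 o10 h27 F10 => s10 C10 o10 h27 F10.
have [o11 f11] := eval_CheckColors C10 h27.
have F11 r := @eval_frame w p11 s10 r.
have [S10 _ _ _ _] := C10.
have S11 := @standard_eval p11 s10 isT isT isT S10.
rewrite eval_CompareOutput //; last by rewrite F11 // F10 // F8 // F7 // a6.
rewrite f11 o11 o10 o8 F10 // F8 // F7 // f6 -!andbA -catA.
by [].
Qed.

End VerifierCorrect.

Lemma eval_Verifier_rE w : (eval w Verifier (state0 w)).1 1 = (size w).+2.
Proof.
rewrite /Verifier eval_Seq [eval _ (_ ;; _) (eval _ _ _)]eval_Seq eval_frame //.
Qed.

Lemma inP_Verifier : inP (fun w => (eval w Verifier (state0 w)).1 3 = 0).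
Proof.
have [||M [c HM]] := @poly_prog_TM 27 Verifier (fun n => n + 2) isT wf_Verifier.
- exact: poly_boundedD poly_bounded_id (poly_bounded_const 2).
- by move=> w; rewrite eval_Verifier_rE addn2.
exists M, c => w; have [k [le_k hk _]] := HM w; exists k; split => //.
exists ((eval w Verifier (state0 w)).1 3 == 0); split => //; by split => [/eqP|->].
Qed.

(** * Soundness and completeness of certificates *)

Lemma cut_colors_zip n cs (S : {set 'I_n}) (side : nat -> bool) k :
  size cs = size (edgesK n) -> (forall i : 'I_n, (i \in S) = side i) ->
  (k \in cut_colors cs S) =
  has (fun ec => (ec.2 == k) && (side ec.1.1 != side ec.1.2)) (zip (pairs n) cs).
Proof.
move=> sz HS; rewrite -map_edgesK.
have -> : zip [seq epair e | e <- edgesK n] cs =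
    [seq (epair ec.1, ec.2) | ec <- zip (edgesK n) cs].
  by elim: (edgesK n) cs {sz} => [|e s IH] [|c cs] //=; rewrite IH.
rewrite has_map; apply/(mem_cut_colors _ _ sz)/hasP => [[ec in_ec [cr <-]]|[ec in_ec]].
  by exists ec; rewrite //= eqxx -!HS.
by rewrite /= -!HS => /andP[/eqP <- cr]; exists ec.
Qed.

Lemma verifier_sound x y : (eval (pair_enc x y) Verifier (state0 (pair_enc x y))).1 3 = 0 ->
  ColorfulCut_complete x.
Proof.
move/eqP; rewrite eval_Verifier => /and4P[n0 /allP good /allP cut /eqP Dx].
set n := cert_n x y in n0 good cut Dx; set p := cert_p x y in good cut Dx.
set L := cert_trace x y in good cut Dx.
pose cs := mkseq (fun e => ones x y (color_pos x y (cert_colors x y) e)) (size (pairs n)).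
have DL : L = zip (pairs n) cs by [].
have szc : size cs = size (pairs n) by rewrite size_mkseq.
have Dcs : cs = unzip2 L by rewrite DL unzip2_zip // szc.
have vc : valid_coloring n p cs.
  rewrite /valid_coloring size_edgesK szc eqxx /=; apply/allP => c.
  by rewrite Dcs => /mapP[ec /good + ->].
exists n, p, cs; split; last split => //.
  by rewrite -Dx Dcs /enc_instance /enc_nats /= -map_comp.
(* Without colours to find, the side bits may well describe the full set, so the empty set is taken
   instead. *)
have [p0|p0] := posnP p.
  exists set0; split; last by apply/(size_cut_colors _ vc); rewrite p0; lia.
  have n1 : 0 < n by lia.
  by apply/eqP => /setP /(_ (Ordinal n1)); rewrite !inE.
pose S : {set 'I_n} := [set i | side x y (cert_sides x y) (val i)].
have full k : 1 <= k <= p -> k \in cut_colors cs S.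
  move=> hk; rewrite (@cut_colors_zip _ _ _ (side x y (cert_sides x y))) //.
  - by rewrite -DL; apply: cut; rewrite mem_iota; lia.
  - by rewrite size_edgesK.
  by move=> i; rewrite inE.
exists S; split; last by apply/(size_cut_colors _ vc).
(* The full set has an empty cut, but colour 1 is on the cut. *)
apply/eqP => ST; have := full 1; rewrite p0 => /(_ isT).
have sz : size cs = size (edgesK n) by rewrite size_edgesK.
by move=> /(mem_cut_colors _ _ sz)[[e c] _ [/=]]; rewrite /crosses ST !inE.
Qed.

(** The edges at vertex 0 suffice. The number [n] is written in binary, but the list of colours
    makes the instance long enough for [n] in unary. *)
Lemma leq_size_pairs n : n <= (size (pairs n)).+1.
Proof.
case: n => // n; rewrite ltnS -{1}(size_iota 1 n) -(size_map (pair 0)).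
apply: uniq_leq_size; first by rewrite map_inj_uniq ?iota_uniq // => a b [].
by move=> uv /mapP[v]; rewrite mem_iota => lt_v ->; rewrite mem_pairs; lia.
Qed.

Lemma size_enc_nat k : 2 <= size (enc_nat k).
Proof. by rewrite size_cat leq_addl. Qed.

Lemma size_enc_nats s : 2 * size s <= size (enc_nats s).
Proof.
elim: s => //= k s IH; rewrite /enc_nats /= size_cat -/(enc_nats s).
by have := size_enc_nat k; lia.
Qed.

Definition unary c := rcons (nseq c true) false.

Lemma size_unaries l m : (forall c, c \in l -> c <= m) ->
  size (flatten [seq unary c | c <- l]) <= size l * m.+1.
Proof.
elim: l => //= c l IH le_m; rewrite size_cat mulSn leq_add //.
  by rewrite size_rcons size_nseq ltnS le_m // inE eqxx.
by apply: IH => c' hc; apply: le_m; rewrite inE hc orbT.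
Qed.

Lemma ones_unary x y pre c post : pair_enc x y = pre ++ unary c ++ post ->
  ones x y (size pre) = c /\ next_pos x y (size pre) = size (pre ++ unary c).
Proof.
move=> Dw; have o : ones x y (size pre) = c.
  rewrite /ones Dw drop_size_cat // /unary.
  by elim: c {Dw} => //= c ->.
split => //; rewrite /next_pos o size_cat size_rcons size_nseq Dw !size_cat size_rcons size_nseq.
lia.
Qed.

(** Unary certificates are short: a cut with [p] colours has at least [p] edges, and colours are at
    most [p], so every number is at most one more than the number of listed colours. The length is
    quadratic in that number. *)
Lemma verifier_complete n p cs (S : {set 'I_n}) :
  let x := enc_instance n p cs in
  valid_coloring n p cs -> S != setT -> size (cut_colors cs S) = p ->
  exists2 y, size y <= pbound 5 (size x) &
    (eval (pair_enc x y) Verifier (state0 (pair_enc x y))).1 3 = 0.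
Proof.
move=> x vc ST full; have [/eqP szc0 /allP good] := andP vc.
have szc : size cs = size (pairs n) by rewrite -size_edgesK.
pose s u := if insub u is Some i then (i : 'I_n) \in S else false.
have sE (i : 'I_n) : (i \in S) = s i by rewrite /s valK.
pose body := flatten [seq unary c | c <- cs].
pose y := unary n ++ unary p ++ mkseq s n ++ body.
have n0 : n != 0.
  by apply/eqP => e; subst n; move/eqP: ST; apply; apply/setP => -[].
exists y.
  have p_le : p <= size cs.
    rewrite -full; apply: leq_trans (size_undup _) _.
    by rewrite size_map size_filter (leq_trans (count_size _ _)) // size_zip geq_minr.
  have X4 : 2 * (size cs).+2 <= size x := size_enc_nats [:: n, p & cs].
  have n_le := leq_size_pairs n; rewrite -szc in n_le.
  have sb : size body <= size cs * (size cs).+1.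
    by apply: size_unaries => c /good hc; lia.
  have -> : size y = n.+1 + (p.+1 + (n + size body)).
    by rewrite /y !size_cat !size_rcons !size_nseq size_mkseq.
  rewrite /pbound.
  have X2 : size x ^ 2 <= size x ^ 5 by rewrite leq_pexp2l //; lia.
  have X3 : size cs * (size cs).+1 <= size x * size x by apply: leq_mul; lia.
  have X5 : 2 * size x <= size x * size x by rewrite leq_mul2r; apply/orP; right; lia.
  rewrite -mulnn in X2; move: (size x ^ 5) (size x * size x) (size cs * _) X2 X3 X5 sb => *; lia.
set w := pair_enc x y.
have Dw : w = pair_enc x [::] ++ y by rewrite /w /pair_enc -!catA.
have spre : size (pair_enc x [::]) = cert_pos x.
  by rewrite size_pair_enc addn0.
have [on nn] := @ones_unary x y (pair_enc x [::]) n (unary p ++ mkseq s n ++ body) Dw.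
rewrite spre -/(cert_n x y) in on nn.
have Dw2 : w = (pair_enc x [::] ++ unary n) ++ unary p ++ mkseq s n ++ body by rewrite -catA.
have [op np] := ones_unary Dw2; rewrite -nn -/(cert_p x y) -/(cert_sides x y) in op np.
set pre := (_ ++ _) ++ _ in np.
have Dw3 : w = pre ++ mkseq s n ++ body by rewrite /pre -!catA.
have Dcol : cert_colors x y = size (pre ++ mkseq s n).
  rewrite /cert_colors on np size_cat size_mkseq -/w Dw3 !size_cat size_mkseq; lia.
have sideE u : u < n -> side x y (cert_sides x y) u = s u.
  move=> lt_u; rewrite /side np -/w (_ : minn _ _ = size pre + u); last first.
    by rewrite Dw3 !size_cat size_mkseq; lia.
  rewrite Dw3 onth_cat ltnNge leq_addr /= addKn onth_cat size_mkseq lt_u.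
  by rewrite /mkseq onth_map onthE (nth_map 0) ?size_iota //= nth_iota // add0n; case: (s u).
have colE e : e <= size cs -> color_pos x y (cert_colors x y) e =
    size ((pre ++ mkseq s n) ++ flatten [seq unary c | c <- take e cs]).
  elim: e => [|e IH] lt_e; first by rewrite take0 cats0 Dcol.
  rewrite /color_pos iterS -/(color_pos _ _ _ e) IH ?(ltnW lt_e) //.
  have De : cs = take e cs ++ nth 0 cs e :: drop e.+1 cs by rewrite -drop_nth // cat_take_drop.
  have [|_ ->] := @ones_unary x y ((pre ++ mkseq s n) ++ flatten [seq unary c | c <- take e cs])
    (nth 0 cs e) (flatten [seq unary c | c <- drop e.+1 cs]).
    by rewrite -/w Dw3 /body {1}De map_cat flatten_cat /= -!catA.
  by rewrite (take_nth 0) // map_rcons flatten_rcons -!catA.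
have traceE : cert_trace x y = zip (pairs n) cs.
  rewrite /cert_trace on /trace; congr zip; rewrite -szc.
  apply: (@eq_from_nth _ 0); rewrite size_mkseq // => e lt_e; rewrite nth_mkseq //.
  rewrite colE ?(ltnW lt_e) //.
  have De : cs = take e cs ++ nth 0 cs e :: drop e.+1 cs by rewrite -drop_nth // cat_take_drop.
  have [|-> //] := @ones_unary x y ((pre ++ mkseq s n) ++ flatten [seq unary c | c <- take e cs])
    (nth 0 cs e) (flatten [seq unary c | c <- drop e.+1 cs]).
  by rewrite -/w Dw3 /body {1}De map_cat flatten_cat /= -!catA.
apply/eqP; rewrite eval_Verifier on op traceE n0 /=; apply/and3P; split.
- apply/allP => -[e c] /(map_f snd) /=; rewrite -/(unzip2 _) unzip2_zip ?szc //.
  exact: good.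
- apply/allP => k; rewrite mem_iota => hk.
  have hk' : 1 <= k <= p by lia.
  have := (size_cut_colors S vc).1 full k hk'.
  rewrite (cut_colors_zip _ szc0 sE) => /hasP[[[u v] c] in_uvc /= H].
  apply/hasP; exists (u, v, c) => //; rewrite /cut_color /=.
  have : (u, v) \in pairs n.
    by have := map_f fst in_uvc; rewrite -/(unzip1 _) unzip1_zip ?szc.
  by rewrite mem_pairs => /andP[lt_uv lt_v]; rewrite !sideE // (ltn_trans lt_uv).
rewrite /emitted /x /enc_instance /enc_nats /=; apply/eqP; congr (_ ++ (_ ++ _)).
by congr flatten; rewrite -[in RHS](@unzip2_zip _ _ (pairs n) cs) ?szc // -map_comp.
Qed.

Theorem ColorfulCut_complete_inNP : inNP ColorfulCut_complete.
Proof.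
exists (fun w => (eval w Verifier (state0 w)).1 3 = 0), 5; split; first exact: inP_Verifier.
move=> x; split => [[n [p [cs [-> [vc [S [ST full]]]]]]]|[y [_ /verifier_sound //]]].
by have [y] := verifier_complete vc ST full; exists y.
Qed.

(** * The reduction program *)

Lemma frameS (l l' : seq nat) s t : {subset l <= l'} -> frame l s t -> frame l' s t.
Proof. by move=> sub fl r nr; apply: fl; apply: contra nr => /sub. Qed.

Lemma frame_widen (l l' : seq nat) s t : all (mem l') l -> frame l s t -> frame l' s t.
Proof. by move=> /allP; apply: frameS. Qed.

Lemma frame_trans (l : seq nat) s t u : frame l s t -> frame l t u -> frame l s u.
Proof. by move=> st tu r nr; rewrite tu // st. Qed.

Lemma eval_frameS x p (ws : seq nat) s : {subset writes p <= ws} -> frame ws s (eval x p s).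
Proof. by move=> sub r nr; rewrite eval_frame //; apply: contra nr => /sub. Qed.

Lemma eval_frame_widen x p (ws : seq nat) s : all (mem ws) (writes p) -> frame ws s (eval x p s).
Proof. by move=> /allP; apply: eval_frameS. Qed.

Lemma writes_SeqS p q (ws : seq nat) : {subset writes p <= ws} -> {subset writes q <= ws} ->
  {subset writes (p ;; q) <= ws}.
Proof. by move=> hp hq r; rewrite mem_cat => /orP[/hp|/hq]. Qed.

Lemma wf_Seq K p q : wf K (p ;; q) = wf K p && wf K q.
Proof. by []. Qed.

Lemma wf_Seqs_map K (A : Type) (f : A -> prog) l :
  (forall a, wf K (f a)) -> wf K (Seqs [seq f a | a <- l]).
Proof. by move=> wff; elim: l => //= a l ->; rewrite wff. Qed.

Lemma writes_Seqs_map (A : Type) (f : A -> prog) l (ws : seq nat) :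
  (forall a, {subset writes (f a) <= ws}) -> {subset writes (Seqs [seq f a | a <- l]) <= ws}.
Proof.
by move=> sub; elim: l => //= a l IH r; rewrite mem_cat => /orP[/sub|/IH].
Qed.

Lemma Seqs_map_ind K x (A : Type) (f : A -> prog) l (ws : seq nat) (P : nat -> state -> Prop) s a0 :
  (forall a, wf K (f a)) -> (forall a, {subset writes (f a) <= ws}) -> bounded s -> P 0 s ->
  (forall q t, q < size l -> P q t -> bounded t -> frame ws s t ->
     P q.+1 (eval x (f (nth a0 l q)) t)) ->
  P (size l) (eval x (Seqs [seq f a | a <- l]) s).
Proof.
move=> wff sub bs P0 PS; pose Q q t := [/\ P q t, bounded t & frame ws s t].
suff: Q (size l) (eval x (Seqs [seq f a | a <- l]) s) by case.
rewrite -[in Q _](size_map f); apply: Seqs_ind; first by split.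
move=> q t; rewrite size_map => lt_q [Pt bt ft]; rewrite (nth_map a0) //.
have [b1 _ _] := @eval_mono K x (f (nth a0 l q)) t (wff _) bt.
split => //; first exact: PS.
by move=> r nr; rewrite (eval_frameS x t (sub _)) // ft.
Qed.

Definition Incs r c : prog := iter c (Seq (Inc r)) Skip.

Lemma wf_Incs K r c : 1 < r <= K -> wf K (Incs r c).
Proof. by move=> hr; elim: c => //= c ->; rewrite hr. Qed.

Lemma writes_Incs r c : {subset writes (Incs r c) <= [:: r]}.
Proof. by elim: c => //= c IH q; rewrite !inE => /orP[//|/IH]; rewrite inE. Qed.

Lemma silent_Incs r c : silent (Incs r c). Proof. by elim: c. Qed.

Lemma eval_Incs x (r : nat) c s : r != 1 -> s.1 r <= s.1 1 ->
  (eval x (Incs r c) s).1 r = minn (s.1 1) (s.1 r + c).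
Proof.
move=> r1; elim: c s => [|c IH] s le_r; first by rewrite addn0; apply/esym/minn_idPr.
rewrite [Incs _ _]/= eval_Seq; case: (ltnP (s.1 r) (s.1 1)) => lt_r.
  by rewrite eval_Inc // IH /= [1 == r]eq_sym (negbTE r1) eqxx ?addSnnS.
have -> : eval x (Inc r) s = s by rewrite /= ltnNge lt_r.
by rewrite IH //; lia.
Qed.

Definition AddTo l b r : prog := For l b (Inc r).

Lemma eval_AddTo x l b r s : uniq [:: r; l; 0; 1] -> b \notin [:: l; r] -> bounded s ->
  (eval x (AddTo l b r) s).1 r = minn (s.1 1) (s.1 r + s.1 b).
Proof.
move=> U nb bs; rewrite /= !inE !negb_or in U nb.
have [/and3P[nrl nr0 nr1] /andP[nl0 nl1] _] := and3P U; have [nbl nbr] := andP nb.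
pose P i (t : state) := t.1 r = minn (s.1 1) (s.1 r + i).
have : P (s.1 b) (eval x (For l b (Inc r)) s).
  apply: (@For_ind (maxn b (maxn l r))) => //.
  - rewrite /= !inE ![_ == r]eq_sym nrl [r == b]eq_sym nbr [l == b]eq_sym nbl; lia.
  - by rewrite /P addn0; have := bs.2 r; lia.
  - by move=> i t k; rewrite /P /= (negbTE nrl).
  rewrite /P => i t lt_i Pt bt tv ft.
  have e1 : t.1 1 = s.1 1.
    by rewrite ft //= !inE ![1 == _]eq_sym negb_or nl1 nr1.
  by rewrite [eval _ _ _]/= e1; case: ltnP => lt_r /=; rewrite ?eqxx; lia.
by [].
Qed.

(** * Growth of the bound and parameters of the tableau *)

Definition boostf e := e + e * e.

(** Each boost at least squares the bound. The copy in register 36 is needed because a loop may not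
    write its own bound. *)
Definition Boost : prog := Cpy 36 1 ;; For 37 36 (For 38 36 Grow).

Lemma eval_Boost x s : (eval x Boost s).1 1 = boostf (s.1 1).
Proof.
rewrite /Boost eval_Seq; set t0 := eval x (Cpy 36 1) s.
pose P k i (t : state) := t.1 1 = k + i /\ t.1 36 = s.1 1.
have inner t k : P k 0 t -> P k (s.1 1) (eval x (For 38 36 Grow) t).
  move=> [t1 t36]; rewrite -{1}t36; apply: (@eval_For_ind x (P k)) => //.
  by move=> i t' _ [h1 h36]; split => //=; rewrite h1 addnS.
pose Q i (t : state) := P (s.1 1) (i * s.1 1) t.
have : Q (t0.1 36) (eval x (For 37 36 (For 38 36 Grow)) t0).
  apply: (@eval_For_ind x Q) => //; first by split; rewrite /= ?addn0.
  move=> i t _ [h1 h36].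
  have [|g1 g36] := inner (setr t 37 i) (s.1 1 + i * s.1 1).
    by split; rewrite //= addn0.
  by split; rewrite // g1 mulSn; lia.
by case => ->.
Qed.

Definition Boosts r : prog := iter r (Seq Boost) Skip.

Lemma eval_Boosts x r s : (eval x (Boosts r) s).1 1 = iter r boostf (s.1 1).
Proof.
elim: r s => // r IH s; rewrite iterSr -(eval_Boost x).
by rewrite -IH.
Qed.

Lemma wf_Boosts r : wf 40 (Boosts r). Proof. by elim: r. Qed.

Lemma writes_Boosts r : {subset writes (Boosts r) <= [:: 36; 37; 38; 1]}.
Proof.
elim: r => // r IH q; rewrite [Boosts _]/= [writes _]/= -/(Boosts r).
rewrite -[36 :: _]/([:: 36; 37; 38; 1] ++ writes (Boosts r)) mem_cat => /orP[//|/IH]; exact.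
Qed.

Lemma silent_Boosts r : silent (Boosts r). Proof. by elim: r. Qed.

Definition PowerStep : prog := Cpy 39 0 ;; For 37 36 (AddTo 38 2 39) ;; Cpy 36 39.

Lemma eval_PowerStep x s : bounded s -> s.1 36 * s.1 2 <= s.1 1 ->
  (eval x PowerStep s).1 36 = s.1 36 * s.1 2.
Proof.
move=> bs le_E; rewrite /PowerStep 2!eval_Seq; set t0 := eval x (Cpy 39 0) s.
have b0 : bounded t0 by have [] := @eval_mono 40 x (Cpy 39 0) s isT bs.
pose P i (t : state) := t.1 39 = i * s.1 2.
have : P (t0.1 36) (eval x (For 37 36 (AddTo 38 2 39)) t0).
  apply: (@For_ind 40) => //; first by rewrite /P /= bs.1.
  rewrite /P => i t lt_i h bt _ ft; rewrite eval_AddTo // h !ft // mulSn [t0.1 1]/= [t0.1 2]/=.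
  have : i.+1 * s.1 2 <= s.1 36 * s.1 2 by rewrite leq_mul2r lt_i orbT.
  by rewrite mulSn; lia.
by [].
Qed.

Definition Power c : prog := iter c (fun p => p ;; PowerStep) (Cpy 36 9).

Lemma wf_Power c : wf 40 (Power c). Proof. by elim: c => //= c ->. Qed.

Lemma writes_Power c : {subset writes (Power c) <= [:: 36; 37; 38; 39]}.
Proof.
elim: c => [|c IH] q; first by rewrite !inE => ->.
rewrite [writes _]/= mem_cat => /orP[/IH //|]; rewrite !inE.
by do 4!case: eqP => //=.
Qed.

Lemma eval_Power x c s : bounded s -> s.1 9 = 1 ->
  (forall i, i <= c -> s.1 2 ^ i <= s.1 1) ->
  (eval x (Power c) s).1 36 = s.1 2 ^ c.
Proof.
move=> bs s9; elim: c => [|c IH] le_E; first by rewrite /= s9.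
rewrite [Power _]/= eval_Seq -/(Power c).
have [b1 _ _] := @eval_mono 40 x (Power c) s (wf_Power c) bs.
have F := eval_frameS x s (@writes_Power c).
have P := IH (fun i le_i => le_E i (leqW le_i)).
by rewrite eval_PowerStep // P !F // -expnSr // le_E.
Qed.

(* Registers of the reduction: 9, 10, 11 the constants 1, 2, 3; 12 the certificate bound; 13, 14, 15
   the time T, the origin o and the width W of the tableau; 16-21 the clause (see [PrepareClause]);
   22, 23 time and cell of a variable; 24 the number of clause vertices; 25 the number of variables;
   26, 27 the numbers n and p of the instance; 28 the current row; 29 the current clause colour;
   30-39 temporaries. *)
Definition CertBound c : prog := iter c (fun p => p ;; AddTo 37 36 12) Skip ;; Incs 12 c.

Lemma wf_CertBound c : wf 40 (CertBound c).
Proof. by rewrite /CertBound /= wf_Incs // andbT; elim: c => //= c ->. Qed.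

Lemma writes_CertBound c : {subset writes (CertBound c) <= [:: 12; 37]}.
Proof.
move=> q; rewrite mem_cat => /orP[|/writes_Incs]; last by rewrite !inE => ->.
elim: c => //= c IH; rewrite mem_cat => /orP[/IH //|]; rewrite !inE.
by case: eqP => [->|_ /= ->]; rewrite ?orbT.
Qed.

Lemma eval_CertBound x c s : bounded s -> s.1 12 = 0 ->
  (eval x (CertBound c) s).1 12 = minn (s.1 1) (c * s.1 36 + c).
Proof.
move=> bs s12; rewrite /CertBound eval_Seq.
set p := iter c _ _.
have [w1 sub] : wf 40 p /\ {subset writes p <= [:: 12; 37]}.
  split; first by rewrite /p; elim: (c) => //= k ->.
  move=> q hq; apply: (@writes_CertBound c); by rewrite mem_cat hq.
have F := eval_frameS x s sub.
have h : (eval x p s).1 12 = minn (s.1 1) (c * s.1 36).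
  rewrite /p {p w1 sub F}; elim: c => [|c IH]; first by rewrite /= s12; lia.
  rewrite iterS eval_Seq; set q := iter c _ _.
  have wq : wf 40 q by rewrite /q; elim: (c) => //= k ->.
  have sub : {subset writes q <= [:: 12; 37]}.
    move=> r hr; apply: (@writes_CertBound c); by rewrite mem_cat hr.
  have [bq _ _] := eval_mono x wq bs.
  rewrite eval_AddTo // IH -/q !(eval_frameS x s sub) // mulSn; lia.
rewrite eval_Incs // h F //; lia.
Qed.

Definition SetupConstants : prog :=
  Grow ;; Grow ;; Grow ;; Incs 9 1 ;; Incs 10 2 ;; Incs 11 3.

(** Time, origin and width are successive values of register 1 itself: only inequalities between
    them matter, so no arithmetic is spent on them. The certificate bound has to be exact and is
    computed after the first boosts, when nothing saturates. *)
Definition Setup c r1 r2 : prog :=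
  SetupConstants ;;
  Boosts r1 ;; Power c ;; CertBound c ;;
  Cpy 13 1 ;; Boost ;; Cpy 14 1 ;; Boost ;; Cpy 15 1 ;; Boosts r2.

Lemma wf_Setup c r1 r2 : wf 40 (Setup c r1 r2).
Proof. by rewrite /Setup /= !wf_Boosts wf_Power ; have /= -> := wf_CertBound c. Qed.

Section SetupCorrect.
Variables (x : seq bool) (c r1 r2 : nat).
Let n := size x.
Let T := iter r1 boostf (n + 3).
Let o := boostf T.
Let W := boostf o.

Lemma boostf_ge e : e <= boostf e. Proof. by rewrite leq_addr. Qed.

Lemma iter_boostf_ge r e : e <= iter r boostf e.
Proof. by elim: r => //= r IH; apply: leq_trans IH (boostf_ge _). Qed.

Lemma eval_Setup : (n + 2) ^ c <= T -> pbound c n <= T ->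
  let s := eval x (Setup c r1 r2) (state0 x) in
  [/\ bounded s, s.1 1 = iter r2 boostf W, s.2 = [::],
    frame [:: 1; 9; 10; 11; 12; 13; 14; 15; 36; 37; 38; 39] (state0 x) s &
    [/\ s.1 9 = 1, s.1 10 = 2, s.1 11 = 3 &
     [/\ s.1 12 = pbound c n, s.1 13 = T, s.1 14 = o & s.1 15 = W]]].
Proof.
move=> pT YT; rewrite /Setup.
rewrite 9!eval_Seq.
set s0 := eval x SetupConstants (state0 x).
have b0 : bounded s0 by have [] := @eval_mono 40 x SetupConstants _ isT (bounded_state0 x).
have e0 : s0.1 1 = n + 3.
  by rewrite /s0 /SetupConstants 3!eval_Seq eval_frame //= /n addn3.
have h0 : [/\ s0.1 9 = 1, s0.1 10 = 2 & s0.1 11 = 3] by [].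
have F0 : frame [:: 1; 9; 10; 11] (state0 x) s0 by apply: eval_frame_widen.
have o0 : s0.2 = [::] by [].
move: s0 b0 e0 h0 F0 o0 => s0 b0 e0 h0 F0 o0.
have [b1 _ _] := eval_mono x (wf_Boosts r1) b0.
have e1 := eval_Boosts x r1 s0; rewrite e0 -/T in e1.
have F1 := eval_frameS x s0 (@writes_Boosts r1).
have o1 := eval_silent x s0 (silent_Boosts r1).
move: (eval x (Boosts r1) s0) b1 e1 F1 o1 => s1 b1 e1 F1 o1.
have [b2 _ _] := eval_mono x (wf_Power c) b1.
have F2 := eval_frameS x s1 (@writes_Power c).
have s1n : s1.1 2 = n by rewrite F1 // F0.
have [h9 h10 h11] := h0.
have s19 : s1.1 9 = 1 by rewrite F1 // h9.
have P2 : (eval x (Power c) s1).1 36 = n ^ c.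
  rewrite -s1n; apply: eval_Power => //.
  (* The base [n + 2] is used since powers of [n] are not monotone in the exponent when [n = 0]. *)
  move=> i le_i; rewrite s1n e1; apply: leq_trans pT.
  apply: (@leq_trans ((n + 2) ^ i)); last by rewrite leq_pexp2l //; lia.
  by case: (i) => // k; rewrite leq_exp2r //; lia.
have o2 : (eval x (Power c) s1).2 = s1.2.
  by apply: eval_silent; elim: (c) => //= k ->.
move: (eval x (Power c) s1) b2 F2 P2 o2 => s2 b2 F2 P2 o2.
have [b3 _ _] := eval_mono x (wf_CertBound c) b2.
have F3 := eval_frameS x s2 (@writes_CertBound c).
have Y3 : (eval x (CertBound c) s2).1 12 = pbound c n.
  have E2 : s2.1 1 = T by rewrite F2.
  have Z2 : s2.1 12 = 0 by rewrite F2 // F1 // F0.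
  by rewrite eval_CertBound // P2 E2; apply/minn_idPr.
have o3 : (eval x (CertBound c) s2).2 = s2.2.
  by apply: eval_silent; rewrite /= silent_Incs andbT; elim: (c) => //= k ->.
move: (eval x (CertBound c) s2) b3 F3 Y3 o3 => s3 b3 F3 Y3 o3.
have E3 : s3.1 1 = T by rewrite F3 // F2.
set p4 := Cpy 13 1; set p5 := Cpy 14 1; set p6 := Cpy 15 1.
have b4 : bounded (eval x Boost (eval x p4 s3)).
  by have [] := @eval_mono 40 x (p4 ;; Boost) _ isT b3.
have E4 := eval_Boost x (eval x p4 s3); rewrite [(eval x p4 s3).1 1]E3 -/o in E4.
have F4 : frame [:: 1; 13; 36; 37; 38] s3 (eval x Boost (eval x p4 s3)).
  by apply: (@eval_frame_widen x (p4 ;; Boost)).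
have h13 : (eval x Boost (eval x p4 s3)).1 13 = T.
  by rewrite eval_frame.
have o4 : (eval x Boost (eval x p4 s3)).2 = s3.2 by apply: (@eval_silent x (p4 ;; Boost)).
move: (eval x Boost (eval x p4 s3)) b4 E4 F4 h13 o4 => s4 b4 E4 F4 h13 o4.
have b5 : bounded (eval x Boost (eval x p5 s4)).
  by have [] := @eval_mono 40 x (p5 ;; Boost) _ isT b4.
have E5 := eval_Boost x (eval x p5 s4); rewrite [(eval x p5 s4).1 1]E4 -/W in E5.
have F5 : frame [:: 1; 14; 36; 37; 38] s4 (eval x Boost (eval x p5 s4)).
  by apply: (@eval_frame_widen x (p5 ;; Boost)).
have h14 : (eval x Boost (eval x p5 s4)).1 14 = o.
  by rewrite eval_frame.
have o5 : (eval x Boost (eval x p5 s4)).2 = s4.2 by apply: (@eval_silent x (p5 ;; Boost)).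
move: (eval x Boost (eval x p5 s4)) b5 E5 F5 h14 o5 => s5 b5 E5 F5 h14 o5.
have b6 : bounded (eval x p6 s5) by have [] := @eval_mono 40 x p6 _ isT b5.
have [b7 _ _] := eval_mono x (wf_Boosts r2) b6.
have e7 := eval_Boosts x r2 (eval x p6 s5); rewrite [(eval x p6 s5).1 1]E5 in e7.
have F7 : frame [:: 1; 15; 36; 37; 38] s5 (eval x (Boosts r2) (eval x p6 s5)).
  apply: (@eval_frameS x (p6 ;; Boosts r2)) => q; rewrite mem_cat => /orP[|/writes_Boosts].
    by rewrite inE => /eqP ->.
  by move: q; apply/allP.
have o7 : (eval x (Boosts r2) (eval x p6 s5)).2 = s5.2.
  by apply: (@eval_silent x (p6 ;; Boosts r2)); exact: silent_Boosts.
have h15 : (eval x (Boosts r2) (eval x p6 s5)).1 15 = W.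
  by rewrite (eval_frameS x _ (@writes_Boosts r2)).
move: (eval x (Boosts r2) _) b7 e7 F7 o7 h15 => s7 b7 e7 F7 o7 h15.
split => //; first by rewrite o7 o5 o4 o3 o2 o1.
  apply: frame_trans (frame_widen _ F7) => //; apply: frame_trans (frame_widen _ F5) => //.
  apply: frame_trans (frame_widen _ F4) => //; apply: frame_trans (frame_widen _ F3) => //.
  apply: frame_trans (frame_widen _ F2) => //; apply: frame_trans (frame_widen _ F1) => //.
  exact: frame_widen F0.
split; first by rewrite F7 // F5 // F4 // F3 // F2.
- by rewrite F7 // F5 // F4 // F3 // F2 // F1.
- by rewrite F7 // F5 // F4 // F3 // F2 // F1.
split => //.
- by rewrite F7 // F5 // F4.
- by rewrite F7 // F5.
- by rewrite F7.
Qed.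

End SetupCorrect.

(** * Loops over rows, cells and a finite list *)

Definition Grid v1 w1 v2 w2 pre (l : seq prog) : prog :=
  For v1 w1 (For v2 w2 (pre ;; Seqs l)).

Lemma writes_Grid (A : Type) (f : A -> prog) l (ws : seq nat) v1 w1 v2 w2 pre :
  (forall a, {subset writes (f a) <= ws}) ->
  {subset writes (Grid v1 w1 v2 w2 pre [seq f a | a <- l]) <= [:: v1, v2 & writes pre ++ ws]}.
Proof.
move=> sub r; rewrite /= !inE !mem_cat => /orP[->//|/orP[->|/orP[->|/(writes_Seqs_map sub) ->]]];
by rewrite !orbT.
Qed.

Lemma wf_Grid K (A : Type) (f : A -> prog) l (ws : seq nat) v1 w1 v2 w2 pre :
  (forall a, wf K (f a)) -> (forall a, {subset writes (f a) <= ws}) ->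
  wf K pre ->
  [&& 1 < v1, v1 <= K, w1 <= K, 1 < v2, v2 <= K & w2 <= K] ->
  uniq [:: v1; v2; w1] -> w2 \notin [:: v1; v2] ->
  all (fun r => r \notin writes pre ++ ws) [:: v1; v2; w1; w2] ->
  wf K (For v2 w2 (pre ;; Seqs [seq f a | a <- l])) /\
  wf K (Grid v1 w1 v2 w2 pre [seq f a | a <- l]).
Proof.
move=> wff sub wpre /and5P[lt1v1 lev1 lew1 lt1v2 /andP[lev2 lew2]] hu hw2 hws.
rewrite /= !inE negb_or in hu; rewrite !inE negb_or in hw2.
have [/andP[n12 n1w] n2w _] := and3P hu; have [nw21 nw22] := andP hw2.
have [nv1 nv2 nw1 nw2 _] := and5P hws.
have nin r : r \notin writes pre ++ ws ->
    r \notin writes (pre ;; Seqs [seq f a | a <- l]).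
  apply: contra; rewrite /= !mem_cat => /orP[->//|/(writes_Seqs_map sub) ->].
  by rewrite orbT.
have wfi : wf K (pre ;; Seqs [seq f a | a <- l]) by rewrite /= wpre wf_Seqs_map.
have wf2 : wf K (For v2 w2 (pre ;; Seqs [seq f a | a <- l])).
  by rewrite wf_For wfi lt1v2 lev2 lew2 eq_sym nw22 !nin.
split => //; rewrite /Grid wf_For wf2 lt1v1 lev1 lew1 n1w /= !inE !negb_or n12 [w1 == v2]eq_sym n2w.
by have /= -> := nin _ nv1; have /= -> := nin _ nw1.
Qed.

(** The invariant counts the executed bodies, which is the mixed-radix index of the triple
    [(a, b, q)]. A body may rely on what [pre] has computed from [a] and [b], as bodies write only
    [ws]. *)
Lemma Grid_ind K x (A : Type) (f : A -> prog) l a0 (ws : seq nat) v1 w1 v2 w2 pre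
    (P : nat -> state -> Prop) s :
  (forall a, wf K (f a)) -> (forall a, {subset writes (f a) <= ws}) ->
  wf K pre ->
  [&& 1 < v1, v1 <= K, w1 <= K, 1 < v2, v2 <= K & w2 <= K] ->
  uniq [:: v1; v2; w1] -> w2 \notin [:: v1; v2] ->
  all (fun r => r \notin writes pre ++ ws) [:: v1; v2; w1; w2] ->
  bounded s -> P 0 s ->
  (forall j t k, P j t -> P j (setr t v1 k)) ->
  (forall j t k, P j t -> P j (setr t v2 k)) ->
  (forall j t, P j t -> P j (eval x pre t)) ->
  (forall a b q t0 t, a < s.1 w1 -> b < s.1 w2 -> q < size l ->
     t0.1 v1 = a -> t0.1 v2 = b -> bounded t0 ->
     frame [:: v1, v2 & writes pre ++ ws] s t0 ->
     P ((a * s.1 w2 + b) * size l + q) t -> bounded t -> frame ws (eval x pre t0) t ->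
     P ((a * s.1 w2 + b) * size l + q).+1 (eval x (f (nth a0 l q)) t)) ->
  P (s.1 w1 * s.1 w2 * size l) (eval x (Grid v1 w1 v2 w2 pre [seq f a | a <- l]) s).
Proof.
move=> wff sub wpre hK hu hw2 hws bs P0 P1 P2 Ppre PS.
have [wf2 wf1] := wf_Grid l wff sub wpre hK hu hw2 hws.
rewrite /= !inE negb_or in hu; rewrite !inE negb_or in hw2.
have [/andP[n12 n1w] n2w _] := and3P hu; have [nw21 nw22] := andP hw2.
have [nv1 nv2 nw1 nw2 _] := and5P hws.
set W := s.1 w2; set L := size l.
have nin r : r \notin writes pre ++ ws ->
    r \notin writes (pre ;; Seqs [seq f a | a <- l]).
  apply: contra; rewrite /= !mem_cat => /orP[->//|/(writes_Seqs_map sub) ->].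
  by rewrite orbT.
pose all_ws := [:: v1, v2 & writes pre ++ ws].
have subS : {subset writes (Seqs [seq f a | a <- l]) <= ws} := writes_Seqs_map sub.
have sub_in : {subset writes (pre ;; Seqs [seq f a | a <- l]) <= all_ws}.
  move=> r; rewrite /= mem_cat /all_ws !inE mem_cat => /orP[->|/subS ->]; by rewrite ?orbT.
apply: (@For_ind K x (fun a t => P (a * W * L) t) v1 w1 _ s wf1 bs) => // [a t k|a t lt_a Pt bt t1 ft].
  exact: P1.
have fta : frame all_ws s t.
  apply: frameS ft => r; rewrite inE => /orP[/eqP ->|]; first by rewrite !inE eqxx.
  by rewrite [writes _]/= inE => /orP[/eqP -> |/sub_in //]; rewrite !inE eqxx orbT.
have nall r : r != v1 -> r != v2 -> r \notin writes pre ++ ws -> r \notin all_ws.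
  by rewrite /all_ws !inE !negb_or => -> ->.
have tW : t.1 w2 = W by rewrite fta // nall.
have -> : a.+1 * W * L = (a * W + t.1 w2) * L by rewrite tW mulSn addnC.
apply: (@For_ind K x (fun b t => P ((a * W + b) * L) t)) => // [|b t' k|b t' lt_b Pt' bt' t2 ft'].
- by rewrite addn0.
- exact: P2.
have fta' : frame all_ws t t'.
  apply: frameS ft' => r; rewrite inE => /orP[/eqP ->|/sub_in //].
  by rewrite !inE eqxx orbT.
have t1' : t'.1 v1 = a.
  rewrite ft' // inE negb_or n12; exact: nin.
have [bp _ _] := eval_mono x wpre bt'.
have ftp : frame all_ws s t' by apply: frame_trans fta'.
rewrite eval_Seq addnS mulSn addnC.
apply: (@Seqs_map_ind K x A f l ws (fun q t => P ((a * W + b) * L + q) t) _ a0) => //.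
  by rewrite addn0; apply: Ppre.
move=> q u lt_q Pu bu fu; rewrite addnS; apply: (PS a b q t') => //.
by rewrite -/W -tW.
Qed.

Lemma divn_index a b q W L : b < W -> q < L ->
  [/\ ((a * W + b) * L + q) %/ L %/ W = a, ((a * W + b) * L + q) %/ L %% W = b
    & ((a * W + b) * L + q) %% L = q].
Proof.
move=> lt_b lt_q; have L0 : 0 < L by lia. have W0 : 0 < W by lia.
have -> : ((a * W + b) * L + q) %/ L = a * W + b by rewrite divnMDl // divn_small ?addn0.
by rewrite divnMDl // divn_small // addn0 modnMDl modn_small // modnMDl modn_small.
Qed.

Lemma divn_lt v T W L : v < T * W * L -> v %/ L %/ W < T /\ v %/ L %% W < W.
Proof.
move=> lt_v; have L0 : 0 < L by move: lt_v; case: L => //; rewrite muln0.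
have W0 : 0 < W by move: lt_v; case: W => //; rewrite muln0.
by split; [rewrite ltn_divLR // ltn_divLR | rewrite ltn_mod].
Qed.

Lemma index_lt a b q T W L : a < T -> b < W -> q < L -> (a * W + b) * L + q < T * W * L.
Proof.
move=> lt_a lt_b lt_q.
have h1 : a * W + b < T * W.
  by apply: (@leq_trans (a.+1 * W)); [rewrite mulSn; lia | rewrite leq_mul2r lt_a orbT].
apply: (@leq_trans ((a * W + b).+1 * L)); first by rewrite mulSn [L + _]addnC ltn_add2l.
by rewrite leq_mul2r h1 orbT.
Qed.

(** * Printing the rows of the clause vertices *)

Definition PutReg r : prog := If (CEq 17 33) (Cpy 21 r) Skip ;; Inc 33.
Definition PutInput : prog :=
  If (CEq 17 33) (If (CIn 34 true) (Cpy 21 10) (Cpy 21 9)) Skip ;; Inc 33.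

(* Registers 18, 19, 20 become t + 1, i + 1, i + 2 and register 21 becomes [init_code i]. *)
Definition Successors : prog :=
  Cpy 18 16 ;; Inc 18 ;; Cpy 19 17 ;; Inc 19 ;; Cpy 20 19 ;; Inc 20.

(** Register 33 walks along the initial row from the origin and the code is stored when it meets
    cell 17. The codes come in the order of [init_codes]: each input bit twice, the separator 01,
    then the certificate cells. *)
Definition PrepareClause : prog :=
  (Successors ;; Cpy 21 0 ;; Cpy 33 14) ;;
  For 34 2 (PutInput ;; PutInput) ;; PutReg 9 ;; PutReg 10 ;; For 34 12 (PutReg 11).

Definition CIf c a b : cond := COr (CAnd c a) (CAnd (CNot c) b).

Section ClauseProgram.
Variable M : TM.

Definition symbol_cond (g : tG M) : cond :=
  COr (CAnd (CEq 21 0) (CB (g == blank M)))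
  (COr (CAnd (CEq 21 9) (CB (g == inp M false)))
  (COr (CAnd (CEq 21 10) (CB (g == inp M true)))
       (CAnd (CEq 21 11) (CB ((g == inp M false) || (g == inp M true)))))).

Definition start_cond (s : option (content M)) : cond :=
  if s is Some (g, st) then
    CAnd (CIf (CEq 17 14) (CB (st == Some (q0 M))) (CB (st == None))) (symbol_cond g)
  else CEq 21 11.

(** Whatever depends on the machine or on contents is decided when the program is built, through
    [CB]; only indices and the initial code are compared at run time. *)
Definition lit_cond (k : kind M) (sgn : bool) (s : option (content M)) : cond :=
  let taut := CAnd (CEq 22 16) (CAnd (CEq 23 17) (CB (s == None))) in
  match k with
  | KWin a b c =>
      CIf (CAnd (CLt 18 13) (CLt 20 15))
        (if sgn then CAnd (CEq 22 16)
           (COr (CAnd (CEq 23 17) (CB (s == Some a)))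
             (COr (CAnd (CEq 23 19) (CB (s == Some b)))
                  (CAnd (CEq 23 20) (CB (s == Some c)))))
         else CAnd (CEq 22 18)
           (CAnd (CEq 23 17) (CB (s == Some (next_content a b c)))))
        taut
  | KRej s0 =>
      CIf (CAnd (CB (rejecting s0)) (CEq 18 13))
        (CAnd (CB sgn) (CAnd (CEq 22 16) (CAnd (CEq 23 17) (CB (s == Some s0)))))
        taut
  | KStart =>
      CIf (CEq 16 0)
        (CAnd (CB (~~ sgn)) (CAnd (CEq 22 16) (CAnd (CEq 23 17) (start_cond s))))
        taut
  | KMono =>
      CIf (CAnd (CEq 16 0) (CAnd (CEq 21 11) (CLt 19 15)))
        (CAnd (CEq 22 16) (CAnd (CEq 23 (if sgn then 17 else 19)) (CB (s == None))))
        taut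
  | KEnd =>
      CIf (CAnd (CEq 16 0) (CEq 21 11))
        (CAnd (CEq 22 16) (CAnd (CEq 23 17)
           (CB (s == if sgn then None else Some (blank M, None)))))
        taut
  end.

Definition ClauseEdges : prog :=
  For 30 24 (If (CLt 28 30)
    (Cpy 36 28 ;; Inc 36 ;; If (CEq 30 36) (Inc 36 ;; Emit 36) (Emit 9)) Skip).

Definition LiteralEdges k sgn : prog :=
  Grid 22 13 23 15 Skip
    [seq If (lit_cond k sgn s) (Emit 29) (Emit 9) | s <- enum {: option (content M)}].

Definition ClauseRows k : prog :=
  (ClauseEdges ;; LiteralEdges k false) ;; Inc 28 ;;
  (ClauseEdges ;; LiteralEdges k true) ;; Inc 28 ;; Inc 29.

Definition AllClauseRows : prog :=
  Grid 16 13 17 15 PrepareClause [seq ClauseRows k | k <- enum {: kind M}].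

Section ClauseCorrect.
Variables (x : seq bool) (T o W Y B : nat).

Hypothesis T0 : 0 < T.
Hypothesis oT : 2 * T <= o.
Hypothesis oW : o + 2 * T < W.
Hypothesis YW : o + size (pair_enc x [::]) + Y <= W.

Let ss := size (enum {: option (content M)}).
Let kk := size (enum {: kind M}).
Let m := T * W * kk.
Let nv := T * W * ss.

Hypothesis WB : W + 2 <= B.
Hypothesis TB : T + 2 <= B.
Hypothesis mB : 3 * m + 2 <= B.

Definition parameters (s : state) :=
  [/\ bounded s, s.1 1 = B, s.1 2 = size x, [/\ s.1 9 = 1, s.1 10 = 2 & s.1 11 = 3] &
   [/\ s.1 12 = Y, s.1 13 = T, s.1 14 = o, s.1 15 = W & s.1 24 = m.*2]].

Definition parameter_regs : seq nat := [:: 0; 1; 2; 9; 10; 11; 12; 13; 14; 15; 24].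

Lemma parameters_frame l s t : bounded t -> ~~ has (mem l) parameter_regs ->
  frame l s t -> parameters s -> parameters t.
Proof.
move=> bt /hasPn nl ft [bs s1 s2 [s9 s10 s11] [s12 s13 s14 s15 s24]].
by split => //; rewrite ?ft //; try exact: nl; split; rewrite ft //; exact: nl.
Qed.

Lemma parameters_eval p s : wf 40 p -> ~~ has (mem (writes p)) parameter_regs ->
  parameters s -> parameters (eval x p s).
Proof.
move=> wp np ps; have [bs _ _ _ _] := ps; have [bp _ _] := eval_mono x wp bs.
by apply: parameters_frame np _ ps => // r nr; rewrite eval_frame.
Qed.

(** The default 0 is the code of a blank, so cells outside the written part need no separate
    treatment. *)
Definition placed i k (t : state) :=
  t.1 33 = o + k /\
  t.1 21 = if o <= i < o + k then nth 0 (init_codes x Y) (i - o) else 0.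

Lemma size_init_codes : size (init_codes x Y) = size (pair_enc x [::]) + Y.
Proof. by rewrite size_cat size_map size_nseq. Qed.

Lemma placed_put p i k s v : parameters s -> s.1 17 = i -> placed i k s ->
  k < size (init_codes x Y) -> nth 0 (init_codes x Y) k = v ->
  (eval x p s).1 21 = v -> frame [:: 21] s (eval x p s) ->
  placed i k.+1 (eval x (If (CEq 17 33) p Skip ;; Inc 33) s).
Proof.
move=> [bs s1 _ _ _] s17 [s33 s21] lt_k nk p21 fp; rewrite size_init_codes in lt_k.
have lt_B : o + k < B by lia.
rewrite eval_Seq eval_If [ceval _ _ _]/= s17 s33.
have [Di|ni] := eqVneq i (o + k).
  rewrite eval_Inc; last by rewrite !fp // s33 s1.
  split; first by rewrite /= fp // s33 addnS.
  by rewrite /= p21 Di leq_addr addnS leqnn addKn nk.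
rewrite [eval x Skip s]/= eval_Inc; last by rewrite s33 s1.
split; first by rewrite /= s33 addnS.
by rewrite /= s21; have -> : (o <= i < o + k.+1) = (o <= i < o + k) by lia.
Qed.

Lemma nth_init_codes k : k < size (pair_enc x [::]) ->
  nth 0 (init_codes x Y) k = (onth (pair_enc x [::]) k == Some true).+1.
Proof.
move=> lt_k; rewrite nth_cat size_map lt_k (nth_map true) //; congr (nat_of_bool _).+1.
move: lt_k; elim: (pair_enc _ _) k => //= b u IH [|k] lt_k; first by case: b.
exact: IH.
Qed.

Lemma eval_Successors s t i : parameters s -> s.1 16 = t -> s.1 17 = i ->
  t < T -> i < W ->
  let s' := eval x Successors s in
  [/\ s'.1 18 = t.+1, s'.1 19 = i.+1 & s'.1 20 = i.+2].
Proof.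
move=> [_ s1 _ _ _] s16 s17 lt_t lt_i; rewrite /Successors 5!eval_Seq.
rewrite (@eval_Inc x 18 (eval x (Cpy 18 16) s)); last by rewrite /= s16 s1; lia.
rewrite (@eval_Inc x 19 (eval x (Cpy 19 17) _)); last by rewrite /= s17 s1; lia.
rewrite eval_Inc; last by rewrite /= s17 s1; lia.
by rewrite /= s16 s17.
Qed.

Lemma eval_PrepareClause s t i : parameters s -> s.1 16 = t -> s.1 17 = i ->
  t < T -> i < W ->
  let s' := eval x PrepareClause s in
  [/\ s'.1 18 = t.+1, s'.1 19 = i.+1, s'.1 20 = i.+2 & s'.1 21 = init_code x o Y i].
Proof.
move=> ps s16 s17 lt_t lt_i; rewrite /PrepareClause.
have sx : size (pair_enc x [::]) = (size x).*2 + 2 by rewrite size_pair_enc addn0.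
have szc := size_init_codes.
set pput := For 34 2 _; set p9 := PutReg 9; set p10 := PutReg 10; set p11 := For 34 12 _.
set pA := _ ;; Cpy 21 0 ;; _.
have PA := parameters_eval (isT : wf 40 pA) isT ps.
pose H (u : state) := [/\ u.1 18 = t.+1, u.1 19 = i.+1, u.1 20 = i.+2 & u.1 17 = i].
have keep p u : ~~ has (mem (writes p)) [:: 17; 18; 19; 20] -> H u -> H (eval x p u).
  by move=> /hasPn nw [h18 h19 h20 h17]; split; rewrite eval_frame //; apply: nw.
rewrite 4!eval_Seq.
have HA : H (eval x pA s).
  rewrite /pA eval_Seq; apply: keep => //.
  have [h18 h19 h20] := eval_Successors ps s16 s17 lt_t lt_i.
  by split => //; rewrite eval_frame.
have plA : placed i 0 (eval x pA s).
  have [[z0 _] _ _ _ [_ _ s14 _ _]] := ps.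
  split; rewrite /pA 2!eval_Seq.
    by rewrite -[LHS]/((eval x Successors s).1 14) eval_frame // addn0.
  rewrite addn0 (_ : (_ <= _ < _) = false); last by lia.
  by rewrite -[LHS]/((eval x Successors s).1 0) eval_frame.
move: (eval x pA s) PA HA plA => s1 PA HA plA.
have bits j u : j < size x -> parameters u -> u.1 34 = j -> u.1 17 = i ->
    forall k, k = j.*2 \/ k = j.*2.+1 ->
    placed i k u -> placed i k.+1 (eval x PutInput u).
  move=> lt_j pu u34 u17 k Dk pk; rewrite /PutInput.
  have [onj onj'] := onth_pair_enc [::] lt_j.
  have lt_k : k < size (pair_enc x [::]) by rewrite sx; lia.
  have [_ _ _ [u9 u10 _] _] := pu.
  apply: (placed_put pu u17 pk _ (nth_init_codes lt_k)).
  - by rewrite szc; lia.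
  - have -> : onth (pair_enc x [::]) k = onth x j by case: Dk => ->.
    by rewrite eval_If [ceval _ _ _]/= u34; case: eqP => _ /=; rewrite ?u9 ?u10.
  by apply: eval_frame_widen.
have Ppput := parameters_eval (isT : wf 40 pput) isT PA.
have Hput := keep pput s1 isT HA; have [_ _ _ A17] := HA.
have plput : placed i (size x).*2 (eval x pput s1).
  have [b1 _ s12 _ _] := PA.
  rewrite -s12; apply: (@For_ind 40 x (fun j u => placed i j.*2 u)) => // j u lt_j pu bu u34 fu.
  have Pu : parameters u by apply: parameters_frame fu PA.
  have u17 : u.1 17 = i by rewrite fu.
  rewrite s12 in lt_j; rewrite eval_Seq doubleS.
  have Pu' := parameters_eval (isT : wf 40 PutInput) isT Pu.
  apply: (bits j) => //; first by rewrite eval_frame.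
    by rewrite eval_frame.
    by right.
  by apply: (bits j) => //; left.
move: (eval x pput s1) Ppput plput Hput => s2 P2 pl2 H2.
have [sepF sepT] := onth_pair_enc_sep x [::].
have reg r v k u : parameters u -> u.1 17 = i -> u.1 r = v -> r \notin [:: 21; 33] ->
    k < size (init_codes x Y) -> nth 0 (init_codes x Y) k = v -> placed i k u ->
    placed i k.+1 (eval x (PutReg r) u).
  move=> pu u17 ur nr lt_k nk pk; apply: (placed_put pu u17 pk lt_k nk) => //.
  by apply: eval_frame_widen.
have P3 := parameters_eval (isT : wf 40 p9) isT P2.
have H3 := keep p9 s2 isT H2; have [_ _ _ f17] := H2.
have pl3 : placed i (size x).*2.+1 (eval x p9 s2).
  apply: (reg 9 1) => //; first by have [_ _ _ []] := P2.
    by rewrite szc; lia.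
  by rewrite nth_init_codes ?sepF // sx; lia.
move: (eval x p9 s2) P3 pl3 H3 => s3 P3 pl3 H3 {f17}.
have P4 := parameters_eval (isT : wf 40 p10) isT P3.
have H4 := keep p10 s3 isT H3; have [_ _ _ f17] := H3.
have pl4 : placed i (size x).*2.+2 (eval x p10 s3).
  apply: (reg 10 2) => //; first by have [_ _ _ []] := P3.
    by rewrite szc; lia.
  by rewrite nth_init_codes ?sepT // sx; lia.
move: (eval x p10 s3) P4 pl4 H4 => s4 P4 pl4 H4 {f17}.
have [_ _ _ f17] := H4; have [h18 h19 h20 _] := keep p11 s4 isT H4.
have [b4 _ _ _ [s412 _ _ _ _]] := P4.
have pl5 : placed i ((size x).*2.+2 + Y) (eval x p11 s4).
  rewrite -s412; apply: (@For_ind 40 x (fun j u => placed i ((size x).*2.+2 + j) u)) => //.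
    by rewrite addn0.
  move=> j u lt_j pu bu u34 fu; rewrite s412 in lt_j.
  have Pu : parameters u by apply: parameters_frame fu P4.
  rewrite addnS; apply: (reg 11 3) => //; first by rewrite fu.
  - by have [_ _ _ []] := Pu.
  - by rewrite szc; lia.
  rewrite nth_cat size_map sx ltnNge addn2 leq_addr /= addKn nth_nseq lt_j //.
have [_ p21] := pl5; split => //; rewrite p21.
rewrite /init_code; have [lt_io|le_oi] := ltnP i o; first by [].
case: ltnP => //= le_i; rewrite nth_default // szc sx; lia.
Qed.

Definition clause_registers t i (s : state) :=
  [/\ s.1 16 = t, s.1 17 = i, s.1 18 = t.+1, s.1 19 = i.+1 &
   s.1 20 = i.+2 /\ s.1 21 = init_code x o Y i].

Lemma ceval_lit_cond s t i t' i' k sgn c : parameters s -> clause_registers t i s ->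
  s.1 22 = t' -> s.1 23 = i' ->
  ceval x (lit_cond k sgn c) s = tableau_lit x T W o Y t i k sgn t' i' c.
Proof.
move=> [[s0 _] _ _ [s9 s10 s11] [s12 s13 s14 s15 s24]] [s16 s17 s18 s19 [s20 s21]] s22 s23.
have if_bool (g a b : bool) : g && a || ~~ g && b = if g then a else b.
  by case: g; rewrite ?orbF.
case: k => [[[[s1|[[a b] d]]|]|]|]; rewrite /tableau_lit /lit_cond /CIf /=;
  rewrite ?s0 ?s9 ?s10 ?s11 ?s13 ?s14 ?s15 ?s16 ?s17 ?s18 ?s19 ?s20 ?s21 ?s22 ?s23 if_bool.
- by [].
- by case: sgn; rewrite /= ?s16 ?s17 ?s18 ?s19 ?s20 ?s22 ?s23.
- by case: sgn.
- by case: sgn; rewrite /= ?s17 ?s19.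
congr (if _ then [&& _, _, _ & _] else _); rewrite /start_cond /start_content.
case: c => [[g st]|] /=; last by rewrite s21 s11.
rewrite s17 s14 s21 s0 s9 s10 s11 if_bool.
have -> : (if i == o then st == Some (q0 M) else st == None) =
    (st == if i == o then Some (q0 M) else None) by case: ifP.
congr (_ && _); have := init_code_le3 x o Y i.
by case: (init_code x o Y i) => [|[|[|[|n]]]] //= _; rewrite ?orbF.
Qed.

Lemma eval_ClauseEdges s u : parameters s -> s.1 28 = u -> u < m.*2 ->
  (eval x ClauseEdges s).2 = s.2 ++ flatten
    [seq enc_nat (if v == u.+1 then u.+2 else 1) | v <- [seq v <- iota 0 m.*2 | u < v]].
Proof.
move=> ps s28 lt_u; have [bs _ _ _ [_ _ _ _ s24]] := ps.
pose e v := enc_nat (if v == u.+1 then u.+2 else 1).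
pose P i (t : state) := t.2 = s.2 ++ flatten [seq e v | v <- [seq v <- iota 0 i | u < v]].
suff: P (s.1 24) (eval x ClauseEdges s) by rewrite s24.
apply: (@For_ind 40 x P) => //; first by rewrite /P cats0.
move=> v t lt_v Pt bt t30 ft; rewrite s24 in lt_v.
have pt : parameters t by apply: parameters_frame ft ps.
have [_ t1 _ [t9 _ _] _] := pt.
have t28 : t.1 28 = u by rewrite ft.
rewrite /P -(addn1 v) iotaD filter_cat map_cat flatten_cat catA -Pt add0n.
have -> : flatten [seq e v0 | v0 <- [seq v0 <- iota v 1 | u < v0]] = if u < v then e v else [::].
  by rewrite /=; case: ifP => _ //=; rewrite cats0.
rewrite eval_If [ceval _ _ _]/= t28 t30; case: ifP => lt_uv; last by rewrite cats0.
have b2 : bounded (eval x (Inc 36) (eval x (Cpy 36 28) t)).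
  by have [] := @eval_mono 40 x (Cpy 36 28 ;; Inc 36) t isT bt.
rewrite 2!eval_Seq; rewrite eval_Inc in b2 *; last by rewrite /= t28 t1; lia.
set t2 := setr _ 36 _ in b2 *.
rewrite eval_If (_ : ceval _ _ t2 = (v == u.+1)); last by rewrite /t2 /= t28 t30.
rewrite /e; case: eqP => [Dv|_].
  have b3 : bounded (eval x (Inc 36) t2) by have [] := @eval_mono 40 x (Inc 36) t2 isT b2.
  rewrite eval_Seq; rewrite eval_Inc in b3 *; last by rewrite /= t28 t1; lia.
  by rewrite eval_Emit //= t28.
by rewrite eval_Emit //= t9.
Qed.

Definition literal t i k sgn (v : nat) :=
  tableau_lit x T W o Y t i k sgn (v %/ ss %/ W) (v %/ ss %% W)
    (nth None (enum {: option (content M)}) (v %% ss)).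

Lemma lit_edge_writes k sgn (c : option (content M)) :
  {subset writes (If (lit_cond k sgn c) (Emit 29) (Emit 9)) <= [:: 4; 5; 6; 7; 8]}.
Proof. by apply/allP. Qed.

Lemma cwf_lit_cond k sgn (c : option (content M)) : cwf 40 (lit_cond k sgn c).
Proof.
by case: k => [[[[s1|[[a b] d]]|]|]|] //=; case: sgn => //; case: c => [[]|].
Qed.

Lemma wf_lit_edge k sgn (c : option (content M)) :
  wf 40 (If (lit_cond k sgn c) (Emit 29) (Emit 9)).
Proof. by rewrite /= cwf_lit_cond. Qed.

Lemma wf_LiteralEdges k sgn : wf 40 (LiteralEdges k sgn).
Proof.
by have [] := @wf_Grid 40 _ _ (enum {: option (content M)}) _ 22 13 23 15 Skip
  (wf_lit_edge k sgn) (@lit_edge_writes k sgn) isT isT isT isT isT.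
Qed.

Lemma writes_LiteralEdges k sgn :
  {subset writes (LiteralEdges k sgn) <= [:: 22; 23; 4; 5; 6; 7; 8]}.
Proof. exact: writes_Grid (@lit_edge_writes k sgn). Qed.

Lemma eval_LiteralEdges s t i k sgn c : parameters s -> clause_registers t i s ->
  s.1 29 = c ->
  (eval x (LiteralEdges k sgn) s).2 = s.2 ++ flatten
    [seq enc_nat (if literal t i k sgn v then c else 1) | v <- iota 0 nv].
Proof.
move=> ps cs s29; have [bs _ _ _ [_ s13 _ s15 _]] := ps.
pose e v := enc_nat (if literal t i k sgn v then c else 1).
pose P j (u : state) := u.2 = s.2 ++ flatten [seq e v | v <- iota 0 j].
suff: P (s.1 13 * s.1 15 * ss) (eval x (LiteralEdges k sgn) s) by rewrite s13 s15.
apply: (@Grid_ind 40 _ _ _ _ None [:: 4; 5; 6; 7; 8]) => //.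
- exact: wf_lit_edge.
- exact: lit_edge_writes.
- by rewrite /P cats0.
move=> a b q t0 u lt_a lt_b lt_q a22 a23 bt0 ft0 Pu bu fu; rewrite s13 s15 in lt_a lt_b *.
have pu : parameters u by apply: parameters_frame fu _ => //; apply: parameters_frame ft0 ps.
have cu : clause_registers t i u.
  have [c16 c17 c18 c19 [c20 c21]] := cs.
  by split; [| | | |split]; rewrite fu // ft0.
rewrite /P -(addn1 (_ + q)) iotaD map_cat flatten_cat catA add0n -[s.2 ++ _]/(s.2 ++ _).
rewrite s15 in Pu; rewrite -Pu /= cats0 /e /literal.
have [-> -> ->] := divn_index a lt_b lt_q.
have [_ _ _ [u9 _ _] _] := pu.
rewrite (ceval_lit_cond _ _ _ pu cu (etrans (fu 22 isT) a22) (etrans (fu 23 isT) a23)).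
have u29 : u.1 29 = c by rewrite fu // ft0.
by case: ifP => _; rewrite eval_Emit // ?u29 ?u9.
Qed.

Definition clause_lit (j : nat) (sgn : bool) (v : nat) : bool :=
  literal (j %/ kk %/ W) (j %/ kk %% W) (nth None (enum {: kind M}) (j %% kk)) sgn v.

Definition row_code u := flatten
  [seq enc_nat (clause_col m clause_lit u v) | v <- [seq v <- iota 0 (m.*2 + nv) | u < v]].

(** In a row the clause vertices come before the variables; path colours occur only in the first
    block and literal colours only in the second. *)
Lemma row_codeE j (sgn : bool) : j < m ->
  row_code (j.*2 + sgn) =
  flatten [seq enc_nat (if v == (j.*2 + sgn).+1 then (j.*2 + sgn).+2 else 1)
          | v <- [seq v <- iota 0 m.*2 | j.*2 + sgn < v]] ++
  flatten [seq enc_nat (if clause_lit j sgn v then (m.*2 + j).+1 else 1) | v <- iota 0 nv].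
Proof.
move=> lt_j; set u := j.*2 + sgn; have lt_u : u < m.*2 by rewrite /u; case: sgn {u}; lia.
rewrite /row_code iotaD filter_cat map_cat flatten_cat add0n; congr (_ ++ _); congr flatten.
  apply/eq_in_map => v; rewrite mem_filter mem_iota => /and3P[_ _ lt_v].
  rewrite /clause_col lt_v andbT; case: ifP => // _.
  by rewrite ifF //; lia.
have -> : iota m.*2 nv = map (addn m.*2) (iota 0 nv) by rewrite -iotaDl addn0.
rewrite filter_map -map_comp.
have -> : [seq v <- iota 0 nv | preim (addn m.*2) (fun v => u < v) v] = iota 0 nv.
  by apply/all_filterP/allP => v _ /=; lia.
apply: eq_map => v; rewrite /= /clause_col (_ : (_ && _) = false); last by lia.
rewrite lt_u leq_addr addKn /=.
have -> : u./2 = j by rewrite /u; case: (sgn); lia.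
by have -> : odd u = sgn by rewrite /u oddD odd_double; case: (sgn).
Qed.

Lemma eval_ClauseRow s t i k j (sgn : bool) : parameters s -> clause_registers t i s ->
  j < m -> j %/ kk %/ W = t -> j %/ kk %% W = i -> nth None (enum {: kind M}) (j %% kk) = k ->
  s.1 28 = j.*2 + sgn -> s.1 29 = (m.*2 + j).+1 ->
  (eval x (ClauseEdges ;; LiteralEdges k sgn) s).2 = s.2 ++ row_code (j.*2 + sgn).
Proof.
move=> ps cs lt_j Dt Di Dk s28 s29; rewrite row_codeE // catA eval_Seq.
have lt_u : j.*2 + sgn < m.*2 by case: (sgn); lia.
rewrite -(eval_ClauseEdges ps s28 lt_u).
have F r := @eval_frame x ClauseEdges s r.
have pe := parameters_eval (isT : wf 40 ClauseEdges) isT ps.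
have ce : clause_registers t i (eval x ClauseEdges s).
  by have [c16 c17 c18 c19 [c20 c21]] := cs; split; [| | | |split]; rewrite F.
rewrite (eval_LiteralEdges _ _ pe ce (etrans (F 29 isT) s29)).
by rewrite /clause_lit Dt Di Dk.
Qed.

Definition row_writes : seq nat := [:: 4; 5; 6; 7; 8; 22; 23; 28; 29; 30; 36].

Lemma writes_ClauseRows k : {subset writes (ClauseRows k) <= row_writes}.
Proof.
have lit sgn : {subset writes (LiteralEdges k sgn) <= row_writes}.
  by move=> r /writes_LiteralEdges; move: r; apply/allP.
have incs r : r \in [:: 28; 29] -> {subset writes (Inc r) <= row_writes}.
  by move=> hr q; rewrite inE => /eqP ->; move: r hr; apply/allP.
by do !apply: writes_SeqS; first [exact: lit | exact: incs | by apply/allP].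
Qed.

Lemma wf_ClauseRows k : wf 40 (ClauseRows k).
Proof. by rewrite /ClauseRows 6!wf_Seq !wf_LiteralEdges. Qed.

Lemma wf_AllClauseRows : wf 40 AllClauseRows.
Proof.
by have [] := @wf_Grid 40 _ _ (enum {: kind M}) _ 16 13 17 15 PrepareClause
  wf_ClauseRows writes_ClauseRows isT isT isT isT isT.
Qed.

Lemma writes_AllClauseRows : {subset writes AllClauseRows <=
  [:: 16, 17 & writes PrepareClause ++ row_writes]}.
Proof. exact: writes_Grid writes_ClauseRows. Qed.

Lemma eval_AllClauseRows s : parameters s -> s.1 28 = 0 -> s.1 29 = m.*2.+1 ->
  (eval x AllClauseRows s).2 = s.2 ++ flatten [seq row_code u | u <- iota 0 m.*2].
Proof.
move=> ps s28 s29; have [bs s1 _ _ [_ s13 _ s15 _]] := ps.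
pose P j (u : state) := [/\ u.1 28 = j.*2, u.1 29 = (m.*2 + j).+1 &
  u.2 = s.2 ++ flatten [seq row_code v | v <- iota 0 j.*2]].
suff: P (s.1 13 * s.1 15 * kk) (eval x AllClauseRows s) by rewrite s13 s15 => -[].
apply: (@Grid_ind 40 _ _ _ _ None row_writes) => //.
- exact: wf_ClauseRows.
- exact: writes_ClauseRows.
- by split; rewrite ?addn0 // cats0.
- by move=> j t [h28 h29 ho]; split; rewrite ?eval_frame // eval_silent.
move=> a b q t0 u lt_a lt_b lt_q a16 a17 bt0 ft0 [u28 u29 uo] bu fu.
rewrite s13 s15 in lt_a lt_b u28 u29 uo *.
set k := nth _ _ _; set j := (a * W + b) * kk + q in u28 u29 uo *.
have [Da Db Dq] := divn_index a lt_b lt_q.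
have lt_j : j < m := index_lt lt_a lt_b lt_q.
have p0 : parameters t0 by apply: parameters_frame ft0 ps.
have pp : parameters (eval x PrepareClause t0) by apply: parameters_eval.
have pu : parameters u by apply: parameters_frame fu pp.
have [c18 c19 c20 c21] := eval_PrepareClause p0 a16 a17 lt_a lt_b.
have cu : clause_registers a b u.
  by split; [| | | |split]; rewrite fu // eval_frame.
have [_ e1 _ _ _] := pu.
rewrite /ClauseRows 4!eval_Seq; set r1 := _ ;; LiteralEdges k false; set r2 := _ ;; LiteralEdges k true.
have subr sgn : {subset writes (ClauseEdges ;; LiteralEdges k sgn) <=
    [:: 4; 5; 6; 7; 8; 22; 23; 30; 36]}.
  apply: writes_SeqS; first by apply/allP.
  by move=> r /writes_LiteralEdges; move: r; apply/allP.
have wr sgn : wf 40 (ClauseEdges ;; LiteralEdges k sgn) by rewrite wf_Seq wf_LiteralEdges.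
have o1 := eval_ClauseRow (sgn := false) pu cu lt_j Da Db (congr1 _ Dq).
rewrite addn0 -/k in o1; have {}o1 := o1 u28 u29.
have F1 := eval_frameS x u (subr false).
have [b1 _ _] := eval_mono x (wr false) bu.
have p1 : parameters (eval x r1 u) by apply: parameters_frame F1 pu.
move: (eval x r1 u) o1 F1 b1 p1 => v1 o1 F1 b1 p1.
have i1 : eval x (Inc 28) v1 = setr v1 28 j.*2.+1.
  by rewrite eval_Inc; rewrite !F1 // u28 // e1; lia.
rewrite i1; have b2 : bounded (setr v1 28 j.*2.+1).
  by apply: bounded_setr; rewrite //= F1 // e1; lia.
set v2 := setr _ _ _.
have p2 : parameters v2.
  by apply: (@parameters_frame [:: 28] v1) => // r; rewrite inE /v2 /= => /negbTE ->.
have c2 : clause_registers a b v2.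
  have [c16 c17 c18' c19' [c20' c21']] := cu.
  by split; [| | | |split]; rewrite /v2 /= F1.
have o2 := eval_ClauseRow (sgn := true) p2 c2 lt_j Da Db (congr1 _ Dq).
rewrite addn1 -/k in o2; have {}o2 := o2 erefl (etrans (F1 29 isT) u29).
have F2 := eval_frameS x v2 (subr true).
move: (eval x r2 v2) o2 F2 => v3 o2 F2.
have f28 : v3.1 28 = j.*2.+1 by rewrite F2.
have f29 : v3.1 29 = (m.*2 + j).+1 by rewrite F2 // /v2 /= F1.
have f1 : v3.1 1 = B by rewrite F2 // /v2 /= F1.
rewrite (@eval_Inc x 28 v3); last by rewrite f28 f1; lia.
rewrite eval_Inc; last by rewrite /= f29 f1; lia.
have iotaSS : iota 0 j.+1.*2 = iota 0 j.*2 ++ [:: j.*2; j.*2.+1].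
  by rewrite doubleS -addn2 iotaD.
split; [by rewrite /= f28 doubleS | by rewrite /= f29 addnS | ].
rewrite iotaSS map_cat flatten_cat [LHS]/= o2 /v2 /= o1 uo -!catA.
by rewrite cats0.
Qed.

End ClauseCorrect.
End ClauseProgram.

(** For an argument of at least 3 a boost multiplies by at least 4, so successive boosts of [T]
    provide the margins of the tableau. *)
Lemma boostf_margins n T Y : n + 3 <= T -> Y <= T ->
  [/\ 0 < T, 2 * T <= boostf T, boostf T + 2 * T < boostf (boostf T)
    & boostf T + (n.*2 + 2) + Y <= boostf (boostf T)].
Proof.
move=> le_nT le_YT.
have hT : 2 * T <= boostf T.
  by rewrite /boostf mul2n -addnn leq_add2l leq_pmulr //; lia.
have ho : 4 * boostf T <= boostf (boostf T).
  rewrite {2}/boostf -{2}(mul1n (boostf T)) -mulnDl leq_mul2r.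
  by apply/orP; right; lia.
by split; lia.
Qed.

(** * The reduction and its output *)

Definition Count r c : prog := Grid 16 13 17 15 Skip [seq Incs r c | _ <- [:: tt]].

Section CountCorrect.
Variables (r c : nat).
Hypothesis hr : (17 < r <= 40).

Let wI (u : unit) : wf 40 (Incs r c).
Proof. by apply: wf_Incs; lia. Qed.

Let sI (u : unit) : {subset writes (Incs r c) <= [:: r]}.
Proof. exact: writes_Incs. Qed.

Let nr : all (fun q => q \notin writes Skip ++ [:: r]) [:: 16; 17; 13; 15].
Proof. by rewrite /= !inE; lia. Qed.

Lemma wf_Count : wf 40 (Count r c).
Proof. by have [] := @wf_Grid 40 _ _ [:: tt] _ 16 13 17 15 Skip wI sI isT isT isT isT nr. Qed.

Lemma writes_Count : {subset writes (Count r c) <= [:: 16; 17; r]}.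
Proof. exact: (writes_Grid (l := [:: tt]) sI). Qed.

Lemma silent_Count : silent (Count r c).
Proof. by rewrite /= silent_Incs. Qed.

Lemma eval_Count x s : bounded s -> s.1 r = 0 ->
  (eval x (Count r c) s).1 r = minn (s.1 1) (s.1 13 * s.1 15 * c).
Proof.
move=> bs sr; pose P j (t : state) := t.1 r = minn (s.1 1) (j * c).
have n16 : (r == 16) = false by lia. have n17 : (r == 17) = false by lia.
suff: P (s.1 13 * s.1 15 * 1) (eval x (Count r c) s) by rewrite /P muln1.
apply: (@Grid_ind 40 x _ _ [:: tt] tt _ 16 13 17 15 Skip P s wI sI isT isT isT isT nr bs) => //.
- by move=> j t k; rewrite /P /= n16.
- by move=> j t k; rewrite /P /= n17.
move=> a b q t0 t _ _ _ _ _ b0 f0 Pt bt ft.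
have e1 : t.1 1 = s.1 1.
  by rewrite ft ?f0 //= !inE; lia.
rewrite /P eval_Incs ?e1; last by have := bt.2 r; rewrite e1.
  by rewrite Pt mulSn; lia.
by lia.
Qed.

End CountCorrect.

Section Reduction.
Variable M : TM.

Let ss := size (enum {: option (content M)}).
Let kk := size (enum {: kind M}).

Definition Counts : prog :=
  Count 24 (2 * kk) ;; Count 25 ss ;; Count 27 (3 * kk) ;; AddReg 37 26 24 25.

(** The clause rows exhaust the edges that meet a clause vertex. The remaining edges join two
    variables and get the dummy colour in the last loop. *)
Definition Reduction c r1 r2 : prog :=
  Setup c r1 r2 ;; Counts ;; Emit 26 ;; Emit 27 ;; (Cpy 29 24 ;; Inc 29) ;;
  AllClauseRows M ;; PairLoop 31 32 25 (Emit 9).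

Lemma wf_Reduction c r1 r2 : wf 40 (Reduction c r1 r2).
Proof.
have wC : wf 40 Counts.
  exact: (introT and4P (And4 (@wf_Count 24 (2 * kk) isT) (@wf_Count 25 ss isT)
    (@wf_Count 27 (3 * kk) isT) (isT : wf 40 (AddReg 37 26 24 25)))).
have wR : wf 40 (AllClauseRows M) && wf 40 (PairLoop 31 32 25 (Emit 9)).
  by rewrite wf_AllClauseRows.
exact: (introT and3P (And3 (wf_Setup c r1 r2) wC wR)).
Qed.

Lemma eval_ones_pairs K x u v n r s : wf K (PairLoop u v n (Emit r)) ->
  r \notin [:: 4; 5; 6; 7; 8] -> u \notin writes (Emit r) -> r \notin [:: u; v] ->
  bounded s ->
  (eval x (PairLoop u v n (Emit r)) s).2 =
  s.2 ++ flatten [seq enc_nat (s.1 r) | _ <- pairs (s.1 n)].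
Proof.
move=> wl nr nu nuv bs.
pose Inv (D : seq (nat * nat)) (t : state) :=
  t.2 = s.2 ++ flatten [seq enc_nat (s.1 r) | _ <- D].
apply: (@PairLoop_ind K x Inv) => //; first by rewrite /Inv cats0.
move=> D a b t _ It bt _ _ _ ft.
rewrite /Inv map_rcons flatten_rcons catA -It eval_Emit // ft //.
rewrite writes_Emit; move: nr nuv; rewrite !inE !negb_or.
by move=> /and5P[-> -> -> -> ->] /andP[-> ->].
Qed.

Lemma flatten_map_flatten (A C D : Type) (f : C -> seq D) (g : A -> seq C) l :
  flatten [seq f a | a <- flatten [seq g u | u <- l]] =
  flatten [seq flatten [seq f a | a <- g u] | u <- l].
Proof. by elim: l => //= u l IH; rewrite map_cat flatten_cat IH. Qed.

Lemma enc_coloring col n : flatten [seq enc_nat k | k <- coloring col n] =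
  flatten [seq flatten [seq enc_nat (col u v) | v <- [seq v <- iota 0 n | u < v]]
          | u <- iota 0 n].
Proof.
rewrite /coloring -map_comp /pairs /allpairs_dep flatten_map_flatten; congr flatten.
by apply: eq_map => u; rewrite -map_comp.
Qed.

Section ReductionCorrect.
Variables (x : seq bool) (c r1 r2 : nat).
Let n := size x.
Let T := iter r1 boostf (n + 3).
Let o := boostf T.
Let W := boostf o.
Let Y := pbound c n.
Let B := iter r2 boostf W.
Let m := T * W * kk.
Let nv := T * W * ss.
Let u0 := pair_enc x [::].

Hypothesis pT : (n + 2) ^ c <= T.
Hypothesis YT : Y <= T.
Hypothesis mB : 3 * m + nv + W + 2 <= B.

Definition reduction_coloring := coloring (clause_col m (@clause_lit M x T o W Y)) (m.*2 + nv).

Lemma eval_Reduction : let s := eval x (Reduction c r1 r2) (state0 x) in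
  s.2 = enc_instance (m.*2 + nv) (3 * m) reduction_coloring /\ s.1 1 = B.
Proof.
have [T0 oT oW YW] := boostf_margins (iter_boostf_ge r1 (n + 3)) YT.
rewrite -/T -/o -/W in T0 oT oW YW.
have {}YW : o + size u0 + Y <= W by rewrite /u0 size_pair_enc addn0.
have [bs s1 so fs [s9 s10 s11 [s12 s13 s14 s15]]] := eval_Setup r2 pT YT.
rewrite /Reduction 6!eval_Seq.
move: (eval x (Setup c r1 r2) (state0 x)) bs s1 so fs s9 s10 s11 s12 s13 s14 s15.
move=> s bs s1 so fs s9 s10 s11 s12 s13 s14 s15.
rewrite -/T -/o -/W -/B -/Y -/n in s1 s12 s13 s14 s15.
have s24 : s.1 24 = 0 by rewrite fs.
have s25 : s.1 25 = 0 by rewrite fs.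
have s27 : s.1 27 = 0 by rewrite fs.
have s28 : s.1 28 = 0 by rewrite fs.
rewrite /Counts (eval_Seq x (Count 24 _)) (eval_Seq x (Count 25 _)) (eval_Seq x (Count 27 _)).
have C1 := @eval_Count 24 (2 * kk) isT x s bs s24.
have F1 := eval_frameS x s (@writes_Count 24 (2 * kk)).
have [b1 _ _] := eval_mono x (@wf_Count 24 (2 * kk) isT) bs.
have o1 := eval_silent x s (silent_Count 24 (2 * kk)).
move: (eval x (Count 24 _) s) C1 F1 b1 o1 => t1 C1 F1 b1 o1.
have C2 := @eval_Count 25 ss isT x t1 b1 (etrans (F1 25 isT) s25).
have F2 := eval_frameS x t1 (@writes_Count 25 ss).
have [b2 _ _] := eval_mono x (@wf_Count 25 ss isT) b1.
have o2 := eval_silent x t1 (silent_Count 25 ss).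
move: (eval x (Count 25 _) t1) C2 F2 b2 o2 => t2 C2 F2 b2 o2.
have C3 := @eval_Count 27 (3 * kk) isT x t2 b2 (etrans (F2 27 isT) (etrans (F1 27 isT) s27)).
have F3 := eval_frameS x t2 (@writes_Count 27 (3 * kk)).
have [b3 _ _] := eval_mono x (@wf_Count 27 (3 * kk) isT) b2.
have o3 := eval_silent x t2 (silent_Count 27 (3 * kk)).
move: (eval x (Count 27 _) t2) C3 F3 b3 o3 => t3 C3 F3 b3 o3.
have C4 := @eval_AddReg x 37 26 24 25 t3 isT isT b3.
have F4 := @eval_frame_widen x (AddReg 37 26 24 25) [:: 26; 37] t3 isT.
have [b4 _ _] := @eval_mono 40 x (AddReg 37 26 24 25) t3 isT b3.
have o4 := @eval_silent x (AddReg 37 26 24 25) t3 isT.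
move: (eval x (AddReg 37 26 24 25) t3) C4 F4 b4 o4 => t4 C4 F4 b4 o4.
have mE : T * W * (2 * kk) = m.*2 by rewrite mulnCA mul2n.
have pE : T * W * (3 * kk) = 3 * m by rewrite mulnCA.
have h24 : t3.1 24 = m.*2.
  by rewrite F3 // F2 // C1 s1 s13 s15 mE; lia.
have h25 : t3.1 25 = nv.
  by rewrite F3 // C2 !F1 // s1 s13 s15 -/nv; lia.
have h27 : t3.1 27 = 3 * m.
  by rewrite C3 !F2 // !F1 // s1 s13 s15 pE; lia.
have h26 : t4.1 26 = m.*2 + nv.
  by rewrite C4 h24 h25 F3 // F2 // F1 // s1; lia.
have p4 : parameters M x T o W Y B t4.
  have keep q : q \notin [:: 16; 17; 24; 25; 26; 27; 37] -> t4.1 q = s.1 q.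
    rewrite !inE !negb_or => hq.
    by rewrite F4 ?F3 ?F2 ?F1 // !inE; lia.
  apply: And5 => //.
  - by rewrite keep.
  - by rewrite keep // fs.
  - by apply: And3; rewrite keep.
  by apply: And5; [rewrite keep | rewrite keep | rewrite keep | rewrite keep | rewrite F4].
have o4' : t4.2 = [::] by rewrite o4 o3 o2 o1.
have g28 : t4.1 28 = 0 by rewrite F4 // F3 // F2 // F1.
have g25 : t4.1 25 = nv by rewrite F4.
have g27 : t4.1 27 = 3 * m by rewrite F4.
have g24 : t4.1 24 = m.*2 by rewrite F4.
have F5 := @eval_frame_widen x (Emit 26) [:: 4; 5; 6; 7; 8] t4 isT.
have p5 := parameters_eval (isT : wf 40 (Emit 26)) isT p4.
have o5 := @eval_Emit x 26 t4 isT b4; rewrite h26 o4' cat0s in o5.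
move: (eval x (Emit 26) t4) F5 p5 o5 => t5 F5 p5 o5.
have [b5 _ _ _ _] := p5.
have F6 := @eval_frame_widen x (Emit 27) [:: 4; 5; 6; 7; 8] t5 isT.
have p6 := parameters_eval (isT : wf 40 (Emit 27)) isT p5.
have o6 := @eval_Emit x 27 t5 isT b5; rewrite F5 // g27 o5 in o6.
move: (eval x (Emit 27) t5) F6 p6 o6 => t6 F6 p6 o6.
have F7 := @eval_frame_widen x (Cpy 29 24 ;; Inc 29) [:: 29] t6 isT.
have p7 := parameters_eval (isT : wf 40 (Cpy 29 24 ;; Inc 29)) isT p6.
have o7 := @eval_silent x (Cpy 29 24 ;; Inc 29) t6 isT.
have g29 : (eval x (Cpy 29 24 ;; Inc 29) t6).1 29 = m.*2.+1.
  have [_ e1 _ _ [_ _ _ _ e24]] := p6.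
  by rewrite eval_Seq eval_Inc; rewrite /= e24 // e1; lia.
move: (eval x (Cpy 29 24 ;; Inc 29) t6) F7 p7 o7 g29 => t7 F7 p7 o7 g29.
have k28 : t7.1 28 = 0 by rewrite F7 // F6 // F5.
have mB' : 3 * (T * W * size (enum {: kind M})) + 2 <= B.
  by rewrite -/kk -/m; lia.
have WB : W + 2 <= B by lia.
have TB : T + 2 <= B by lia.
have o8 := eval_AllClauseRows T0 oT oW YW WB TB mB' p7 k28 g29.
have F8 := eval_frameS x t7 (@writes_AllClauseRows M).
have [b7 _ _ _ _] := p7.
have [b8 _ _] := eval_mono x (@wf_AllClauseRows M) b7.
move: (eval x (AllClauseRows M) t7) o8 F8 b8 => t8 o8 F8 b8.
have h8 : t8.1 25 = nv by rewrite F8 // F7 // F6 // F5.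
have h9 : t8.1 9 = 1 by rewrite F8 //; have [_ _ _ []] := p7.
have h1 : t8.1 1 = B by rewrite F8 //; have [] := p7.
split; last by rewrite eval_frame.
have -> k l cs : enc_instance k l cs = enc_nat k ++ enc_nat l ++ flatten (map enc_nat cs) by [].
rewrite (@eval_ones_pairs 40) // h8 h9 o8 o7 o6 -[LHS]catA [RHS]catA; congr (_ ++ _).
rewrite /reduction_coloring enc_coloring iotaD map_cat flatten_cat.
rewrite -[iota 0 _ in X in X ++ _]/(iota 0 m.*2) add0n; congr (_ ++ _).
  by rewrite /row_code iotaD add0n.
(* Shifted by [m.*2], the pairs of variable vertices become [pairs nv], over which the last loop
   runs. *)
have shift : iota m.*2 nv = map (addn m.*2) (iota 0 nv) by rewrite -iotaDl addn0.
rewrite /pairs /allpairs_dep flatten_map_flatten shift -map_comp; congr flatten.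
apply/eq_in_map => u _ /=; rewrite filter_cat map_cat flatten_cat.
have -> : [seq v <- iota 0 m.*2 | m.*2 + u < v] = [::].
  apply/eqP; rewrite -[_ == _]negbK -has_filter; apply/hasPn => v; rewrite mem_iota; lia.
rewrite filter_map -!map_comp /=; congr flatten.
have -> : [seq v <- iota 0 nv | preim (addn m.*2) (leq (m.*2 + u).+1) v] = [seq v <- iota 0 nv | u < v].
  by apply: eq_filter => v /=; rewrite -addnS leq_add2l.
apply: eq_map => v /=; rewrite /clause_col ifF; last by lia.
by rewrite ifF //; lia.
Qed.

End ReductionCorrect.
End Reduction.

(** * Hardness *)

Lemma bits_inj : injective bits.
Proof.
pose val := foldr (fun (b : bool) v => b + v.*2) 0.
suff can k : val (bits k) = k by move=> a b /(congr1 val); rewrite !can.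
elim/ltn_ind: k => k IH; rewrite bitsE; case: eqP => [-> //|k0] /=.
by rewrite IH ?odd_double_half //; lia.
Qed.

(** A doubled bit is never 01, so the terminator is recognised at an even offset and the code is
    prefix-free. *)
Lemma enc_nat_inj a b s t : enc_nat a ++ s = enc_nat b ++ t -> a = b /\ s = t.
Proof.
rewrite /enc_nat -!catA => E.
suff [/bits_inj -> ->] : bits a = bits b /\ s = t by [].
elim: (bits a) (bits b) E => [|c l IH] [|d l'] /=.
- by case.
- by case: d.
- by case: c.
by move=> [-> _ /IH[-> ->]].
Qed.

Lemma enc_nats_inj : injective enc_nats.
Proof.
have nz k s : enc_nat k ++ s <> [::] by rewrite /enc_nat -catA; case: (flatten _).
elim=> [|a s IH] [|b t] //; rewrite /enc_nats /= ?[RHS]/=.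
- by move/esym/nz.
- by move/nz.
by move=> /enc_nat_inj[-> /IH ->].
Qed.

(** Injectivity of the encoding keeps an encoded instance from entering the language on behalf of
    another instance. *)
Lemma ColorfulCut_complete_enc n p cs : valid_coloring n p cs ->
  ColorfulCut_complete (enc_instance n p cs) <-> colorful_cut n p cs.
Proof.
move=> vc; split => [[n' [p' [cs' [/enc_nats_inj[-> -> ->] [_ //]]]]]|cc].
by exists n, p, cs.
Qed.

Lemma boostf_square e : e ^ 2 <= boostf e.
Proof. by rewrite -mulnn leq_addl. Qed.

Lemma iter_boostf_pow r e : e ^ (2 ^ r) <= iter r boostf e.
Proof.
elim: r => [|r IH] /=; first by rewrite expn1.
apply: leq_trans (boostf_square _); rewrite expnSr expnM.
by rewrite leq_exp2r.
Qed.

Lemma poly_bounded_boosts r f :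
  poly_bounded f -> poly_bounded (fun n => iter r boostf (f n)).
Proof. by move=> pf; elim: r => //= r IH; apply: poly_boundedD IH (poly_boundedM IH IH). Qed.

(** After [d] boosts the exponent is [2 ^ d], which exceeds [d]; the base [n + 3] is the bound left
    by the three [Grow] of the set-up. *)
Lemma boosts_dominate f : poly_bounded f -> exists r, forall n, f n <= iter r boostf (n + 3).
Proof.
move=> [d H]; exists d => n; apply: leq_trans (H n) (leq_trans _ (iter_boostf_pow _ _)).
apply: (@leq_trans ((n + 3) ^ d)).
  by case: (d) => // e; rewrite leq_exp2r //; lia.
apply: leq_pexp2l; first by lia.
exact: ltnW (ltn_expl _ _).
Qed.

(** As [C < 2 ^ C <= W ^ C] for positive [C], a constant factor is paid for by a larger exponent. *)
Lemma boosts_const C : exists r, forall W, 2 <= W -> C * W ^ 2 <= iter r boostf W.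
Proof.
exists C.+2 => W W2; apply: leq_trans (iter_boostf_pow _ _).
apply: (@leq_trans (W ^ C * W ^ 2)).
  rewrite leq_mul2r; apply/orP; right.
  by apply: leq_trans (ltnW (ltn_expl C (isT : 1 < 2))) _; case: (C) => // c; rewrite leq_exp2r.
rewrite -expnD leq_pexp2l ?(ltnW W2) // addn2.
exact: ltnW (ltn_expl _ _).
Qed.

(** The last row of the tableau has a fixed time, whereas the halting time depends on the
    certificate. *)
Lemma halted_run (M : TM) k j w : k <= j -> haltst M (cstate (run M k w)) <> None ->
  run M j w = run M k w.
Proof.
move=> le_kj; rewrite -(subnK le_kj); elim: (j - k) => // i IH h.
have -> : run M (i.+1 + k) w = step (run M (i + k) w) by [].
by rewrite IH //; case: (run M k w) h => -[[q l] a] r /=; case: haltst.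
Qed.

Section Hardness.
Variables (M : TM) (x : seq bool) (T o W Y : nat).
Let ss := size (enum {: option (content M)}).
Let kk := size (enum {: kind M}).
Let m := T * W * kk.
Let nv := T * W * ss.

Lemma enum_nth_index (A : finType) (a a0 : A) :
  index a (enum {: A}) < size (enum {: A}) /\ nth a0 (enum {: A}) (index a (enum {: A})) = a.
Proof. by split; [rewrite index_mem mem_enum | rewrite nth_index // mem_enum]. Qed.

(** Clauses and variables are numbered in mixed radix; quotients and remainders recover the
    triples. *)
Lemma satisfies_clause_lit :
  (exists a : nat -> bool, forall j, j < m -> exists sgn v,
     [/\ v < nv, @clause_lit M x T o W Y j sgn v & a v = ~~ sgn]) <->
  (exists X, @satisfies M x T W o Y X).
Proof.
pose opt v := nth None (enum {: option (content M)}) (v %% ss).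
split => [[a sat]|[X sat]].
  exists (fun t i s => a ((t * W + i) * ss + index s (enum {: option (content M)}))).
  move=> t i k lt_t lt_i.
  have [lt_q nq] := enum_nth_index k None.
  have [sgn [v [lt_v hl av]]] := sat _ (index_lt lt_t lt_i lt_q).
  have [Dt Di Dq] := divn_index t lt_i lt_q.
  rewrite /clause_lit -/kk Dt Di Dq nq /literal -/ss in hl.
  have [lt_t' lt_i'] := divn_lt lt_v.
  exists sgn, (v %/ ss %/ W), (v %/ ss %% W), (opt v); split => //.
  have s0 : 0 < ss by move: lt_v; rewrite /nv; case: (ss) => //; rewrite muln0.
  by rewrite /opt index_uniq ?enum_uniq ?ltn_mod // -!divn_eq.
exists (fun v => X (v %/ ss %/ W) (v %/ ss %% W) (opt v)) => j lt_j.
have [lt_t lt_i] := divn_lt lt_j.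
have [sgn [t' [i' [s' [lt_t' lt_i' hl Xs]]]]] :=
  sat _ _ (nth None (enum {: kind M}) (j %% kk)) lt_t lt_i.
have [lt_q nq] := enum_nth_index s' None.
have [Dt Di Dq] := divn_index t' lt_i' lt_q.
exists sgn, ((t' * W + i') * ss + index s' (enum {: option (content M)})); split.
- exact: index_lt.
- by rewrite /clause_lit /literal -/ss Dt Di Dq nq.
by rewrite /opt Dt Di Dq nq.
Qed.

End Hardness.

Theorem ColorfulCut_complete_NP_hard : NP_hard ColorfulCut_complete.
Proof.
move=> L [V [c [[M [cM dec]] Lspec]]].
pose kk := size (enum {: kind M}); pose ss := size (enum {: option (content M)}).
(* The summands serve the powers in the set-up, the certificate bound and the running time on pairs;
   the last 1 is there because the last row has time [T - 1]. *)
have [r1 Hr1] : exists r, forall n, (n + 2) ^ c + pbound c n +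
    pbound cM (2 * n + 2 + pbound c n) + 1 <= iter r boostf (n + 3).
  apply: boosts_dominate.
  have pY := poly_bounded_pbound c poly_bounded_id.
  have p2 := poly_boundedD poly_bounded_id (poly_bounded_const 2).
  apply: poly_boundedD (poly_bounded_const 1); apply: poly_boundedD.
    exact: poly_boundedD (poly_boundedX c p2) pY.
  apply: poly_bounded_pbound; apply: poly_boundedD pY.
  exact: poly_boundedD (poly_boundedM (poly_bounded_const 2) poly_bounded_id) (poly_bounded_const 2).
(* The terms [3 * kk] and [ss] come from the number of colours and of variables; 3 covers the
   remaining [W + 2]. *)
have [r2 Hr2] := boosts_const (3 * kk + ss + 3).
pose T (x : seq bool) := iter r1 boostf (size x + 3).
pose o x := boostf (T x); pose W x := boostf (o x).
pose m x := T x * W x * kk; pose nv x := T x * W x * ss.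
have hyps x : [/\ (size x + 2) ^ c <= T x, pbound c (size x) <= T x,
    3 * m x + nv x + W x + 2 <= iter r2 boostf (W x) &
    pbound cM (2 * size x + 2 + pbound c (size x)) <= (T x).-1].
  have h1 := Hr1 (size x); rewrite -/(T x) in h1.
  have hT : size x + 3 <= T x by exact: iter_boostf_ge.
  have hW : T x <= W x by apply: leq_trans (boostf_ge _) (boostf_ge _).
  have h2 := Hr2 (W x) (leq_trans (leq_trans _ hT) hW).
  split; try lia.
  apply: leq_trans (h2 _); last by lia.
  have hTW : T x * W x <= W x ^ 2 by rewrite -mulnn leq_mul2r hW orbT.
  have hk : m x <= W x ^ 2 * kk by rewrite leq_mul2r hTW orbT.
  have hs : nv x <= W x ^ 2 * ss by rewrite leq_mul2r hTW orbT.
  have hWW : W x <= W x ^ 2 by rewrite -mulnn leq_pmulr //; lia.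
  have hW2 : 2 <= W x ^ 2 by apply: leq_trans hWW; lia.
  rewrite (mulnDl (3 * kk + ss)) (mulnDl (3 * kk)) -(mulnA 3 kk) (mulnC kk) (mulnC ss).
  apply: (@leq_trans (3 * (W x ^ 2 * kk) + W x ^ 2 * ss + (W x ^ 2 + W x ^ 2))); last by lia.
  by rewrite -addnA; apply: leq_add; apply: leq_add => //; rewrite leq_mul2l.
have [||M' [cR HM]] := @poly_prog_TM 40 (Reduction M c r1 r2)
  (fun n => iter r2 boostf (boostf (boostf (iter r1 boostf (n + 3))))) isT (wf_Reduction _ _ _ _).
- apply: poly_bounded_boosts; apply: (@poly_bounded_boosts 2); apply: poly_bounded_boosts.
  exact: poly_boundedD poly_bounded_id (poly_bounded_const 3).
- by move=> x; have [h1 h2 h3 _] := hyps x; have [_ ->] := eval_Reduction h1 h2 h3.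
exists (fun x => (eval x (Reduction M c r1 r2) (state0 x)).2); split.
  by exists M', cR => x; have [k [le_k hk ok]] := HM x; exists k; rewrite hk.
move=> x; have [h1 h2 h3 h4] := hyps x.
have [-> _] := eval_Reduction h1 h2 h3.
have hT : size x + 3 <= T x := iter_boostf_ge _ _.
have m1 : 1 < m x.
  have kk0 : 0 < kk by rewrite /kk -cardE; apply/card_gt0P; exists None.
  have hTW : T x <= T x * W x.
    have hW : T x <= W x := leq_trans (boostf_ge _) (boostf_ge _).
    by rewrite leq_pmulr //; lia.
  have hm : T x * W x <= m x by rewrite leq_pmulr.
  lia.
rewrite ColorfulCut_complete_enc; last exact: clause_col_valid (ltnW m1).
rewrite clause_colP // satisfies_clause_lit.
have [T0 oT oW YW] := boostf_margins hT h2.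
have {}YW : o x + size (pair_enc x [::]) + pbound c (size x) <= W x.
  by rewrite size_pair_enc addn0.
rewrite (@tableauP M x (T x) (W x) (o x) (pbound c (size x)) T0 oT oW YW V).
  by rewrite Lspec; split => [[y [le_y Vy]]|[y le_y Vy]]; exists y.
move=> y le_y; have [k [le_k [b [hb bV]]]] := dec (pair_enc x y).
exists b => //; rewrite (@halted_run _ k) ?hb //.
apply: leq_trans le_k (leq_trans _ h4); rewrite /pbound leq_add2r leq_mul2l; apply/orP; right.
case: (cM) => // e; rewrite leq_exp2r // size_pair_enc; rewrite /pbound in le_y; lia.
Qed.

Theorem theorem2 : NP_complete ColorfulCut_complete.
Proof. by split; [exact: ColorfulCut_complete_inNP | exact: ColorfulCut_complete_NP_hard]. Qed.
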